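(* Let $E=A\#_fH$ be a crossed product with convolution invertible cocycle $f$, let $M$ be an $E$-bimodule, and let $S$ be a separable subalgebra of $A$ such that $f(h,l)\in S$ for all $h,l\in H$. Put $\widetilde A=A/S$, $\widetilde A^0=S$ and $\widetilde A^r=\widetilde A\otimes_S\cdots\otimes_S\widetilde A$ ($r$ times) for $r>0$, and let $(M\otimes_S\widetilde A^*\otimes_S,b_* )$ be the complex with left $H$-action described in the context. Then the Hochschild homology $H_*(E,M)$ of $E$ with coefficients in $M$ is the homology of $H$ with coefficients in the chain complex $(M\otimes_S\widetilde A^*\otimes_S,b_* )$.
   Context: $k$ is a commutative ring with unit, $\otimes=\otimes_k$, $H$ is a Hopf algebra with counit $\epsilon$, antipode (denoted $\mathcal S$ here) and Sweedler notation $\Delta(h)=h^{(1)}\otimes h^{(2)}$ (sum understood), $A$ is a $k$-algebra. A weak action of $H$ on $A$ is a bilinear map $(h,a)\mapsto a^h$, $H\times A\to A$, with $(ab)^h=a^{h^{(1)}}b^{h^{(2)}}$, $1^h=\epsilon(h)1$, $a^1=a$. Given a weak action and a $k$-linear map $f:H\otimes H\to A$, $A\#_fH$ is $A\otimes H$ (elements written $a\#h$) with product $(a\#h)(b\#l)=ab^{h^{(1)}}f(h^{(2)},l^{(1)})\#h^{(3)}l^{(2)}$; it is called a crossed product if it is associative with unit $1\#1$, equivalently: $f(h,1)=f(1,h)=\epsilon(h)1_A$; $f(l^{(1)},m^{(1)})^{h^{(1)}}f(h^{(2)},l^{(2)}m^{(2)})=f(h^{(1)},l^{(1)})f(h^{(2)}l^{(2)},m)$;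 and $(a^{l^{(1)}})^{h^{(1)}}f(h^{(2)},l^{(2)})=f(h^{(1)},l^{(1)})a^{h^{(2)}l^{(2)}}$ for all $h,l,m\in H$, $a\in A$. $A$ is regarded as the subalgebra $A\#1$ of $E$. When $f$ is convolution invertible, $h\mapsto1\#h$ is convolution invertible with inverse $h\mapsto(1\#h)^{-1}:=f^{-1}(\mathcal S(h^{(2)}),h^{(3)})\#\mathcal S(h^{(1)})$. $M\otimes_S\widetilde A^r\otimes_S:=M\otimes_{A^e}(A\otimes_S\widetilde A^r\otimes_SA)=M\otimes_{S^e}\widetilde A^r$ is the cyclic tensor product over $S$ (for $r=0$ it is $M/[S,M]$), where $B^e=B\otimes B^{\mathrm{op}}$. The boundary is the Hochschild boundary $b_r(m\otimes_Sa_1\otimes_S\cdots\otimes_Sa_r\otimes_S)=ma_1\otimes_Sa_2\otimes_S\cdots\otimes_Sa_r\otimes_S+\sum_{i=1}^{r-1}(-1)^im\otimes_Sa_1\otimes_S\cdots\otimes_Sa_ia_{i+1}\otimes_S\cdots\otimes_Sa_r\otimes_S+(-1)^ra_rm\otimes_Sa_1\otimes_S\cdots\otimes_Sa_{r-1}\otimes_S$. Using the fact that $f$ takes its values in $S$, $H$ acts on the left on this complex by $h\cdot(m\otimes_Sa_1\otimes_S\cdots\otimes_Sa_r\otimes_S)=(1\#h^{(r+2)})m(1\#h^{(1)})^{-1}\otimes_Sa_1^{h^{(2)}}\otimes_S\cdots\otimes_Sa_r^{h^{(r+1)}}\otimes_S$. For a chain complex $(C_*,b_* )$ of left $H$-modules,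 the homology of $H$ with coefficients in $C_*$ is the homology of the total complex of the double complex $C_r\otimes\overline H^s$ ($\overline H=H/k$, $\overline H^s$ its $s$-fold tensor power) with differentials $b_r\otimes\mathrm{id}$ and $c\otimes h_1\otimes\cdots\otimes h_s\mapsto(-1)^r\epsilon(h_1)c\otimes h_2\otimes\cdots\otimes h_s+\sum_{i=1}^{s-1}(-1)^{r+i}c\otimes h_1\otimes\cdots\otimes h_ih_{i+1}\otimes\cdots\otimes h_s+(-1)^{r+s}h_s\cdot c\otimes h_1\otimes\cdots\otimes h_{s-1}$.
   Formalization: The separable subalgebra S is additionally assumed stable under the weak action (s^h lies in S for all h in H and s in S); without this the map a ↦ a^h is not defined on A/S and the described action of H on the complex does not exist. *)

(* Defs.v *)
From HB Require Import structures.
From mathcomp Require Import freeg.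
From mathcomp Require Import all_boot all_algebra.
From mathcomp Require Import boolp classical_sets functions.

Set Implicit Arguments.
Unset Strict Implicit.
Unset Printing Implicit Defensive.

Import GRing.Theory.
Local Open Scope ring_scope.
Local Open Scope quotient_scope.
Local Open Scope classical_set_scope.

Section Span.
Variables (k : pzRingType) (V : lmodType k).

Definition is_submod (P : set V) : Prop :=
  [/\ P 0, forall x y, P x -> P y -> P (x + y) &
      forall (c : k) x, P x -> P (c *: x)].

(* The submodule generated by R. *)
Definition spanp (R : set V) : {pred V} :=
  fun x => `[< forall P, is_submod P -> R `<=` P -> P x >].

Lemma spanpP (R : set V) x :
  reflect (forall P, is_submod P -> R `<=` P -> P x) (x \in spanp R).
Proof. exact: asboolP. Qed.

Lemma spanp_sub (R : set V) x : R x -> x \in spanp R.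
Proof. by move=> Rx; apply/spanpP => P _; apply. Qed.

Lemma spanp_submod (R : set V) : submod_closed (spanp R).
Proof.
split=> [|c x y Rx Ry]; apply/spanpP => P PV RP; have [P0 PD PZ] := PV => //.
move/spanpP: Rx => /(_ P PV RP) Px; move/spanpP: Ry => /(_ P PV RP) Py.
exact/PD/Py/PZ.
Qed.

Fact spanp_zmod (R : set V) : zmod_closed (spanp R).
Proof.
have [h0 hL] := spanp_submod R; split; first exact: h0.
by move=> x y hx hy; rewrite addrC -scaleN1r; exact: hL.
Qed.
HB.instance Definition _ (R : set V) :=
  GRing.isZmodClosed.Build V (spanp R) (spanp_zmod R).
Fact spanp_scale (R : set V) : GRing.scaler_closed (spanp R).
Proof.
by have [h0 hL] := spanp_submod R; move=> c x hx; rewrite -[_ *: _]addr0 hL.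
Qed.
HB.instance Definition _ (R : set V) :=
  GRing.isScaleClosed.Build k V (spanp R) (@spanp_scale R).

(* V / <R> *)
Definition quotm (R : set V) : Type := Quotient.quot (spanp R).
HB.instance Definition _ (R : set V) := Choice.on (quotm R).
HB.instance Definition _ (R : set V) := EqQuotient.on (quotm R).
HB.instance Definition _ (R : set V) := GRing.Zmodule.on (quotm R).
HB.instance Definition _ (R : set V) := ZmodQuotient.on (quotm R).

Variable R : set V.
Definition cls (x : V) : quotm R := \pi_(quotm R) x.

Lemma clsE x y : (cls x = cls y) <-> (x - y \in spanp R).
Proof.
rewrite /cls -[_ \in _]/(Quotient.equiv (spanp R) x y).
by split=> [/eqmodP|h]; [|apply/eqmodP].
Qed.

Lemma clsD x y : cls (x + y) = cls x + cls y.
Proof. by rewrite /cls raddfD. Qed.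

Definition quotm_scale (c : k) (x : quotm R) : quotm R := cls (c *: repr x).

Lemma quotm_scaleE c x : quotm_scale c (cls x) = cls (c *: x).
Proof.
apply/clsE; rewrite -scalerBr; apply: rpredZ; apply/clsE.
by rewrite /cls reprK.
Qed.

Lemma clsK (x : quotm R) : cls (repr x) = x.
Proof. by rewrite /cls reprK. Qed.

Fact quotm_scaleA c d x :
  quotm_scale c (quotm_scale d x) = quotm_scale (c * d) x.
Proof. by rewrite -[x]clsK !quotm_scaleE scalerA. Qed.
Fact quotm_scale1 : left_id 1 quotm_scale.
Proof. by move=> x; rewrite -[x]clsK quotm_scaleE scale1r clsK. Qed.
Fact quotm_scaleDr : right_distributive quotm_scale +%R.
Proof.
move=> c x y; rewrite -[x]clsK -[y]clsK -clsD !quotm_scaleE -clsD.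
by rewrite scalerDr.
Qed.
Fact quotm_scaleDl x : {morph quotm_scale^~ x : c d / c + d}.
Proof. by move=> c d; rewrite -[x]clsK !quotm_scaleE -clsD scalerDl. Qed.
HB.instance Definition _ := GRing.Zmodule_isLmodule.Build k (quotm R)
  quotm_scaleA quotm_scale1 quotm_scaleDr quotm_scaleDl.

Fact cls_linear : linear cls.
Proof. by move=> c x y; rewrite clsD -quotm_scaleE. Qed.
HB.instance Definition _ := GRing.isLinear.Build k V (quotm R) _ cls cls_linear.

End Span.
Arguments cls {k V} R x.
Arguments spanp {k V} R.
Arguments quotm {k V} R.

Definition mklin (k : pzRingType) (U W : lmodType k) (f : U -> W)
    (f_lin : linear f) : {linear U -> W} :=
  HB.pack_for {linear U -> W} f (GRing.isLinear.Build k U W _ f f_lin).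

(* The linear map Q -> W with value phi x at gen x for all x, when there is one
   (it is unique as soon as the gen x span Q), and 0 otherwise. Below gen is
   always a spanning family of (classes of) pure tensors; that the map exists
   says that the formula phi respects the relations that define Q. *)
Definition linext (k : pzRingType) (X : Type) (Q W : lmodType k)
    (gen : X -> Q) (phi : X -> W) : {linear Q -> W} :=
  if pselect (exists g : {linear Q -> W}, forall x, g (gen x) = phi x) is left e
  then projT1 (cid e) else \0.

Lemma linextE (k : pzRingType) (X : Type) (Q W : lmodType k)
    (gen : X -> Q) (phi : X -> W) :
  (exists g : {linear Q -> W}, forall x, g (gen x) = phi x) ->
  forall x, linext gen phi (gen x) = phi x.
Proof. by rewrite /linext; case: pselect => // e _; exact: (projT2 (cid e)). Qed.

Section Presented.
Variables (k : comNzRingType) (X : choiceType) (R : set {freeg X / k}).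

Definition pgen (x : X) : quotm R := cls R << x >>.

Fact fglift_linear (W : lmodType k) (phi : X -> W) : linear (fglift phi).
Proof.
have hA : {morph fglift phi : u v / u + v}.
  move=> u v; have hB := lift_is_additive phi.
  have h0 : fglift phi 0 = 0 by rewrite -(subrr 0) hB subrr.
  by rewrite -[v in LHS]opprK hB -(sub0r v) hB h0 sub0r opprK.
have h0 : fglift phi 0 = 0 by rewrite -freeg_nil fglift_Freeg prelift_nil.
move=> c u v; rewrite hA; congr (_ + _).
rewrite -[u]freeg_sumE scaler_sumr !(big_morph _ hA h0) scaler_sumr.
apply: eq_bigr => x _.
have -> : c *: << coeff x u *g x >> = << c * coeff x u *g x >>.
  by apply/eqP/freeg_eqP=> y; rewrite coeffZ !coeffU mulrA.
by rewrite !liftU scalerA.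
Qed.

Lemma pgen_ext (W : lmodType k) (phi : X -> W) :
  (forall r, R r -> fglift phi r = 0) ->
  exists g : {linear quotm R -> W}, forall x, g (pgen x) = phi x.
Proof.
move=> phiR.
pose F : {linear {freeg X / k} -> W} := mklin (fglift_linear phi).
have phiS u : u \in spanp R -> F u = 0.
  move=> /spanpP /(_ [set u | F u = 0]); apply => [|r /phiR //].
  split; rewrite /mkset.
  - exact: linear0.
  - by move=> x y h1 h2; rewrite linearD h1 h2 addr0.
  - by move=> c x h1; rewrite linearZ_LR h1 scaler0.
have FE u : F (repr (cls R u)) = F u.
  apply/eqP; rewrite -subr_eq0 -linearB; apply/eqP/phiS/clsE.
  exact: clsK.
have glin : linear (fun q : quotm R => F (repr q)).
  move=> c x y; rewrite -[x in LHS]clsK -[y in LHS]clsK -cls_linear.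
  apply: etrans (FE _) _.
  by rewrite linearP.
exists (mklin glin) => x /=.
by apply: etrans (FE _) _; rewrite /= liftU scale1r.
Qed.

End Presented.

Lemma pgen_ind (k : comNzRingType) (X : choiceType) (R : set {freeg X / k})
    (P : set (quotm R)) :
  is_submod P -> (forall x, P (pgen R x)) -> forall q, P q.
Proof.
move=> [P0 PD PZ] Pg q; rewrite -[q]clsK -[repr q]freeg_sumE linear_sum.
apply: big_ind => // x _.
suff -> : << coeff x (repr q) *g x >> = coeff x (repr q) *: << x >>.
  by rewrite linearZ_LR; exact/PZ/Pg.
by apply/eqP/freeg_eqP=> y; rewrite coeffZ !coeffU mul1r.
Qed.

Section Tensor.
Variables (k : comNzRingType) (U V : lmodType k).

Inductive tens_rel : set {freeg (U * V) / k} :=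
| TensL c u u' v :
    tens_rel (<< (c *: u + u', v) >> - c *: << (u, v) >> - << (u', v) >>)
| TensR c u v v' :
    tens_rel (<< (u, c *: v + v') >> - c *: << (u, v) >> - << (u, v') >>).

Definition tens : Type := quotm tens_rel.
HB.instance Definition _ := GRing.Lmodule.on tens.

Definition ptens (u : U) (v : V) : tens := pgen tens_rel (u, v).

Lemma ptens_linl v : linear (ptens^~ v).
Proof.
move=> c u u'; rewrite /ptens /pgen -cls_linear; apply/clsE.
by rewrite opprD addrA; apply/spanp_sub/TensL.
Qed.

Lemma ptens_linr u : linear (ptens u).
Proof.
move=> c v v'; rewrite /ptens /pgen -cls_linear; apply/clsE.
by rewrite opprD addrA; apply/spanp_sub/TensR.
Qed.

Lemma tens_ind (P : set tens) :
  is_submod P -> (forall u v, P (ptens u v)) -> forall t, P t.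
Proof. by move=> PV Pp; apply: pgen_ind => // -[u v]; exact: Pp. Qed.

Lemma tens_ext (W : lmodType k) (b : U -> V -> W) :
  (forall v, linear (b^~ v)) -> (forall u, linear (b u)) ->
  exists g : {linear tens -> W}, forall p, g (ptens p.1 p.2) = b p.1 p.2.
Proof.
move=> bl br.
have [|g gE] := @pgen_ext _ _ tens_rel W (fun p => b p.1 p.2).
  pose phi (p : U * V) := b p.1 p.2.
  have [F FE] : exists F : {linear {freeg (U * V) / k} -> W}, F =1 fglift phi.
    by exists (mklin (fglift_linear phi)).
  have FU p : F << p >> = b p.1 p.2 by rewrite FE liftU scale1r.
  have FB c x y z : F (x - c *: y - z) = F x - c *: F y - F z.
    by rewrite !linearB linearZ_LR.
  move=> r Rr; rewrite -/phi -FE; case: Rr => [c u u' v|c u v v'].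
    by rewrite FB !FU /= bl addrAC addrK subrr.
  by rewrite FB !FU /= br addrAC addrK subrr.
by exists g => -[u v]; exact: gE.
Qed.

(* Every tensor is a finite sum of pure tensors; trep chooses one such sum. *)
Lemma trep_ex (t : tens) :
  exists s : seq (U * V), t = \sum_(p <- s) ptens p.1 p.2.
Proof.
move: t; apply: tens_ind => [|u v]; last first.
  by exists [:: (u, v)]; rewrite big_seq1.
split; rewrite /mkset.
- by exists [::]; rewrite big_nil.
- by move=> _ _ [s ->] [s' ->]; exists (s ++ s'); rewrite big_cat.
- move=> c _ [s ->]; exists [seq (c *: p.1, p.2) | p <- s].
  rewrite big_map scaler_sumr; apply: eq_bigr => p _ /=.
  have h0 : ptens 0 p.2 = 0.
    by have := ptens_linl p.2 1 0 0; rewrite !scale1r addr0 -[LHS]addr0 => /addrI.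
  by have := ptens_linl p.2 c p.1 0; rewrite h0 !addr0 => ->.
Qed.

Definition trep (t : tens) : seq (U * V) := projT1 (cid (trep_ex t)).
Lemma trepE t : \sum_(p <- trep t) ptens p.1 p.2 = t.
Proof. by rewrite -(projT2 (cid (trep_ex t))). Qed.

Lemma trep_sum (W : lmodType k) (b : U -> V -> W) :
  (forall v, linear (b^~ v)) -> (forall u, linear (b u)) ->
  exists2 g : {linear tens -> W}, forall u v, g (ptens u v) = b u v &
    forall t, \sum_(p <- trep t) b p.1 p.2 = g t.
Proof.
move=> bl br; have [g gE] := tens_ext bl br.
exists g => [u v|t]; first exact: (gE (u, v)).
by rewrite -[in RHS](trepE t) linear_sum; apply: eq_bigr => p _; rewrite gE.
Qed.

End Tensor.
Notation "u \ox v" := (ptens u v) (at level 40, left associativity).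

Section TensorPower.
Variables (k : comNzRingType) (V : lmodType k) (n : nat).

Definition upd (T : Type) (x : 'I_n -> T) (i : 'I_n) (v : T) : 'I_n -> T :=
  fun j => if j == i then v else x j.

Inductive tpow_rel : set {freeg ('I_n -> V) / k} :=
| TpowRel c x i v v' :
    tpow_rel (<< upd x i (c *: v + v') >> - c *: << upd x i v >>
              - << upd x i v' >>).

(* The n-fold tensor power of V; it is k for n = 0. *)
Definition tpow : Type := quotm tpow_rel.
HB.instance Definition _ := GRing.Lmodule.on tpow.

Definition ppow (x : 'I_n -> V) : tpow := pgen tpow_rel x.

End TensorPower.

(* A family of modules C_n with maps C_{n+1} -> C_n, n >= 0. That d d = 0 is not
   part of the record; n-cycles that are boundaries are divided out. *)
Record cplx (k : comNzRingType) := Cplx {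
  cobj : nat -> lmodType k;
  cdiff : forall n, {linear cobj n.+1 -> cobj n}
}.

Section Homology.
Variables (k : comNzRingType) (C : cplx k) (n : nat).

Definition is_cycle : {pred cobj C n} :=
  match n return cobj C n -> bool with
  | 0 => fun _ => true
  | m.+1 => fun x => cdiff C m x == 0
  end.

Fact is_cycle_submod : submod_closed is_cycle.
Proof.
rewrite /is_cycle; case: n => [|m]; first by split.
split; first by apply/eqP; exact: linear0.
by move=> c x y /eqP hx /eqP hy; apply/eqP; rewrite linearP hx hy scaler0 addr0.
Qed.
HB.instance Definition _ :=
  GRing.isSubmodClosed.Build k (cobj C n) is_cycle is_cycle_submod.

Definition cycles : Type := {x : cobj C n | x \in is_cycle}.
HB.instance Definition _ := SubType.on cycles.
HB.instance Definition _ := Choice.on cycles.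
HB.instance Definition _ := [SubChoice_isSubLmodule of cycles by <:].

Definition boundaries : set cycles :=
  [set z | exists y, val z = cdiff C n y].

Definition homology : Type := quotm boundaries.
HB.instance Definition _ := GRing.Lmodule.on homology.

End Homology.

Section Faces.
Variable n : nat.

Definition front T (x : 'I_n.+1 -> T) : 'I_n -> T := fun j => x (lift ord_max j).
Definition tail T (x : 'I_n.+1 -> T) : 'I_n -> T := fun j => x (lift ord0 j).

(* (x_0, .., x_i x_(i+1), .., x_n) *)
Definition merge (T : pzRingType) (i : 'I_n) (x : 'I_n.+1 -> T) : 'I_n -> T :=
  fun j => if (j < i)%N then front x j
           else if j == i then front x i * tail x i
           else tail x j.

End Faces.

Record bimodule (k : comNzRingType) (E : algType k) := Bimodule {
  bm_car :> lmodType k;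
  bm_l : E -> bm_car -> bm_car;
  bm_r : bm_car -> E -> bm_car;
  bm_l_linl : forall m, linear (bm_l^~ m);
  bm_l_linr : forall e, linear (bm_l e);
  bm_r_linl : forall e, linear (bm_r^~ e);
  bm_r_linr : forall m, linear (bm_r m);
  bm_l1 : forall m, bm_l 1 m = m;
  bm_r1 : forall m, bm_r m 1 = m;
  bm_lA : forall e e' m, bm_l (e * e') m = bm_l e (bm_l e' m);
  bm_rA : forall m e e', bm_r m (e * e') = bm_r (bm_r m e) e';
  bm_lrA : forall e m e', bm_r (bm_l e m) e' = bm_l e (bm_r m e')
}.

Section Hochschild.
Variables (k : comNzRingType) (E : algType k) (M : bimodule E).

Definition hoch_obj (n : nat) : lmodType k := tens M (tpow E n).

Definition hoch_gen n (w : M * ('I_n -> E)) : hoch_obj n := w.1 \ox ppow w.2.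

Definition hoch_diff n : {linear hoch_obj n.+1 -> hoch_obj n} :=
  linext (@hoch_gen n.+1) (fun w : M * ('I_n.+1 -> E) =>
    let: (m, x) := w in
    hoch_gen (bm_r m (x ord0), tail x)
    + \sum_(i < n) (-1) ^+ i.+1 *: hoch_gen (m, merge i x)
    + (-1) ^+ n.+1 *: hoch_gen (bm_l (x ord_max) m, front x)).

Definition hochschild : cplx k := Cplx hoch_diff.

End Hochschild.

Section Hopf.
Variables (k : comNzRingType) (H : algType k).

Record hopf := Hopf {
  comul : {linear H -> tens H H};
  counit : {lrmorphism H -> k^o};
  antip : {linear H -> H};
  comul1 : comul 1 = 1 \ox 1;
  comulM : forall h l, comul (h * l) =
    \sum_(p <- trep (comul h)) \sum_(q <- trep (comul l))
      (p.1 * q.1) \ox (p.2 * q.2);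
  comulA : forall h,
    \sum_(p <- trep (comul h)) \sum_(q <- trep (comul p.1))
      q.1 \ox (q.2 \ox p.2) =
    \sum_(p <- trep (comul h)) \sum_(q <- trep (comul p.2))
      p.1 \ox (q.1 \ox q.2);
  counitl : forall h, \sum_(p <- trep (comul h)) (counit p.1 : k) *: p.2 = h;
  counitr : forall h, \sum_(p <- trep (comul h)) (counit p.2 : k) *: p.1 = h;
  antipl : forall h, \sum_(p <- trep (comul h)) antip p.1 * p.2 =
    (counit h : k)%:A;
  antipr : forall h, \sum_(p <- trep (comul h)) p.1 * antip p.2 =
    (counit h : k)%:A
}.

Variable hH : hopf.

(* Sweedler notation with n+1 legs: a finite list of words of length n+1, such
   that the sum of x`_0 \ox .. \ox x`_n over sw n h is the n-fold iterated
   comultiplication of h. The leg h^(i) of the usual notation is x`_(i-1). The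
   list depends on the choice in trep; sums over it of multilinear functions of
   the legs do not. *)
Fixpoint sw (n : nat) (h : H) : seq (seq H) :=
  if n is m.+1
  then [seq p.1 :: x | p <- trep (comul hH h), x <- sw m p.2]
  else [:: [:: h]].

Lemma swS n h :
  sw n.+1 h = [seq p.1 :: x | p <- trep (comul hH h), x <- sw n p.2].
Proof. by []. Qed.

Lemma sw1E (W : nmodType) (F : H -> H -> W) h :
  \sum_(x <- sw 1 h) F x`_0 x`_1 = \sum_(p <- trep (comul hH h)) F p.1 p.2.
Proof.
by rewrite swS big_allpairs_dep; apply: eq_bigr => p _; rewrite big_seq1.
Qed.

Lemma sw2E (W : nmodType) (F : H -> H -> H -> W) h :
  \sum_(x <- sw 2 h) F x`_0 x`_1 x`_2 =
  \sum_(p <- trep (comul hH h)) \sum_(q <- trep (comul hH p.2))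
    F p.1 q.1 q.2.
Proof.
rewrite swS big_allpairs_dep; apply: eq_bigr => p _.
exact: (sw1E (fun h1 h2 => F p.1 h1 h2)).
Qed.

End Hopf.

Lemma linear_sumf (k : comNzRingType) (U W : lmodType k) (I : Type) (r : seq I)
    (F : I -> U -> W) :
  (forall i, linear (F i)) -> linear (fun u => \sum_(i <- r) F i u).
Proof.
move=> Fl c u v; rewrite scaler_sumr -big_split.
by apply: eq_bigr => i _; rewrite Fl.
Qed.

Section SweedlerLinear.
Variables (k : comNzRingType) (H : algType k) (hH : hopf H) (W : lmodType k).

Lemma sw1_linear (F : H -> H -> W) :
  (forall y, linear (F^~ y)) -> (forall x, linear (F x)) ->
  linear (fun h => \sum_(x <- sw hH 1 h) F x`_0 x`_1).
Proof.
move=> Fl Fr c h h'; rewrite !sw1E.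
by have [g _ gE] := trep_sum Fl Fr; rewrite !gE linearP linearP.
Qed.

Lemma sw2_linear (F : H -> H -> H -> W) :
  (forall y z, linear (fun x => F x y z)) ->
  (forall x z, linear (fun y => F x y z)) ->
  (forall x y, linear (F x y)) ->
  linear (fun h => \sum_(x <- sw hH 2 h) F x`_0 x`_1 x`_2).
Proof.
move=> F1 F2 F3 c h h'; rewrite !sw2E.
pose G x y := \sum_(q <- trep (comul hH y)) F x q.1 q.2.
have Gl y : linear (G^~ y) by apply: linear_sumf => q; exact: F1.
have Gr x : linear (G x).
  move=> d y y'; have [g _ gE] := trep_sum (fun z => F2 x z) (fun y => F3 x y).
  by rewrite /G !gE linearP linearP.
by have [g _ gE] := trep_sum Gl Gr; rewrite !gE linearP linearP.
Qed.

End SweedlerLinear.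

Section Crossed.
Variables (k : comNzRingType) (H : algType k) (hH : hopf H) (A : algType k).

(* wact h a is a^h. *)
Record weakAction := WeakAction {
  wact :> H -> A -> A;
  wact_linl : forall a, linear (wact^~ a);
  wact_linr : forall h, linear (wact h);
  wactM : forall h a b,
    wact h (a * b) = \sum_(x <- sw hH 1 h) wact x`_0 a * wact x`_1 b;
  wact_1r : forall h, wact h 1 = (counit hH h : k)%:A;
  wact_1l : forall a, wact 1 a = a
}.

Variables (w : weakAction) (f : {linear tens H H -> A}).

Definition crossed_mul_pure (a : A) (h : H) (b : A) (l : H) : tens A H :=
  \sum_(x <- sw hH 2 h) \sum_(y <- sw hH 1 l)
    (a * w x`_0 b * f (x`_1 \ox y`_0)) \ox (x`_2 * y`_1).

Definition crossed_mul (u v : tens A H) : tens A H :=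
  linext (fun p : A * H => p.1 \ox p.2)
    (fun p => linext (fun q : A * H => q.1 \ox q.2)
       (fun q => crossed_mul_pure p.1 p.2 q.1 q.2) v) u.

Lemma crossed_mul_linear4 :
  [/\ forall h b l, linear (fun a => crossed_mul_pure a h b l),
      forall a b l, linear (fun h => crossed_mul_pure a h b l),
      forall a h l, linear (fun b => crossed_mul_pure a h b l) &
      forall a h b, linear (crossed_mul_pure a h b)].
Proof.
pose T a h0 h1 h2 b l0 l1 : tens A H :=
  (a * w h0 b * f (h1 \ox l0)) \ox (h2 * l1).
have Ta h0 h1 h2 b l0 l1 : linear (fun a => T a h0 h1 h2 b l0 l1).
  by move=> c u v; rewrite /T !mulrDl -!scalerAl ptens_linl.
have T0 a h1 h2 b l0 l1 : linear (fun h0 => T a h0 h1 h2 b l0 l1).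
  move=> c u v; rewrite /T wact_linl mulrDr mulrDl -scalerAr -scalerAl.
  by rewrite ptens_linl.
have T1 a h0 h2 b l0 l1 : linear (fun h1 => T a h0 h1 h2 b l0 l1).
  by move=> c u v; rewrite /T ptens_linl linearP mulrDr -scalerAr ptens_linl.
have T2 a h0 h1 b l0 l1 : linear (fun h2 => T a h0 h1 h2 b l0 l1).
  by move=> c u v; rewrite /T mulrDl -scalerAl ptens_linr.
have Tb a h0 h1 h2 l0 l1 : linear (fun b => T a h0 h1 h2 b l0 l1).
  move=> c u v; rewrite /T wact_linr mulrDr mulrDl -scalerAr -scalerAl.
  by rewrite ptens_linl.
have Tl0 a h0 h1 h2 b l1 : linear (fun l0 => T a h0 h1 h2 b l0 l1).
  by move=> c u v; rewrite /T ptens_linr linearP mulrDr -scalerAr ptens_linl.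
have Tl1 a h0 h1 h2 b l0 : linear (T a h0 h1 h2 b l0).
  by move=> c u v; rewrite /T mulrDr -scalerAr ptens_linr.
split.
- move=> h b l; do 2!(apply: linear_sumf => ?); exact: Ta.
- move=> a b l.
  apply: (sw2_linear hH (F := fun x y z =>
    \sum_(q <- sw hH 1 l) T a x y z b q`_0 q`_1)) => *.
  + by apply: linear_sumf => ?; exact: T0.
  + by apply: linear_sumf => ?; exact: T1.
  + by apply: linear_sumf => ?; exact: T2.
- move=> a h l; do 2!(apply: linear_sumf => ?); exact: Tb.
- move=> a h b; apply: linear_sumf => x.
  by apply: (sw1_linear hH (F := T a x`_0 x`_1 x`_2 b)) => *;
    [exact: Tl0 | exact: Tl1].
Qed.

Lemma crossed_mul_bilin :
  [/\ forall v, linear (crossed_mul^~ v), forall u, linear (crossed_mul u) &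
      forall a h b l,
        crossed_mul (a \ox h) (b \ox l) = crossed_mul_pure a h b l].
Proof.
have [La Lh Lb Ll] := crossed_mul_linear4.
pose G p : {linear tens A H -> tens A H} :=
  linext (fun q : A * H => q.1 \ox q.2)
    (fun q => crossed_mul_pure p.1 p.2 q.1 q.2).
have GE p b l : G p (b \ox l) = crossed_mul_pure p.1 p.2 b l.
  apply: (linextE (gen := fun q : A * H => q.1 \ox q.2) _ (b, l)).
  apply: (@tens_ext _ _ _ _ (crossed_mul_pure p.1 p.2)) => *; first exact: Lb.
  exact: Ll.
have Gl h v : linear (fun a => G (a, h) v).
  move=> c a a'; move: v; apply: tens_ind => [|b l]; last by rewrite !GE /= La.
  split; rewrite /mkset; first by rewrite !linear0 ?scaler0 ?addr0.
    by move=> x y hx hy; rewrite !(linearD (G _)) hx hy scalerDr addrACA.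
  move=> d x hx; rewrite !(linearZ_LR (G _)) hx scalerDr !scalerA.
  by rewrite (mulrC c).
have Gr a v : linear (fun h => G (a, h) v).
  move=> c h h'; move: v; apply: tens_ind => [|b l]; last by rewrite !GE /= Lh.
  split; rewrite /mkset; first by rewrite !linear0 ?scaler0 ?addr0.
    by move=> x y hx hy; rewrite !(linearD (G _)) hx hy scalerDr addrACA.
  move=> d x hx; rewrite !(linearZ_LR (G _)) hx scalerDr !scalerA.
  by rewrite (mulrC c).
have mulE a h v : crossed_mul (a \ox h) v = G (a, h) v.
  apply: (linextE (gen := fun q : A * H => q.1 \ox q.2)
    (phi := fun p => G p v) _ (a, h)).
  have [| |g gE] := @tens_ext _ _ _ _ (fun a h => G (a, h) v).
  - by move=> ?; exact: Gl.
  - by move=> ?; exact: Gr.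
  - by exists g => -[a1 h1]; exact: (gE (a1, h1)).
split; last by move=> a h b l; rewrite mulE GE.
- by move=> v c u u'; rewrite /crossed_mul linearP.
- move=> u c v v'; move: u; apply: tens_ind => [|a h]; last first.
    by rewrite !mulE linearP.
  have L v0 : linear (crossed_mul^~ v0) by move=> ? ? ?; rewrite /crossed_mul linearP.
  have L0 v0 : crossed_mul 0 v0 = 0 by rewrite /crossed_mul linear0.
  split; rewrite /mkset; first by rewrite !L0 ?scaler0 ?addr0.
    move=> x y hx hy; rewrite -[x]scale1r !L !scale1r hx hy scalerDr.
    by rewrite addrACA.
  move=> d x hx; rewrite -[d *: x]addr0 !L hx !L0 !addr0 scalerDr !scalerA.
  by rewrite (mulrC c).
Qed.

(* A #_f H is a crossed product: its product is associative with unit 1 # 1. *)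
Definition is_crossed : Prop :=
  [/\ associative crossed_mul, left_id (1 \ox 1) crossed_mul &
      right_id (1 \ox 1) crossed_mul].

Definition crossed (_ : is_crossed) : Type := tens A H.

Variable wf : is_crossed.
HB.instance Definition _ := GRing.Lmodule.on (crossed wf).

Fact crossed_mulA : associative (crossed_mul : crossed wf -> _ -> crossed wf).
Proof. by case: wf. Qed.
Fact crossed_mul1l :
  left_id (1 \ox 1) (crossed_mul : crossed wf -> _ -> crossed wf).
Proof. by case: wf. Qed.
Fact crossed_mul1r :
  right_id (1 \ox 1) (crossed_mul : crossed wf -> _ -> crossed wf).
Proof. by case: wf. Qed.
Fact crossed_mulDl :
  left_distributive (crossed_mul : crossed wf -> _ -> crossed wf) +%R.
Proof.
have [L _ _] := crossed_mul_bilin.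
by move=> x y z; have := L z 1 x y; rewrite !scale1r.
Qed.
Fact crossed_mulDr :
  right_distributive (crossed_mul : crossed wf -> _ -> crossed wf) +%R.
Proof.
have [_ L _] := crossed_mul_bilin.
by move=> x y z; have := L x 1 y z; rewrite !scale1r.
Qed.
Fact crossed_1_neq0 : (1 \ox 1 : crossed wf) != 0.
Proof.
have [| |g gE] := @tens_ext _ A H A (fun a h => (counit hH h : k) *: a).
- by move=> h c a a'; rewrite scalerDr !scalerA (mulrC c).
- by move=> a c h h'; rewrite linearP scalerDl scalerA.
apply/eqP => /(congr1 g); rewrite linear0 (gE (1, 1)) /= rmorph1 scale1r.
exact/eqP/oner_neq0.
Qed.
HB.instance Definition _ := GRing.Zmodule_isNzRing.Build (crossed wf)
  crossed_mulA crossed_mul1l crossed_mul1r crossed_mulDl crossed_mulDr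
  crossed_1_neq0.

Fact crossed_scaleAl (c : k) (u v : crossed wf) : c *: (u * v) = (c *: u) * v.
Proof.
by have [L _ _] := crossed_mul_bilin; rewrite -[u]/(u : tens A H) /GRing.mul /=;
  rewrite -[in RHS](addr0 (c *: u)) L /crossed_mul linear0 addr0.
Qed.
HB.instance Definition _ :=
  GRing.Lmodule_isLalgebra.Build k (crossed wf) crossed_scaleAl.

Fact crossed_scaleAr (c : k) (u v : crossed wf) : c *: (u * v) = u * (c *: v).
Proof.
have [_ L _] := crossed_mul_bilin.
have L0 : crossed_mul u 0 = 0 := mulr0 u.
by move: (L u c v 0); rewrite L0 !addr0 => e; exact/esym/e.
Qed.
HB.instance Definition _ :=
  GRing.Lalgebra_isAlgebra.Build k (crossed wf) crossed_scaleAr.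

End Crossed.

Section Separable.
Variables (k : comNzRingType) (S : algType k).

(* e is a separability idempotent: it maps to 1 under multiplication and
   s e = e s for the outer S-bimodule structure on S \ox S. *)
Definition sep_idem (e : tens S S) : Prop :=
  \sum_(p <- trep e) p.1 * p.2 = 1 /\
  forall s, \sum_(p <- trep e) (s * p.1) \ox p.2 =
            \sum_(p <- trep e) p.1 \ox (p.2 * s).

Definition separable : Prop := exists e, sep_idem e.

End Separable.

Section Subalgebra.
Variables (k : comNzRingType) (A : algType k) (S : subalgClosed A).

Definition salg : Type := {x : A | x \in (S : {pred A})}.
HB.instance Definition _ := SubType.on salg.
HB.instance Definition _ := Choice.on salg.
HB.instance Definition _ := [SubChoice_isSubLalgebra of salg by <:].
HB.instance Definition _ := [SubLalgebra_isSubAlgebra of salg by <:].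

End Subalgebra.

Section ConvInverse.
Variables (k : comNzRingType) (H : algType k) (hH : hopf H) (A : algType k).

Definition conv_inverse (f g : {linear tens H H -> A}) : Prop :=
  forall h l,
  \sum_(x <- sw hH 1 h) \sum_(y <- sw hH 1 l)
     f (x`_0 \ox y`_0) * g (x`_1 \ox y`_1) =
     ((counit hH h : k) * (counit hH l : k))%:A /\
  \sum_(x <- sw hH 1 h) \sum_(y <- sw hH 1 l)
     g (x`_0 \ox y`_0) * f (x`_1 \ox y`_1) =
     ((counit hH h : k) * (counit hH l : k))%:A.

End ConvInverse.

Section Cyclic.
Variables (k : comNzRingType) (H : algType k) (hH : hopf H) (A : algType k).
Variables (w : weakAction hH A) (f g : {linear tens H H -> A}).
Variables (wf : is_crossed w f) (M : bimodule (crossed wf)).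
Variable S : subalgClosed A.

Definition inA (a : A) : crossed wf := a \ox 1.
Definition inH (h : H) : crossed wf := 1 \ox h.

(* (1 # h)^-1, for g the convolution inverse of f. *)
Definition inH_inv (h : H) : crossed wf :=
  \sum_(x <- sw hH 2 h) g (antip hH x`_1 \ox x`_2) \ox antip hH x`_0.

(* A/S *)
Definition Abar : lmodType k := quotm [set a : A | a \in (S : {pred A})].

Section Words.
Variable r : nat.

(* (m, a) stands for the cyclic word m, a_0, .., a_(r-1). *)
Definition cword : Type := (M * ('I_r -> A))%type.

Definition cpure (x : cword) : tens M (tpow Abar r) :=
  x.1 \ox ppow (fun i => cls _ (x.2 i) : Abar).

(* Right and left multiplication of a letter by s; letter 0 is m, and letter
   i+1 is a_i. *)
Definition crmul (j : 'I_r.+1) (x : cword) (s : A) : cword :=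
  if unlift ord0 j is Some i then (x.1, upd x.2 i (x.2 i * s))
  else (bm_r x.1 (inA s), x.2).
Definition clmul (j : 'I_r.+1) (s : A) (x : cword) : cword :=
  if unlift ord0 j is Some i then (x.1, upd x.2 i (s * x.2 i))
  else (bm_l (inA s) x.1, x.2).

(* ordS j is the letter that follows j cyclically: for r = 0 the relations are
   m s = s m. *)
Inductive cyc_rel : set (tens M (tpow Abar r)) :=
| CycRel j x s : s \in (S : {pred A}) ->
    cyc_rel (cpure (crmul j x s) - cpure (clmul (ordS j) s x)).

(* M \ox_S Abar \ox_S .. \ox_S Abar \ox_S with r factors Abar: the quotient of
   M \ox Abar^(\ox r) by the cyclic S-balancing relations. *)
Definition cyc_obj : lmodType k := quotm cyc_rel.

Definition cyc_gen (x : cword) : cyc_obj := cls cyc_rel (cpure x).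

(* For A/S to carry a |-> a^h, S has to be stable under the weak action.
   The action of h: h^(1) acts through (1 # h^(1))^-1 on the right of m,
   h^(i+2) on a_i for 0 <= i < r, and h^(r+2) on the left of m. *)
Definition cyc_act (h : H) : {linear cyc_obj -> cyc_obj} :=
  linext cyc_gen (fun x : cword =>
    \sum_(y <- sw hH r.+1 h)
      cyc_gen (bm_l (inH y`_(r.+1)) (bm_r x.1 (inH_inv y`_0)),
               fun i : 'I_r => w y`_(i.+1) (x.2 i))).

End Words.

Definition cyc_diff r : {linear cyc_obj r.+1 -> cyc_obj r} :=
  linext (@cyc_gen r.+1) (fun x : cword r.+1 =>
    let: (m, a) := x in
    cyc_gen (bm_r m (inA (a ord0)), tail a)
    + \sum_(i < r) (-1) ^+ i.+1 *: cyc_gen (m, merge i a)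
    + (-1) ^+ r.+1 *: cyc_gen (bm_l (inA (a ord_max)) m, front a)).

Definition cyc : cplx k := Cplx cyc_diff.

End Cyclic.

Section DependentProduct.
Variables (k : pzRingType) (I : Type) (V : I -> lmodType k).

Definition dprod : Type := forall i, V i.
HB.instance Definition _ := Choice.on dprod.

Definition dprod_add (x y : dprod) : dprod := fun i => x i + y i.
Definition dprod_opp (x : dprod) : dprod := fun i => - x i.
Definition dprod_scale (c : k) (x : dprod) : dprod := fun i => c *: x i.

Fact dprod_addA : associative dprod_add.
Proof.
by move=> x y z; apply/functional_extensionality_dep => i; exact: addrA.
Qed.
Fact dprod_addC : commutative dprod_add.
Proof. by move=> x y; apply/functional_extensionality_dep => i; exact: addrC. Qed.
Fact dprod_add0 : left_id (fun=> 0) dprod_add.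
Proof. by move=> x; apply/functional_extensionality_dep => i; exact: add0r. Qed.
Fact dprod_addN : left_inverse (fun=> 0) dprod_opp dprod_add.
Proof. by move=> x; apply/functional_extensionality_dep => i; exact: addNr. Qed.
HB.instance Definition _ :=
  GRing.isZmodule.Build dprod dprod_addA dprod_addC dprod_add0 dprod_addN.

Fact dprod_scaleA c d x :
  dprod_scale c (dprod_scale d x) = dprod_scale (c * d) x.
Proof. by apply/functional_extensionality_dep => i; exact: scalerA. Qed.
Fact dprod_scale1 : left_id 1 dprod_scale.
Proof. by move=> x; apply/functional_extensionality_dep => i; exact: scale1r. Qed.
Fact dprod_scaleDr : right_distributive dprod_scale +%R.
Proof.
by move=> c x y; apply/functional_extensionality_dep => i; exact: scalerDr.
Qed.
Fact dprod_scaleDl x : {morph dprod_scale^~ x : c d / c + d}.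
Proof.
by move=> c d; apply/functional_extensionality_dep => i; exact: scalerDl.
Qed.
HB.instance Definition _ := GRing.Zmodule_isLmodule.Build k dprod
  dprod_scaleA dprod_scale1 dprod_scaleDr dprod_scaleDl.

End DependentProduct.

Section HopfHomology.
Variables (k : comNzRingType) (H : algType k) (hH : hopf H) (C : cplx k).
Variable act : forall r, H -> {linear cobj C r -> cobj C r}.

(* H/k *)
Definition Hbar : lmodType k := quotm [set (1 : H)].

Definition dbl_obj (r s : nat) : lmodType k := tens (cobj C r) (tpow Hbar s).

Definition dbl_gen r s (x : cobj C r * ('I_s -> H)) : dbl_obj r s :=
  x.1 \ox ppow (fun i => cls _ (x.2 i) : Hbar).

Definition dbl_v r s : {linear dbl_obj r.+1 s -> dbl_obj r s} :=
  linext (@dbl_gen r.+1 s) (fun x => dbl_gen (cdiff C r x.1, x.2)).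

Definition dbl_h r s : {linear dbl_obj r s.+1 -> dbl_obj r s} :=
  linext (@dbl_gen r s.+1) (fun x : cobj C r * ('I_s.+1 -> H) =>
    let: (c, h) := x in
    (-1) ^+ r *: ((counit hH (h ord0) : k) *: dbl_gen (c, tail h))
    + \sum_(i < s) (-1) ^+ (r + i.+1) *: dbl_gen (c, merge i h)
    + (-1) ^+ (r + s.+1) *: dbl_gen (act r (h ord_max) c, front h)).

Definition bideg (n : nat) : Type := {p : nat * nat | p.1 + p.2 == n}%N.

(* The sum over r + s = n is finite, so a product serves as direct sum. *)
Definition tot_obj (n : nat) : lmodType k :=
  dprod (fun p : bideg n => dbl_obj (val p).1 (val p).2).

Definition bideg_l n (p : bideg n) : bideg n.+1 :=
  exist _ ((val p).1.+1, (val p).2) (valP p).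
Fact bideg_r_subproof n (p : bideg n) : ((val p).1 + (val p).2.+1 == n.+1)%N.
Proof. by rewrite addnS eqSS; exact: valP p. Qed.
Definition bideg_r n (p : bideg n) : bideg n.+1 :=
  exist _ ((val p).1, (val p).2.+1) (bideg_r_subproof p).

Definition tot_fun n (x : tot_obj n.+1) : tot_obj n :=
  fun p => dbl_v _ _ (x (bideg_l p)) + dbl_h _ _ (x (bideg_r p)).

Fact tot_fun_linear n : linear (@tot_fun n).
Proof.
move=> c x y; apply/functional_extensionality_dep => p.
rewrite /tot_fun.
transitivity (dbl_v _ _ (c *: x (bideg_l p) + y (bideg_l p)) +
              dbl_h _ _ (c *: x (bideg_r p) + y (bideg_r p))) => //.
by rewrite !linearP addrACA -scalerDr.
Qed.

(* The total complex, whose homology is the homology of H with coefficients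
   in C. *)
Definition hopf_cplx : cplx k := Cplx (fun n => mklin (@tot_fun_linear n)).

End HopfHomology.
Arguments hopf_cplx {k H} hH C act.

(* Main.v *)
(** Both sides are functors of the E-bimodule M which turn k-split short exact
   sequences of bimodules into degreewise split sequences of complexes, have
   homology M/[E, M] in degree 0, naturally in M, and have no homology in positive
   degrees on the free bimodules E (x) V (x) E. Dimension shifting along
   E (x) M (x) E -> M shows that two such functors have isomorphic homology.

   For the homology of H with coefficients in the cyclic complex, averaging a
   k-linear splitting over the separability idempotent of S makes it S-bilinear,
   hence compatible with M (x)_S A~^r (x)_S. On E (x) V (x) E with E = A # H,
   moving the A-part of the first factor to the end of the word contracts the
   cyclic complex onto degree 0; this commutes with the action of H since f takes
   its values in S. What is left in degree 0 is the free H-module H (x) (V (x) E),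
   through (a # h) (x) v (x) e |-> h'' (x) v (x) e a (1 # h'). *)
Require Import Defs.
From HB Require Import structures.
From mathcomp Require Import freeg.
From mathcomp Require Import all_boot all_algebra.
From mathcomp Require Import boolp classical_sets functions.

Set Implicit Arguments.
Unset Strict Implicit.
Unset Printing Implicit Defensive.

Import GRing.Theory.
Local Open Scope ring_scope.

(** * Linear maps on quotients and tensor products *)

(** Every module here is given by generators and relations, and [linext] returns zero if a formula
    violates a relation. So maps are built from functionals on words: [good] collects the conditions
    for a functional to descend, and [is_fam] is the resulting universal property. It serves three
    times: letters in E with S empty give the Hochschild complex, letters in A the cyclic complex,
    letters in H with S = {1} the rows of the double complex, which are Hochschild complexes of H
    with right action through the counit. The three contractions are instances of [fam_contraction].

    The obstacle is that H acts on A only weakly: acting by l and then by h differs from acting by h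
    l by a conjugation with f. As f has values in S, these values slide across the tensors over S to
    m, where the inverses of 1 # h absorb them. That these inverses are two-sided rests on the
    cocycle and twisting identities, which are first recovered from associativity of E.

    Dimension shifting ends in degree 1, where the degree 0 homology of the free bimodule enters;
    there both theories give the kernel of K/[E, K] -> P/[E, P] for the cover P of M with kernel
    K. *)

Section Linear.
Variable k : comNzRingType.
Implicit Types U V W : lmodType k.

Lemma lin_id U : linear (fun x : U => x).
Proof. by []. Qed.

Lemma lin_app U V W (g : {linear V -> W}) (f : U -> V) :
  linear f -> linear (fun x => g (f x)).
Proof. by move=> f_lin c x y; rewrite f_lin linearP. Qed.

Lemma lin_comp U V W (g : V -> W) (f : U -> V) :
  linear g -> linear f -> linear (fun x => g (f x)).
Proof. by move=> g_lin f_lin c x y; rewrite f_lin g_lin. Qed.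

Lemma lin_zero U W : linear (fun _ : U => 0 : W).
Proof. by move=> c x y; rewrite scaler0 addr0. Qed.

Lemma lin_add U W (f g : U -> W) :
  linear f -> linear g -> linear (fun x => f x + g x).
Proof. by move=> fl gl c x y; rewrite fl gl scalerDr addrACA. Qed.

Lemma lin_scale U W (d : k) (f : U -> W) :
  linear f -> linear (fun x => d *: f x).
Proof. by move=> fl c x y; rewrite fl scalerDr !scalerA mulrC. Qed.

Lemma lin_opp U W (f : U -> W) : linear f -> linear (fun x => - f x).
Proof. by move=> fl c x y; rewrite fl opprD scalerN. Qed.

Lemma lin_scalel U W (f : U -> k^o) (v : W) :
  linear f -> linear (fun x => (f x : k) *: v).
Proof. by move=> fl c x y; rewrite fl scalerDl scalerA. Qed.

Lemma lin_mull U (T : algType k) (f : U -> T) (t : T) :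
  linear f -> linear (fun x => f x * t).
Proof. by move=> fl c x y; rewrite fl mulrDl scalerAl. Qed.

Lemma lin_mulr U (T : algType k) (f : U -> T) (t : T) :
  linear f -> linear (fun x => t * f x).
Proof. by move=> fl c x y; rewrite fl mulrDr scalerAr. Qed.

Lemma lin_tensl U V W (f : U -> V) (v : W) :
  linear f -> linear (fun x => f x \ox v).
Proof. by move=> fl c x y; rewrite fl ptens_linl. Qed.

Lemma lin_tensr U V W (f : U -> W) (v : V) :
  linear f -> linear (fun x => v \ox f x).
Proof. by move=> fl c x y; rewrite fl ptens_linr. Qed.

Lemma lin_bml U (T : algType k) (M : bimodule T) (f : U -> T) (m : M) :
  linear f -> linear (fun x => bm_l (f x) m).
Proof. by move=> fl c x y; rewrite fl bm_l_linl. Qed.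

Lemma lin_bmlr U (T : algType k) (M : bimodule T) (t : T) (f : U -> M) :
  linear f -> linear (fun x => bm_l t (f x)).
Proof. by move=> fl c x y; rewrite fl bm_l_linr. Qed.

Lemma lin_bmr U (T : algType k) (M : bimodule T) (t : T) (f : U -> M) :
  linear f -> linear (fun x => bm_r (f x) t).
Proof. by move=> fl c x y; rewrite fl bm_r_linl. Qed.

Lemma lin_bmrr U (T : algType k) (M : bimodule T) (m : M) (f : U -> T) :
  linear f -> linear (fun x => bm_r m (f x)).
Proof. by move=> fl c x y; rewrite fl bm_r_linr. Qed.

Lemma lin_cls U V (R : set V) (f : U -> V) :
  linear f -> linear (fun x => cls R (f x)).
Proof. by move=> fl c x y; rewrite fl cls_linear. Qed.

Section Values.
Variables (U W : lmodType k) (f : U -> W).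
Hypothesis f_lin : linear f.

Lemma linf0 : f 0 = 0.
Proof. exact: linear0 (mklin f_lin). Qed.
Lemma linfD x y : f (x + y) = f x + f y.
Proof. exact: linearD (mklin f_lin) x y. Qed.
Lemma linfN x : f (- x) = - f x.
Proof. exact: linearN (mklin f_lin) x. Qed.
Lemma linfB x y : f (x - y) = f x - f y.
Proof. exact: linearB (mklin f_lin) x y. Qed.
Lemma linfZ c x : f (c *: x) = c *: f x.
Proof. exact: linearZ_LR (mklin f_lin) c x. Qed.
Lemma linf_sum I (r : seq I) (P : pred I) (F : I -> U) :
  f (\sum_(i <- r | P i) F i) = \sum_(i <- r | P i) f (F i).
Proof. exact: linear_sum (mklin f_lin) I r P F. Qed.

End Values.

Lemma spanp_id (V : lmodType k) (R : set V) x :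
  is_submod R -> (x \in spanp R) <-> R x.
Proof. by move=> RS; split=> [/spanpP|/spanp_sub //]; apply. Qed.

Lemma cls_eq0 (V : lmodType k) (R : set V) x :
  cls R x = 0 <-> x \in spanp R.
Proof. by rewrite -[in X in _ <-> X](subr0 x) -clsE linear0. Qed.

Lemma spanp_lin0 (V W : lmodType k) (R : set V) (f : {linear V -> W}) x :
  (forall r, R r -> f r = 0) -> x \in spanp R -> f x = 0.
Proof.
move=> fR /spanpP /(_ (fun u => f u = 0)); apply=> //.
split=> [|u v fu fv|c u fu]; first exact: linear0.
  by rewrite linearD fu fv addr0.
by rewrite linearZ_LR fu scaler0.
Qed.

Lemma quotm_ext (V W : lmodType k) (R : set V) (f : {linear V -> W}) :
  (forall r, R r -> f r = 0) ->
  exists g : {linear quotm R -> W}, forall x, g (cls R x) = f x.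
Proof.
move=> fR.
have gE x : f (repr (cls R x)) = f x.
  apply/eqP; rewrite -subr_eq0 -linearB; apply/eqP.
  by apply: spanp_lin0 fR _; apply/clsE; exact: clsK.
have gl : linear (fun q : quotm R => f (repr q)).
  by move=> c x y; rewrite -[x in LHS]clsK -[y in LHS]clsK -cls_linear gE linearP.
by exists (mklin gl) => x; exact: gE.
Qed.

Lemma quotm_ind (V : lmodType k) (R : set V) (P : quotm R -> Prop) :
  (forall x, P (cls R x)) -> forall q, P q.
Proof. by move=> h q; rewrite -[q]clsK. Qed.

Lemma eq_tens (U V W : lmodType k) (f g : {linear tens U V -> W}) :
  (forall u v, f (u \ox v) = g (u \ox v)) -> f =1 g.
Proof.
move=> h; apply: tens_ind => //.
split=> [|x y hx hy|c x hx]; first by rewrite !linear0.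
  by rewrite !linearD hx hy.
by rewrite !linearZ_LR hx.
Qed.

Lemma tens_ext2 (U V W : lmodType k) (b : U -> V -> W) :
  (forall v, linear (b^~ v)) -> (forall u, linear (b u)) ->
  exists g : {linear tens U V -> W}, forall u v, g (u \ox v) = b u v.
Proof.
by move=> bl br; have [g gE] := tens_ext bl br; exists g => u v; exact: (gE (u, v)).
Qed.

(** Fixing the first argument gives a map on V (x) X, chosen by [cid]; it is determined by its
    values on pure tensors, so the choice is linear in that argument. *)
Lemma tens_ext3 (U V X W : lmodType k) (F : U -> V -> X -> W) :
  (forall y z, linear (fun x => F x y z)) -> (forall x z, linear (fun y => F x y z)) ->
  (forall x y, linear (F x y)) ->
  exists G : {linear tens U (tens V X) -> W}, forall x y z, G (x \ox (y \ox z)) = F x y z.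
Proof.
move=> F1 F2 F3; have hx x := tens_ext2 (F2 x) (F3 x).
pose g x := projT1 (cid (hx x)).
have gE x y z : g x (y \ox z) = F x y z := projT2 (cid (hx x)) y z.
have [t|x|G GE] := @tens_ext2 _ _ _ (fun x t => g x t).
- move=> c x x'; have hl : linear (fun t => c *: g x t + g x' t).
    by apply: lin_add; [apply: lin_scale|]; exact: linearP.
  apply: (@eq_tens _ _ _ (g (c *: x + x')) (mklin hl)) => y z /=.
  by rewrite !gE F1.
- exact: linearP.
- by exists G => x y z; rewrite GE gE.
Qed.

End Linear.

(* Proves linearity by following the head symbol of the body; lin_hook is
   extended below with further operations. *)
Ltac lin_hook := fail.
Ltac lin_step := match goal with
  | |- GRing.linear_for _ (fun x => x) => exact: lin_id
  | |- GRing.linear_for _ id => exact: lin_id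
  | |- GRing.linear_for _ (fun x => 0) => exact: lin_zero
  | |- GRing.linear_for _ (ptens ?a) => exact: ptens_linr
  | |- GRing.linear_for _ (GRing.mul ?t) => exact: (lin_mulr t (@lin_id _ _))
  | |- GRing.linear_for _ (GRing.scale ?c) => exact: (lin_scale c (@lin_id _ _))
  | |- GRing.linear_for _ (bm_l ?t) => exact: bm_l_linr
  | |- GRing.linear_for _ (bm_r ?m) => exact: bm_r_linr
  | |- GRing.linear_for _ (GRing.Linear.sort ?g) => exact: linearP
  | |- GRing.linear_for _ (fun x => GRing.Linear.sort ?g (@?f x)) =>
    apply: (@lin_app _ _ _ _ g f)
  | |- GRing.linear_for _ (fun x => cls ?R (@?f x)) =>
    apply: (@lin_cls _ _ _ R f)
  | |- GRing.linear_for _ (fun x => ptens (@?f x) ?v) =>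
    apply: (@lin_tensl _ _ _ _ f v)
  | |- GRing.linear_for _ (fun x => ptens ?v (@?f x)) =>
    apply: (@lin_tensr _ _ _ _ f v)
  | |- GRing.linear_for _ (fun x => @bm_l _ ?T ?M (@?f x) ?m) =>
    apply: (@lin_bml _ _ T M f m)
  | |- GRing.linear_for _ (fun x => @bm_l _ ?T ?M ?t (@?f x)) =>
    apply: (@lin_bmlr _ _ T M t f)
  | |- GRing.linear_for _ (fun x => @bm_r _ ?T ?M (@?f x) ?t) =>
    apply: (@lin_bmr _ _ T M t f)
  | |- GRing.linear_for _ (fun x => @bm_r _ ?T ?M ?m (@?f x)) =>
    apply: (@lin_bmrr _ _ T M m f)
  | |- GRing.linear_for _ (fun x => GRing.mul (@?f x) ?t) =>
    apply: (@lin_mull _ _ _ f t)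
  | |- GRing.linear_for _ (fun x => GRing.mul ?t (@?f x)) =>
    apply: (@lin_mulr _ _ _ f t)
  | |- GRing.linear_for _ (fun x => GRing.scale ?c (@?f x)) =>
    apply: (@lin_scale _ _ _ c f)
  | |- GRing.linear_for _ (fun x => GRing.scale (@?f x) ?v) =>
    apply: (@lin_scalel _ _ _ f v)
  | |- GRing.linear_for _ (fun x => GRing.add (@?f x) (@?g x)) =>
    apply: (@lin_add _ _ _ f g)
  | |- GRing.linear_for _ (fun x => GRing.opp (@?f x)) =>
    apply: (@lin_opp _ _ _ f)
  | |- GRing.linear_for _ (fun x => \sum_(i <- ?r) @?F x i) =>
    apply: (@linear_sumf _ _ _ _ r (fun i x => F x i)) => ?
  | _ => first [lin_hook | assumption | solve [eauto 2]]
  end.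
Ltac lin := repeat (cbv beta; lin_step).

Section Iso.
Variable k : comNzRingType.

Definition iso (U V : lmodType k) : Prop :=
  exists phi : {linear U -> V}, bijective phi.

Lemma iso_bij (U V : lmodType k) (f : {linear U -> V}) :
  (forall x, f x = 0 -> x = 0) -> (forall y, exists x, f x = y) -> iso U V.
Proof.
move=> f_inj f_surj; exists f.
have [g gK] : exists g, cancel g f.
  by exists (fun y => projT1 (cid (f_surj y))) => y; exact: (projT2 (cid (f_surj y))).
exists g => // x; apply/eqP; rewrite -subr_eq0; apply/eqP/f_inj.
by rewrite linearB gK subrr.
Qed.

Lemma iso_sym (U V : lmodType k) : iso U V -> iso V U.
Proof.
case=> f [g fK gK].
have gl : linear g.
  by move=> c x y; apply: (can_inj fK); rewrite linearP !gK.
by exists (mklin gl); exists f.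
Qed.

Lemma iso_trans (U V W : lmodType k) : iso U V -> iso V W -> iso U W.
Proof.
case=> f f_bij [g g_bij].
have hl : linear (fun x => g (f x)) by move=> c x y; rewrite !linearP.
by exists (mklin hl); exact: bij_comp.
Qed.

End Iso.

Section HomologyIso.
Variable k : comNzRingType.

Definition is_bdry (C : cplx k) n (x : cobj C n) : Prop :=
  exists y, x = cdiff C n y.

(** [homology] divides by the span of the boundaries. They already form a submodule, so the cycles
    of class zero are exactly the boundaries. *)
Lemma boundaries_submod (C : cplx k) n : is_submod (@boundaries k C n).
Proof.
split=> [|x y [u hu] [v hv]|c x [u hu]].
- by exists 0; rewrite linear0.
- by exists (u + v); rewrite linearD -hu -hv.
- by exists (c *: u); rewrite linearZ_LR -hu.
Qed.

(** All conditions concern cycles, and the two degrees may differ. This form fits connecting maps,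
    which lower the degree and behave well on cycles only. *)
Lemma homology_iso (C D : cplx k) n m (phi : {linear cobj C n -> cobj D m}) :
  (forall x, x \in @is_cycle k C n -> phi x \in @is_cycle k D m) ->
  (forall x, x \in @is_cycle k C n -> is_bdry x <-> is_bdry (phi x)) ->
  (forall y, y \in @is_cycle k D m ->
    exists2 x, x \in @is_cycle k C n & is_bdry (phi x - y)) ->
  iso (homology C n) (homology D m).
Proof.
move=> phi_cyc phi_bdry phi_surj.
pose phiz (z : cycles C n) : cycles D m := exist _ (phi (val z)) (phi_cyc _ (valP z)).
have phizl : linear (fun z => cls (@boundaries k D m) (phiz z)).
  move=> c x y; rewrite -cls_linear; congr (cls _ _); apply: val_inj.
  by rewrite /= !linearP.
have [|g gE] := @quotm_ext _ _ _ (@boundaries k C n) (mklin phizl).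
  move=> z zB; apply/cls_eq0/spanp_id; first exact: boundaries_submod.
  by apply/(phi_bdry _ (valP z)).
apply: (@iso_bij _ _ _ g).
  elim/quotm_ind => z; rewrite gE => /cls_eq0/(spanp_id _ (@boundaries_submod _ _)).
  move=> zB; apply/cls_eq0/spanp_id; first exact: boundaries_submod.
  by apply/(phi_bdry _ (valP z)).
elim/quotm_ind => y; have [x xC xB] := phi_surj _ (valP y).
pose z : cycles C n := exist _ x xC; exists (cls _ z); rewrite gE; apply/clsE/spanp_id => //.
exact: boundaries_submod.
Qed.

End HomologyIso.

(** * Dimension shifting *)

Section TensorMap.
Variables (k : comNzRingType) (U U' V V' : lmodType k).

Lemma tmap2_ex (f : {linear U -> U'}) (g : {linear V -> V'}) :
  exists h : {linear tens U V -> tens U' V'},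
    forall u v, h (u \ox v) = f u \ox g v.
Proof.
apply: (tens_ext2 (b := fun u v => f u \ox g v)) => ?.
  by apply/lin_tensl/lin_app/lin_id.
by apply/lin_tensr/lin_app/lin_id.
Qed.

Definition tmap2 (f : {linear U -> U'}) (g : {linear V -> V'}) :
  {linear tens U V -> tens U' V'} := projT1 (cid (tmap2_ex f g)).

Lemma tmap2E f g u v : tmap2 f g (u \ox v) = f u \ox g v.
Proof. exact: (projT2 (cid (tmap2_ex f g))). Qed.

End TensorMap.

Section Bimodules.
Variables (k : comNzRingType) (E : algType k).

Definition mull (e : E) : {linear E -> E} := mklin (lin_mulr e (@lin_id k E)).
Definition mulr_by (e : E) : {linear E -> E} := mklin (lin_mull e (@lin_id k E)).

Section Free.
Variable V : lmodType k.

(** The bracketing singles out the left factor E, which the contraction of the Hochschild complex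
    moves to the end of the word. *)
Definition free_car : lmodType k := tens E (tens V E).

Definition free_l (e : E) : {linear free_car -> free_car} :=
  tmap2 (mull e) (idfun : {linear _ -> _}).
Definition free_r (e : E) : {linear free_car -> free_car} :=
  tmap2 (idfun : {linear _ -> _}) (tmap2 (idfun : {linear V -> V}) (mulr_by e)).

Lemma free_lE e a x : free_l e (a \ox x) = (e * a) \ox x.
Proof. by rewrite /free_l tmap2E. Qed.
Lemma free_rE e a v b : free_r e (a \ox (v \ox b)) = a \ox (v \ox (b * e)).
Proof. by rewrite /free_r !tmap2E. Qed.

Lemma eq_free (W : lmodType k) (f g : {linear free_car -> W}) :
  (forall a v b, f (a \ox (v \ox b)) = g (a \ox (v \ox b))) -> f =1 g.
Proof.
move=> h; apply: eq_tens => a x.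
have fl : linear (fun y : tens V E => f (a \ox y)) by lin.
have gl : linear (fun y : tens V E => g (a \ox y)) by lin.
by apply: (@eq_tens _ _ _ _ (mklin fl) (mklin gl)); exact: h.
Qed.

Lemma free_l_linl x : linear (free_l^~ x).
Proof.
move=> c e e'.
have hl : linear (fun y => c *: free_l e y + free_l e' y) by lin.
apply: (@eq_tens _ _ _ _ (free_l (c *: e + e')) (mklin hl)) => a y.
have al : linear (fun e : E => (e * a) \ox y) by lin.
by rewrite /= !free_lE; exact: al.
Qed.

Lemma free_r_linr x : linear (free_r^~ x).
Proof.
move=> c e e'.
have hl : linear (fun y => c *: free_r e y + free_r e' y) by lin.
apply: (@eq_free _ (free_r (c *: e + e')) (mklin hl)) => a v b.
have bl : linear (fun e : E => a \ox (v \ox (b * e))) by lin.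
by rewrite /= !free_rE; exact: bl.
Qed.

Lemma free_l1 x : free_l 1 x = x.
Proof.
apply: (@eq_tens _ _ _ _ (free_l 1) (idfun : {linear _ -> _})) => a y.
by rewrite free_lE mul1r.
Qed.

Lemma free_r1 x : free_r 1 x = x.
Proof.
apply: (@eq_free _ (free_r 1) (idfun : {linear _ -> _})) => a v b.
by rewrite free_rE mulr1.
Qed.

Lemma free_lA e e' x : free_l (e * e') x = free_l e (free_l e' x).
Proof.
have hl : linear (fun y => free_l e (free_l e' y)) by lin.
apply: (@eq_tens _ _ _ _ (free_l (e * e')) (mklin hl)) => a y.
by rewrite /= !free_lE mulrA.
Qed.

Lemma free_rA x e e' : free_r (e * e') x = free_r e' (free_r e x).
Proof.
have hl : linear (fun y => free_r e' (free_r e y)) by lin.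
apply: (@eq_free _ (free_r (e * e')) (mklin hl)) => a v b.
by rewrite /= !free_rE mulrA.
Qed.

Lemma free_lrA e x e' : free_r e' (free_l e x) = free_l e (free_r e' x).
Proof.
have hl : linear (fun y => free_r e' (free_l e y)) by lin.
have hr : linear (fun y => free_l e (free_r e' y)) by lin.
apply: (@eq_free _ (mklin hl) (mklin hr)) => a v b.
by rewrite /= !(free_rE, free_lE).
Qed.

Definition free_bim : bimodule E :=
  @Bimodule k E free_car free_l (fun x e => free_r e x) free_l_linl
    (fun e => linearP (free_l e)) (fun e => linearP (free_r e)) free_r_linr
    free_l1 free_r1 free_lA free_rA free_lrA.

End Free.

Definition is_bmor (M N : bimodule E) (phi : M -> N) : Prop :=
  (forall e m, phi (bm_l e m) = bm_l e (phi m)) /\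
  (forall e m, phi (bm_r m e) = bm_r (phi m) e).

Section Kernel.
Variables (P M : bimodule E) (p : {linear P -> M}) (p_mor : is_bmor p).

Definition in_ker : {pred P} := fun x => p x == 0.

Fact in_ker_submod : submod_closed in_ker.
Proof.
split; first by apply/eqP; exact: linear0.
by move=> c x y /eqP hx /eqP hy; apply/eqP; rewrite linearP hx hy scaler0 addr0.
Qed.
HB.instance Definition _ :=
  GRing.isSubmodClosed.Build k P in_ker in_ker_submod.

Definition ker_car : Type := {x : P | x \in in_ker}.
HB.instance Definition _ := SubType.on ker_car.
HB.instance Definition _ := Choice.on ker_car.
HB.instance Definition _ := [SubChoice_isSubLmodule of ker_car by <:].

Lemma ker_l_subproof e (x : ker_car) : bm_l e (val x) \in in_ker.
Proof.
have [pl _] := p_mor; rewrite unfold_in /in_ker pl (eqP (valP x)).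
by rewrite (linf0 (@bm_l_linr k E M e)).
Qed.
Lemma ker_r_subproof e (x : ker_car) : bm_r (val x) e \in in_ker.
Proof.
have [_ pr] := p_mor; rewrite unfold_in /in_ker pr (eqP (valP x)).
by rewrite (linf0 (@bm_r_linl k E M e)).
Qed.

Definition ker_l e x : ker_car :=
  exist (fun y => y \in in_ker) _ (ker_l_subproof e x).
Definition ker_r x e : ker_car :=
  exist (fun y => y \in in_ker) _ (ker_r_subproof e x).

Lemma ker_l_linl m : linear (ker_l^~ m).
Proof. by move=> c e e'; apply: val_inj; rewrite [RHS]linearP; exact: bm_l_linl. Qed.
Lemma ker_l_linr e : linear (ker_l e).
Proof. by move=> c x y; apply: val_inj; rewrite [RHS]linearP; exact: bm_l_linr. Qed.
Lemma ker_r_linl e : linear (ker_r^~ e).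
Proof. by move=> c x y; apply: val_inj; rewrite [RHS]linearP; exact: bm_r_linl. Qed.
Lemma ker_r_linr m : linear (ker_r m).
Proof. by move=> c e e'; apply: val_inj; rewrite [RHS]linearP; exact: bm_r_linr. Qed.
Lemma ker_l1 m : ker_l 1 m = m.
Proof. by apply: val_inj; rewrite /= bm_l1. Qed.
Lemma ker_r1 m : ker_r m 1 = m.
Proof. by apply: val_inj; rewrite /= bm_r1. Qed.
Lemma ker_lA e e' m : ker_l (e * e') m = ker_l e (ker_l e' m).
Proof. by apply: val_inj; rewrite /= bm_lA. Qed.
Lemma ker_rA m e e' : ker_r m (e * e') = ker_r (ker_r m e) e'.
Proof. by apply: val_inj; rewrite /= bm_rA. Qed.
Lemma ker_lrA e m e' : ker_r (ker_l e m) e' = ker_l e (ker_r m e').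
Proof. by apply: val_inj; rewrite /= bm_lrA. Qed.

Definition ker_bim : bimodule E :=
  @Bimodule k E ker_car ker_l ker_r ker_l_linl ker_l_linr ker_r_linl ker_r_linr
    ker_l1 ker_r1 ker_lA ker_rA ker_lrA.

End Kernel.

(** A set of generators only: [quotm] takes the span, so that the quotient by [comm] is M/[E, M]. *)
Definition comm (M : bimodule E) : set M :=
  fun x => exists e m, x = bm_l e m - bm_r m e.

End Bimodules.

Section Resolving.
Variables (k : comNzRingType) (E : algType k).

(** Compatibility with the differentials is a separate condition, since the maps induced by k-linear
    splittings do not satisfy it in general. *)
Definition degmap (C D : cplx k) : Type := forall n, {linear cobj C n -> cobj D n}.

Definition chain_map (C D : cplx k) (f : degmap C D) : Prop :=
  forall n x, f n (cdiff C n x) = cdiff D n (f n.+1 x).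

(* A homology theory that agrees with M/[E,M] in degree 0, vanishes on free
   bimodules in positive degrees and turns k-split short exact sequences of
   bimodules into degreewise split sequences of complexes. *)
Record resolving (F : bimodule E -> cplx k)
    (theta : forall M, {linear cobj (F M) 0 -> quotm (@comm k E M)}) : Prop := {
  res_split : forall (K P M : bimodule E) (i : {linear K -> P})
      (p : {linear P -> M}) (r : {linear P -> K}) (s : {linear M -> P}),
    is_bmor i -> is_bmor p -> (forall x, r (i x) = x) ->
    (forall x, p (s x) = x) -> (forall x, i (r x) + s (p x) = x) ->
    exists (fi : degmap (F K) (F P)) (fp : degmap (F P) (F M))
      (fr : degmap (F P) (F K)) (fs : degmap (F M) (F P)),
      [/\ chain_map fi, chain_map fp, forall n x, fr n (fi n x) = x,
          forall n x, fp n (fs n x) = x &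
          forall n x, fi n (fr n x) + fs n (fp n x) = x] /\
      forall x m, theta K x = cls _ m -> theta P (fi 0 x) = cls _ (i m);
  res_dd : forall V n x,
    cdiff (F (free_bim E V)) n (cdiff (F (free_bim E V)) n.+1 x) = 0;
  res_acyclic : forall V n x,
    cdiff (F (free_bim E V)) n x = 0 -> is_bdry x;
  res_theta_surj : forall M y, exists x, theta M x = y;
  res_theta0 : forall M x, theta M x = 0 <-> is_bdry x
}.

Section Shift.
Variables (CK CP CM : cplx k) (fi : degmap CK CP) (fp : degmap CP CM).
Variables (fr : degmap CP CK) (fs : degmap CM CP).
Hypotheses (fi_chain : chain_map fi) (fp_chain : chain_map fp).
Hypotheses (friK : forall n x, fr n (fi n x) = x).
Hypotheses (fpsK : forall n x, fp n (fs n x) = x).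
Hypotheses (fisp : forall n x, fi n (fr n x) + fs n (fp n x) = x).
Hypothesis ddP : forall n x, cdiff CP n (cdiff CP n.+1 x) = 0.
Hypothesis acyclicP : forall n x, cdiff CP n x = 0 -> is_bdry x.

Lemma fi_inj n x : fi n x = 0 -> x = 0.
Proof. by move=> /(congr1 (fr n)); rewrite friK linear0. Qed.

Lemma fi0E n x : fp n x = 0 -> fi n (fr n x) = x.
Proof. by move=> px; have := fisp x; rewrite px linear0 addr0. Qed.

(** Evaluating i r + s p = id at i x and using r i = id gives s p i x = 0, and s is injective. *)
Lemma fpi n x : fp n (fi n x) = 0.
Proof.
have := fisp (fi n x); rewrite friK -[X in _ = X]addr0 => /addrI.
by move=> /(congr1 (fp n)); rewrite fpsK linear0.
Qed.

(** The connecting map of the snake lemma. The degreewise splittings give it the linear formula r d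
    s on all chains, so that no lift has to be chosen. *)
Definition connect n : {linear cobj CM n.+1 -> cobj CK n} :=
  mklin (lin_app (fr n) (lin_app (cdiff CP n) (linearP (fs n.+1)))).

(** For a cycle x, p kills d s x, and i r is the identity on the kernel of p. *)
Lemma connectE n x : cdiff CM n x = 0 ->
  fi n (connect n x) = cdiff CP n (fs n.+1 x).
Proof. by move=> dx; rewrite /= fi0E // fp_chain fpsK. Qed.

(** If x = d z, then s x - d s z comes from K and has the same boundary as s x. Conversely, if the
    connecting map sends x to d w, then s x - i w is a cycle of the acyclic complex, hence some d u,
    and x = d p u. *)
Lemma connect_bdry n x : cdiff CM n x = 0 ->
  is_bdry x <-> is_bdry (connect n x).
Proof.
move=> dx; split=> [[z xE]|[w wE]].
  pose u := fs n.+1 x - cdiff CP n.+1 (fs n.+2 z).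
  have pu : fp n.+1 u = 0 by rewrite linearB fp_chain !fpsK -xE subrr.
  exists (fr n.+1 u); apply/eqP; rewrite -subr_eq0; apply/eqP/fi_inj.
  by rewrite linearB connectE // fi_chain fi0E // linearB ddP subr0 subrr.
have [|u uE] := acyclicP (n := n) (x := fs n.+1 x - fi n.+1 w).
  by rewrite linearB -fi_chain -wE connectE // subrr.
by exists (fp n.+2 u); rewrite -fp_chain -uE linearB fpi fpsK subr0.
Qed.

(** If i y = d u, then p u is a cycle, and its connecting value differs from y by the boundary of -
    r u. *)
Lemma connect_surj n y : is_bdry (fi n y) ->
  exists2 x, cdiff CM n x = 0 & is_bdry (connect n x - y).
Proof.
move=> [u uE]; exists (fp n.+1 u); first by rewrite -fp_chain -uE fpi.
exists (- fr n.+1 u); apply/eqP; rewrite subr_eq linearN addrC; apply/eqP.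
have sE : fs n.+1 (fp n.+1 u) = u - fi n.+1 (fr n.+1 u).
  by apply/eqP; rewrite eq_sym subr_eq addrC fisp.
by rewrite /= sE !linearB -uE -fi_chain !friK.
Qed.

Lemma shift_iso n : iso (homology CM n.+2) (homology CK n.+1).
Proof.
apply: (homology_iso (phi := connect n.+1)).
- move=> x /eqP dx; apply/eqP/fi_inj.
  by rewrite fi_chain connectE // ddP.
- by move=> x /eqP; exact: connect_bdry.
- move=> y /eqP dy; have [|x dx xB] := @connect_surj n.+1 y.
    by apply: (acyclicP (n := n)); rewrite -fi_chain dy linear0.
  by exists x => //; apply/eqP.
Qed.

Section Degree1.
Variables (QK QP : lmodType k) (qi : {linear QK -> QP}).
Variables (thK : {linear cobj CK 0 -> QK}) (thP : {linear cobj CP 0 -> QP}).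
Hypothesis thiE : forall x, thP (fi 0 x) = qi (thK x).
Hypothesis thK_surj : forall y, exists x, thK x = y.
Hypothesis thK0 : forall x, thK x = 0 <-> is_bdry x.
Hypothesis thP0 : forall x, thP x = 0 <-> is_bdry x.

(** Presents the kernel of qi : QK -> QP as the homology in degree 1 of a complex, so that
    [homology_iso] applies to it. With qi = 0 its homology in degree 0 is QP. *)
Definition two_obj (n : nat) : lmodType k := if n is 0 then QP else QK.
Definition two_diff n : {linear two_obj n.+1 -> two_obj n} :=
  match n return {linear two_obj n.+1 -> two_obj n} with
  | 0 => qi
  | m.+1 => \0
  end.

Definition two_cplx : cplx k := Cplx two_diff.

Lemma shift_iso1 : iso (homology CM 1) (homology two_cplx 1).
Proof.
pose phi : {linear cobj CM 1 -> cobj two_cplx 1} :=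
  mklin (lin_app thK (linearP (connect 0))).
have phi0 x : cdiff CM 0 x = 0 -> is_bdry x <-> phi x = 0.
  by move=> dx; rewrite (connect_bdry dx) /= thK0.
apply: (homology_iso (phi := phi)).
- move=> x /eqP dx; apply/eqP; rewrite -[LHS]/(qi (thK (connect 0 x))) -thiE.
  (* The image of the connecting value under i is d s x, a boundary in the complex of P, so its
     class in QP vanishes. *)
  by apply/thP0; rewrite connectE //; exists (fs 1 x).
- move=> x /eqP /phi0 ->; split=> [->|[y ->]] //.
  by exists 0; rewrite linear0.
- move=> y /eqP yC; have [c cE] := thK_surj y.
  (* A class in the kernel of qi is represented by c with i c a boundary, which is what
     [connect_surj] asks for. In higher degrees acyclicity plays this part. *)
  have [|x dx xB] := @connect_surj 0 c; first by apply/thP0; rewrite thiE cE.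
  exists x; first exact/eqP.
  exists 0; rewrite linear0 -cE.
  by apply: etrans (esym (linearB thK (connect 0 x) c)) _; apply/thK0.
Qed.

End Degree1.
End Shift.

Section Cover.
Variable M : bimodule E.

Definition cover_ex : exists p : {linear free_bim E M -> M},
  forall a m b, p (a \ox (m \ox b)) = bm_r (bm_l a m) b.
Proof.
have hE (a : E) : exists g : {linear tens M E -> M},
    forall m b, g (m \ox b) = bm_r (bm_l a m) b.
  by apply: (tens_ext2 (b := fun m b => bm_r (bm_l a m) b)) => ?; lin.
pose g a := projT1 (cid (hE a)).
have gE a m b : g a (m \ox b) = bm_r (bm_l a m) b := projT2 (cid (hE a)) m b.
have [||p pE] := @tens_ext2 _ _ _ _ (fun a x => g a x); last first.
- by exists p => a m b; rewrite pE gE.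
- by move=> a; lin.
- move=> x c a a'.
  have hl : linear (fun y => c *: g a y + g a' y) by lin.
  apply: (@eq_tens _ _ _ _ (g (c *: a + a')) (mklin hl)) => m b /=.
  have al : linear (fun a => bm_r (bm_l a m) b) by lin.
  by rewrite !gE al.
Qed.

Definition cover : {linear free_bim E M -> M} := projT1 (cid cover_ex).

Lemma coverE a m b : cover (a \ox (m \ox b)) = bm_r (bm_l a m) b.
Proof. exact: (projT2 (cid cover_ex)). Qed.

Lemma cover_mor : is_bmor cover.
Proof.
split=> e x.
  have fl : linear (fun y => cover (free_l M e y)) by lin.
  have gl : linear (fun y => bm_l e (cover y)) by lin.
  apply: (@eq_free _ _ _ _ (mklin fl) (mklin gl)) => a m b.
  by rewrite /= free_lE !coverE bm_lA bm_lrA.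
have fl : linear (fun y => cover (free_r M e y)) by lin.
have gl : linear (fun y => bm_r (cover y) e) by lin.
apply: (@eq_free _ _ _ _ (mklin fl) (mklin gl)) => a m b.
by rewrite /= free_rE !coverE bm_rA.
Qed.

(** The section m |-> 1 (x) m (x) 1 is k-linear for every k but in general not a map of bimodules;
    this is why only k-split sequences can be asked for. *)
Definition cover_sec : {linear M -> free_bim E M} :=
  mklin (lin_tensr (1 : E) (lin_tensl (1 : E) (@lin_id k M))).

Lemma cover_secK x : cover (cover_sec x) = x.
Proof. by rewrite coverE bm_l1 bm_r1. Qed.

Definition cover_ker : bimodule E := ker_bim cover_mor.
Definition cover_inc : {linear cover_ker -> free_bim E M} := val.

Lemma cover_retr_subproof x : x - cover_sec (cover x) \in in_ker cover.
Proof. by apply/eqP; rewrite linearB cover_secK subrr. Qed.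

Definition cover_retr_fun x : cover_ker :=
  exist (fun y => y \in in_ker cover) _ (cover_retr_subproof x).
Lemma cover_retr_linear : linear cover_retr_fun.
Proof.
have l : linear (fun x => x - cover_sec (cover x)) by lin.
by move=> c x y; apply: val_inj; rewrite [RHS]linearP; exact: l.
Qed.
Definition cover_retr : {linear free_bim E M -> cover_ker} :=
  mklin cover_retr_linear.

End Cover.

(** Induction on n with M variable: shifting replaces M by the kernel of its cover and lowers the
    degree by one. In degrees 0 and 1 both theories are compared with a complex made from quotients
    by commutators, which mentions neither F nor G. *)
Lemma resolving_iso F thF G thG n (M : bimodule E) :
  @resolving F thF -> @resolving G thG ->
  iso (homology (F M) n) (homology (G M) n).
Proof.
move=> rF rG; pose Q N : lmodType k := quotm (@comm k E N).
have deg0 F' thF' N : @resolving F' thF' ->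
    iso (homology (F' N) 0) (homology (two_cplx (\0 : {linear Q N -> Q N})) 0).
  move=> rF'; pose D := two_cplx (\0 : {linear Q N -> Q N}).
  apply: (@homology_iso k (F' N) D 0 0 (thF' N)) => // [x _|y _].
    rewrite -(res_theta0 rF'); split=> [->|[y ->]] //.
    by exists 0; rewrite linear0.
  have [x <-] := res_theta_surj rF' y.
  by exists x => //; exists 0; rewrite linear0 subrr.
pose P N := free_bim E N; pose K N := cover_ker N; pose i N := @cover_inc N.
have i_mor N : is_bmor (i N) by [].
have riK N x : @cover_retr N (i N x) = x.
  apply: val_inj; have cx : cover N (i N x) = 0 := eqP (valP x).
  by rewrite -[LHS]/(i N x - cover_sec N (cover N (i N x))) cx linear0 subr0.
have isp N x : i N (@cover_retr N x) + cover_sec N (cover N x) = x.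
  exact: subrK.
have split F' thF' N (rF' : @resolving F' thF') :=
  res_split rF' (i_mor N) (cover_mor N) (@riK N) (@cover_secK N) (@isp N).
(* The inclusion of the kernel induces a map on quotients by commutators. It need not be injective,
   and its kernel is the common value of H_1. *)
have qi_ex N : exists g : {linear Q (K N) -> Q (P N)},
    forall x, g (cls _ x) = cls _ (i N x).
  have il : linear (fun x => cls (@comm k E (P N)) (i N x)) by lin.
  have [|g gE] := @quotm_ext _ _ _ (@comm k E (K N)) (mklin il); last by exists g.
  move=> _ [e [m ->]]; apply/cls_eq0/spanp_sub; exists e, (i N m).
  by rewrite linearB; have [-> ->] := i_mor N.
pose qi N := projT1 (cid (qi_ex N)).
have qiE N x : qi N (cls _ x) = cls _ (i N x) := projT2 (cid (qi_ex N)) x.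
have deg1 F' thF' N : @resolving F' thF' ->
    iso (homology (F' N) 1) (homology (two_cplx (qi N)) 1).
  move=> rF'; have [fi [fp [fr [fs [[c1 c2 h1 h2 h3] h4]]]]] := split _ _ N rF'.
  apply: (shift_iso1 c1 c2 h1 h2 h3 (@res_dd _ _ rF' N) (@res_acyclic _ _ rF' N)
    (thK := thF' (K N)) (thP := thF' (P N))).
  - move=> x; rewrite -[thF' (K N) x]clsK qiE; apply: h4.
    by rewrite clsK.
  - exact: (res_theta_surj rF').
  - exact: (res_theta0 rF').
  - exact: (res_theta0 rF').
have step F' thF' N j : @resolving F' thF' ->
    iso (homology (F' N) j.+2) (homology (F' (K N)) j.+1).
  move=> rF'; have [fi [fp [fr [fs [[c1 c2 h1 h2 h3] h4]]]]] := split _ _ N rF'.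
  exact: (shift_iso c1 c2 h1 h2 h3 (@res_dd _ _ rF' N) (@res_acyclic _ _ rF' N)).
case: n => [|n].
  by apply: iso_trans (deg0 _ _ M rF) _; apply: iso_sym; exact: deg0 rG.
elim: n M => [|n IHn] M.
  by apply: iso_trans (deg1 _ _ M rF) _; apply: iso_sym; exact: deg1 rG.
apply: iso_trans (step _ _ M n rF) _; apply: iso_trans (IHn (K M)) _.
by apply: iso_sym; exact: step rG.
Qed.

End Resolving.

(** * Hochschild boundaries on words *)

Section Words.
Variables (k : comNzRingType) (W : lmodType k).

(** Words are lists, so that proofs can recurse on letters. The length n is part of each condition,
    and words of other lengths are left unconstrained. *)
Definition slin (V : lmodType k) n (psi : seq V -> W) : Prop :=
  forall s1 s2, (size s1 + size s2).+1 = n -> linear (fun x => psi (s1 ++ x :: s2)).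

Definition svan (V : lmodType k) (S : set V) n (psi : seq V -> W) : Prop :=
  forall s1 s2 x, (size s1 + size s2).+1 = n -> S x -> psi (s1 ++ x :: s2) = 0.

Variable T : algType k.
Variable S : set T.

Definition sbal n (psi : seq T -> W) : Prop :=
  forall s1 s2 x s y, (size s1 + size s2).+2 = n -> S s ->
    psi (s1 ++ x * s :: y :: s2) = psi (s1 ++ x :: s * y :: s2).

Lemma slin_cons (V : lmodType k) n psi (z : V) :
  slin n.+1 psi -> slin n (fun u => psi (z :: u)).
Proof. by move=> pl t1 t2 tE; apply: (pl (z :: t1)); rewrite /= addSn tE. Qed.

Lemma svan_cons (V : lmodType k) (X : set V) n psi (z : V) :
  svan X n.+1 psi -> svan X n (fun u => psi (z :: u)).
Proof.
by move=> pv t1 t2 a tE; apply: (pv (z :: t1)); rewrite /= addSn tE.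
Qed.

Lemma sbal_cons n psi z : sbal n.+1 psi -> sbal n (fun u => psi (z :: u)).
Proof.
by move=> pb t1 t2 a b c tE; apply: (pb (z :: t1)); rewrite /= addSn tE.
Qed.

(** The alternating sum of the inner faces, the first with sign +. Keeping the first letter inside
    the functional makes it a recursion, in which the subtraction produces the signs. *)
Fixpoint mid (s : seq T) (psi : seq T -> W) : W :=
  if s is x :: s' then
    if s' is y :: t then psi (x * y :: t) - mid s' (fun u => psi (x :: u)) else 0
  else 0.

Lemma mid_cons x y t psi :
  mid (x :: y :: t) psi = psi (x * y :: t) - mid (y :: t) (fun u => psi (x :: u)).
Proof. by []. Qed.

Lemma eq_mid s psi1 psi2 :
  (forall u, (size u).+1 = size s -> psi1 u = psi2 u) -> mid s psi1 = mid s psi2.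
Proof.
elim: s psi1 psi2 => [|x [|y t] IHs] psi1 psi2 h //.
rewrite !mid_cons h //; congr (_ - _).
by apply: IHs => u su; apply: h; rewrite /= su.
Qed.

Lemma mid0 s : mid s (fun=> 0) = 0.
Proof. by elim: s => [|x [|y t] IHs] //; rewrite mid_cons IHs subrr. Qed.

Lemma midD s psi1 psi2 :
  mid s (fun u => psi1 u + psi2 u) = mid s psi1 + mid s psi2.
Proof.
elim: s psi1 psi2 => [|x [|y t] IHs] psi1 psi2; rewrite ?addr0 //.
by rewrite !mid_cons IHs opprD addrACA.
Qed.

Lemma midZ s c psi : mid s (fun u => c *: psi u) = c *: mid s psi.
Proof.
elim: s psi => [|x [|y t] IHs] psi; rewrite ?scaler0 //.
by rewrite !mid_cons IHs scalerBr.
Qed.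

Lemma midN s psi : mid s (fun u => - psi u) = - mid s psi.
Proof.
rewrite -scaleN1r -midZ; apply: eq_mid => u _; by rewrite scaleN1r.
Qed.

Lemma mid_lin (U : lmodType k) s (psi : U -> seq T -> W) :
  (forall u, (size u).+1 = size s -> linear (psi^~ u)) ->
  linear (fun x => mid s (psi x)).
Proof.
move=> h c x y.
rewrite -midZ -midD; apply: eq_mid => u su; exact: h.
Qed.

(** A factor on the left of the first letter stays there in every inner face: the first face keeps
    it by associativity, the others do not touch it. Balancing and [mid_mid] both rest on this. *)
Lemma mid_equivl s y t psi1 psi2 :
  (forall z u, (size u).+1 = size t -> psi1 (z :: u) = psi2 (s * z :: u)) ->
  mid (y :: t) psi1 = mid (s * y :: t) psi2.
Proof.
case: t => [|z t] // h; rewrite !mid_cons -mulrA -h //; congr (_ - _).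
by apply: eq_mid => u [su]; rewrite h //= su.
Qed.

Lemma mid_equivr s y t psi1 psi2 :
  (forall z u, (size u).+1 = size t -> psi1 (rcons u (z * s)) = psi2 (rcons u z)) ->
  mid (rcons t (y * s)) psi1 = mid (rcons t y) psi2.
Proof.
elim: t psi1 psi2 => [|x [|x' t] IHt] psi1 psi2 h //.
  by rewrite /= !subr0 mulrA (h _ [::]).
have e := h y (x * x' :: t) (erefl _); rewrite !rcons_cons in e.
rewrite /= e; congr (_ - _).
apply: (IHt (fun u => psi1 (x :: u)) (fun u => psi2 (x :: u))) => z u su.
by apply: (h z (x :: u)); rewrite /= su.
Qed.

Lemma mid_rcons u y z psi :
  mid (rcons (rcons u y) z) psi =
  mid (rcons u y) (fun v => psi (rcons v z)) +
  (-1) ^+ size u *: psi (rcons u (y * z)).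
Proof.
elim: u psi => [|x [|x' u] IHu] psi.
- by rewrite /= subr0 add0r scale1r.
- by rewrite /= !subr0 expr1 scaleN1r.
have := IHu (fun v => psi (x :: v)); rewrite [in LHS]/= => IH.
by rewrite /= IH opprD addrA exprS mulN1r scaleNr.
Qed.

(** In the inner faces of x :: u, those merging x with the first letter of u sum to the term where x
    and y were merged beforehand, by [mid_equivl]. The others vanish by induction. *)
Lemma mid_mid s psi : mid s (fun u => mid u psi) = 0.
Proof.
elim: s psi => [|x [|y t] IHs] psi //.
rewrite mid_cons.
have -> : mid (y :: t) (fun u => mid (x :: u) psi) =
    mid (y :: t) (fun u => if u is v :: u' then psi (x * v :: u') else 0)
    - mid (y :: t) (fun u => mid u (fun v => psi (x :: v))).
  rewrite -midN -midD; apply: eq_mid => -[|v u] _; by rewrite ?subrr.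
rewrite IHs subr0; apply/eqP; rewrite subr_eq0; apply/eqP/esym.
apply: (@mid_equivl x y t (fun u => if u is v :: u' then psi (x * v :: u') else 0)).
by move=> z u _.
Qed.

Lemma mid_slin n psi : slin n psi -> slin n.+1 (fun s => mid s psi).
Proof.
move=> + s1; elim: s1 n psi => [|z s1 IHs] n psi pl s2 /=.
  case: s2 => [|y t] /= nE; first exact: lin_zero.
  case: nE pl => <- pl; apply: lin_add.
    by apply: (@lin_comp _ _ _ _ (fun x => psi (x :: t)));
      [exact: (pl [::] t) | exact/lin_mull/lin_id].
  apply/lin_opp/(@mid_lin _ (y :: t) (fun x u => psi (x :: u))) => u su.
  by apply: (pl [::] u); rewrite /= add0n su.
case: n pl => [|n] pl [nE] //.
have IH := IHs n _ (@slin_cons _ n psi z pl) s2 (congr1 succn nE).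
case: s1 {IHs} nE IH => [|z' s1] nE IH; apply: lin_add; try exact: lin_opp.
  by apply: (@lin_comp _ _ _ _ (fun x => psi (x :: s2)));
    [apply: (pl [::] s2); rewrite -nE | exact/lin_mulr/lin_id].
by apply: (pl (z * z' :: s1)); rewrite -nE.
Qed.

Lemma mid_sbal n psi : sbal n psi -> sbal n.+1 (fun s => mid s psi).
Proof.
move=> + s1; elim: s1 n psi => [|z s1 IHs] n psi pb s2 x s y /= [nE] Ss.
  rewrite -mulrA; congr (_ - _).
  apply: (@mid_equivl s y s2 (fun u => psi (x * s :: u))
    (fun u => psi (x :: u))) => w u su.
  by apply: (pb [::]); rewrite //= su -nE.
case: n pb nE => [|n] // pb [nE].
have IH := IHs n _ (@sbal_cons n psi z pb) s2 x s y (congr1 succn nE) Ss.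
case: s1 {IHs} nE IH => [|z' s1] nE IH; rewrite [LHS]/= [RHS]/=;
  congr (_ - _); try exact: IH.
  by rewrite mulrA (pb [::]) // -nE.
by rewrite (pb (z * z' :: s1)) // -nE.
Qed.

Lemma mid_svan0 n psi x y t : svan S n psi -> (size t).+1 = n -> S x ->
  mid (x :: y :: t) psi = psi (x * y :: t).
Proof.
move=> pv nE Sx; rewrite mid_cons (@eq_mid _ _ (fun=> 0)) ?mid0 ?subr0 //.
by move=> u /= su; apply: (pv [::] u) => //; rewrite -nE -su.
Qed.

(** Faces away from x still contain this letter of S and vanish. The two that merge x with a
    neighbour carry opposite signs and agree by balancing. *)
Lemma mid_svan n psi z s1 x y t : svan S n psi -> sbal n psi ->
  (size s1 + size t).+2 = n -> S x -> mid (z :: s1 ++ x :: y :: t) psi = 0.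
Proof.
elim: s1 n psi z => [|z' s1 IHs] [|n] psi z // pv pb [nE] Sx.
  rewrite mid_cons (@mid_svan0 n) //; last exact: svan_cons.
  by rewrite (pb [::]) ?subrr // -nE.
rewrite mid_cons (pv (z * z' :: s1)) //; last by rewrite /= -nE addnS.
by rewrite (IHs n) ?subr0 //; [exact: svan_cons | exact: sbal_cons].
Qed.

End Words.

Lemma mid_map (k : comNzRingType) (W W' : lmodType k) (T : algType k)
    (g : W -> W') (s : seq T) psi :
  linear g -> g (mid s psi) = mid s (fun u => g (psi u)).
Proof.
move=> gl; elim: s psi => [|x [|y t] IHs] psi; rewrite ?(linf0 gl) //.
by rewrite !mid_cons (linfB gl) IHs.
Qed.

Section Boundary.
Variables (k : comNzRingType) (T : algType k) (S : set T) (M : bimodule T).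
Variable W : lmodType k.
Implicit Types (phi : M -> seq T -> W) (m : M) (t u : seq T).

(** Balancing at each place of the cyclic word: between letters, between m and the first letter,
    between the last letter and m. Without letters, m is its own neighbour, whence the clause for n
    = 0. *)
Definition bal n phi : Prop :=
  [/\ forall m, sbal S n (phi m),
      n = 0%N -> forall m s, S s -> phi (bm_r m s) [::] = phi (bm_l s m) [::],
      forall m s x t, (size t).+1 = n -> S s ->
        phi (bm_r m s) (x :: t) = phi m (s * x :: t) &
      forall m s x t, (size t).+1 = n -> S s ->
        phi m (rcons t (x * s)) = phi (bm_l s m) (rcons t x)].

(* The functionals that factor through a balanced tensor product of M with n
   copies of T/S. *)
Definition good n phi : Prop :=
  [/\ forall s, size s = n -> linear (phi^~ s), forall m, slin n (phi m),
      forall m, svan S n (phi m) & bal n phi].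

Definition fst_face phi m s : W := if s is x :: t then phi (bm_r m x) t else 0.
Definition lst_face phi m s : W :=
  if s is x :: t then phi (bm_l (last x t) m) (belast x t) else 0.

Lemma lst_face_rcons phi m t z : lst_face phi m (rcons t z) = phi (bm_l z m) t.
Proof. by case: t => [|x t] //=; rewrite last_rcons belast_rcons. Qed.

(** The Hochschild boundary followed by phi. The minus before [mid] is the sign of the first inner
    face. *)
Definition bd phi m s : W :=
  fst_face phi m s - mid s (phi m) + (-1) ^+ size s *: lst_face phi m s.

(** This is why the boundary descends to the balanced quotients. The delicate clause is vanishing on
    a letter of S, where the faces do not all vanish singly and two of them have to cancel. *)
Lemma bd_good n phi : good n phi -> good n.+1 (bd phi).
Proof.
case=> pm pl pv [ps p0 pL pR]; split; last split.
- move=> s sn; apply: lin_add; last first.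
    apply: lin_scale; case: s sn => [|x t] [tn] /=; first exact: lin_zero.
    apply: (@lin_comp _ _ _ _ (phi^~ (belast x t)) (bm_l (last x t))); last by lin.
    by apply: pm; rewrite size_belast.
  apply: lin_add; last first.
    by apply/lin_opp/mid_lin => u su; apply: pm; rewrite sn in su; case: su.
  case: s sn => [|x t] [tn] /=; first exact: lin_zero.
  by apply: (@lin_comp _ _ _ _ (phi^~ t) (fun m => bm_r m x)); [exact: pm | lin].
- move=> m s1 s2 sn; apply: lin_add; last first.
    have -> : (fun x => (-1) ^+ size (s1 ++ x :: s2) *:
        lst_face phi m (s1 ++ x :: s2)) =
      (fun x => (-1) ^+ n.+1 *: lst_face phi m (s1 ++ x :: s2)).
      by apply: functional_extensionality_dep => x; rewrite size_cat /= addnS sn.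
    apply: lin_scale; case/lastP: s2 sn => [|s2 z] sn.
      have -> : (fun x => lst_face phi m (s1 ++ [:: x])) =
                (fun x => phi (bm_l x m) s1).
        by apply: functional_extensionality_dep => x; rewrite cats1 lst_face_rcons.
      apply: (@lin_comp k T M W (phi^~ s1) (fun x => bm_l x m)); last by lin.
      by apply: pm; case: sn; rewrite addn0.
    have -> : (fun x => lst_face phi m (s1 ++ x :: rcons s2 z)) =
              (fun x => phi (bm_l z m) (s1 ++ x :: s2)).
      apply: functional_extensionality_dep => x.
      by rewrite -rcons_cons -rcons_cat lst_face_rcons.
    by apply: pl; case: sn; rewrite size_rcons addnS.
  apply: lin_add; last exact/lin_opp/(mid_slin (pl m)).
  case: s1 sn => [|x s1] [sn] /=; last exact: pl.
  by apply: (@lin_comp k T M W (phi^~ s2) (bm_r m)); [exact: pm | lin].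
- move=> m s1 s2 x [sn] Sx; rewrite /bd.
  (* The letter x of S is last, first or inner. Each time the two faces that multiply it into its
     cyclic neighbours cancel by balancing, and all others keep x as a letter. *)
  case/lastP: s2 sn => [|s2 y] sn; last case: s1 sn => [|z s1] sn.
  + rewrite cats1 lst_face_rcons size_rcons; rewrite addn0 in sn.
    case/lastP: s1 sn => [|s1 z] sn.
      by rewrite /= p0 -?sn // subr0 expr1 scaleN1r subrr.
    rewrite -pR //; last by rewrite -sn size_rcons.
    rewrite mid_rcons (@eq_mid _ _ _ _ _ (fun=> 0)).
      have -> : fst_face phi m (rcons (rcons s1 z) x) = 0.
        case: s1 sn => [|z' s1] /= sn; first by apply: (pv _ [::] [::]).
        by rewrite -cats1 (pv _ _ [::]) //= addn0.
      rewrite mid0 size_rcons !exprS mulrA mulrNN !mul1r !add0r.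
      exact: addNr.
    move=> u; rewrite size_rcons => -[su]; rewrite -cats1 (pv _ _ [::]) //.
    by rewrite addn0 su -sn size_rcons.
  + rewrite cat0s -rcons_cons lst_face_rcons rcons_cons [fst_face _ _ _]/=.
    rewrite [phi _ (x :: s2)](pv _ [::]) //; last by rewrite -sn size_rcons.
    rewrite scaler0 addr0; move: sn; have [w [u ->]] : exists w u, rcons s2 y = w :: u.
      by case: (s2) => [|a b]; do 2!eexists.
    by move=> sn; rewrite (mid_svan0 _ (pv m) sn Sx) pL ?subrr.
  + rewrite [fst_face _ _ _]/= (pv _ s1) //.
    rewrite -rcons_cons -rcons_cat lst_face_rcons (pv _ (z :: s1)) //; last first.
      by rewrite -sn size_rcons addnS.
    rewrite scaler0 addr0 sub0r rcons_cat rcons_cons.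
    move: sn; have [w [u ->]] : exists w u, rcons s2 y = w :: u.
      by case: (s2) => [|a b]; do 2!eexists.
    move=> sn; rewrite (mid_svan _ _ (pv m) (ps m) _ Sx) ?oppr0 //.
    by rewrite -sn addSn addnS.
- move=> m s1 s2 x s y [sn] Ss; rewrite /bd !size_cat /=.
  congr (_ - _ + _ *: _).
  + case: s1 sn => [|z s1] sn /=; first by rewrite bm_rA pL.
    by rewrite ps.
  + by apply: (mid_sbal (ps m)); rewrite ?sn.
  + case/lastP: s2 sn => [|s2 z] sn.
      by rewrite -!cat_rcons !cats0 !lst_face_rcons bm_lA pR // -sn addn0.
    rewrite -!rcons_cons -!rcons_cat !lst_face_rcons ps // -sn size_rcons.
    by rewrite addnS.
- by [].
- move=> m s x t [st] Ss; rewrite /bd; congr (_ - _ + _ *: _).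
  + by rewrite /= bm_rA.
  + by apply: mid_equivl => z u su; apply: pL => //; rewrite su.
  + case/lastP: t st => [|t z] st; first by rewrite /= -bm_lrA p0 // bm_lA.
    by rewrite -!rcons_cons !lst_face_rcons -bm_lrA pL // -st size_rcons.
- move=> m s x t [st] Ss; rewrite /bd !size_rcons; congr (_ - _ + _ *: _).
  + case: t st => [|z t] st; first by rewrite /= bm_rA p0 // bm_lrA.
    by rewrite /= pR // bm_lrA.
  + by apply: mid_equivr => z u su; apply: pR => //; rewrite su.
  + by rewrite !lst_face_rcons bm_lA.
Qed.

Lemma mid_fst phi m x s : s != [::] ->
  mid (x :: s) (fst_face phi m) = fst_face phi (bm_r m x) s - mid s (phi (bm_r m x)).
Proof. by case: s => [|y t] // _; rewrite mid_cons /= bm_rA. Qed.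

Lemma mid_lst phi m u z : u != [::] ->
  mid (rcons u z) (lst_face phi m) =
  mid u (phi (bm_l z m)) - (-1) ^+ size u *: lst_face phi (bm_l z m) u.
Proof.
case/lastP: u => [|u y] // _; rewrite mid_rcons !lst_face_rcons bm_lA size_rcons.
rewrite exprS mulN1r scaleNr opprK; congr (_ + _).
by apply: eq_mid => v _; rewrite lst_face_rcons.
Qed.

(** Inner faces cancel among themselves by [mid_mid], inner against outer ones by [mid_fst] and
    [mid_lst]; the two outer faces commute by [bm_lrA]. *)
Lemma bd_bd phi m s : bd (bd phi) m s = 0.
Proof.
case: s => [|x s]; first by rewrite /bd /= !(subr0, scaler0, addr0).
case/lastP: s => [|v z].
  by rewrite /bd /= !(subr0, scaler0, addr0).
set s := rcons v z.
have midE : mid (x :: s) (bd phi m) =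
    mid (x :: s) (fst_face phi m) - mid (x :: s) (fun u => mid u (phi m))
    + (-1) ^+ size s *: mid (x :: s) (lst_face phi m).
  rewrite -midZ -midN -!midD; apply: eq_mid => u [su].
  by rewrite /bd su.
rewrite {1}/bd midE mid_mid subr0 mid_fst; last by rewrite -size_eq0 size_rcons.
rewrite {2}/s -rcons_cons mid_lst // rcons_cons -/s.
have -> : fst_face (bd phi) m (x :: s) = bd phi (bm_r m x) s by [].
have -> : lst_face (bd phi) m (x :: s) = bd phi (bm_l z m) (x :: v).
  by rewrite -rcons_cons lst_face_rcons.
rewrite /bd [in lst_face _ _ s]/s lst_face_rcons [fst_face _ _ (x :: v)]/=.
rewrite -bm_lrA.
have -> : size (x :: s) = (size s).+1 by [].
have -> : size (x :: v) = size s by rewrite size_rcons.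
set e := (-1) ^+ size s; rewrite exprS mulN1r -/e.
set a := fst_face _ _ _; set b := mid s _; set c := phi _ v.
set d := mid _ _; set f := lst_face _ _ _.
rewrite opprD addrACA subrr add0r scaleNr -!scalerBr.
by rewrite opprB (addrC _ (- d)) addrA subrr scaler0.
Qed.

End Boundary.

Definition word (k : comNzRingType) (V : lmodType k) n (s : seq V) : 'I_n -> V :=
  fun i => nth 0 s i.
Arguments word {k V} n s.

Section Letters.
Variables (k : comNzRingType) (V : lmodType k) (n : nat).

Definition letters (x : 'I_n -> V) : seq V := [seq x i | i <- enum 'I_n].

Lemma size_letters x : size (letters x) = n.
Proof. by rewrite size_map size_enum_ord. Qed.

Lemma nth_letters x (i : 'I_n) : nth 0 (letters x) i = x i.
Proof. by rewrite (nth_map i) ?nth_ord_enum // size_enum_ord. Qed.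

Lemma lettersK x : word n (letters x) = x.
Proof. by apply: functional_extensionality_dep => i; exact: nth_letters. Qed.

Lemma wordK s : size s = n -> letters (word n s) = s.
Proof.
move=> sn; apply: (@eq_from_nth _ 0); rewrite size_letters // => i ilt.
exact: (nth_letters _ (Ordinal ilt)).
Qed.

Lemma letters_upd x i v :
  letters (upd x i v) = take i (letters x) ++ v :: drop i.+1 (letters x).
Proof.
apply: (@eq_from_nth _ 0); rewrite size_letters.
  rewrite size_cat size_take size_letters ltn_ord /= size_drop size_letters.
  by rewrite addnS -addSn subnKC.
move=> j jn; rewrite (nth_letters _ (Ordinal jn)) nth_cat size_take.
rewrite size_letters ltn_ord /upd; have [ji|ij|ji] := ltngtP j i.
- rewrite nth_take // (nth_letters _ (Ordinal jn)) ifN //.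
  by apply/eqP => /(congr1 val) /= e; rewrite e ltnn in ji.
- rewrite -(subnSK ij) /= nth_drop subnKC //.
  rewrite (nth_letters _ (Ordinal jn)) ifN //.
  by apply/eqP => /(congr1 val) /= e; rewrite e ltnn in ij.
- have -> : (j - i)%N = 0%N by rewrite ji subnn.
  rewrite ifT //; exact/eqP/val_inj.
Qed.

End Letters.

Definition wcls (k : comNzRingType) (V : lmodType k) (R : set V) n (s : seq V) :
  'I_n -> quotm R := fun i => cls R (word n s i).
Arguments wcls {k V} R n s.

Definition clT (k : comNzRingType) (V : lmodType k) (R : set V) : lmodType k := quotm R.
Definition twT (k : comNzRingType) (V M : lmodType k) (R : set V) n : lmodType k :=
  tens M (tpow (clT R) n).

Definition tw_gen (k : comNzRingType) (V M : lmodType k) n (R : set V)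
  (m : M) (s : seq V) : twT M R n := m \ox ppow (wcls R n s : 'I_n -> clT R).
Arguments tw_gen {k V M} n R m s.

Section WordExtension.
Variables (k : comNzRingType) (W : lmodType k).

Lemma tpow_ext (V : lmodType k) n (psi : seq V -> W) : slin n psi ->
  exists g : {linear tpow V n -> W},
    forall s, size s = n -> g (ppow (word n s)) = psi s.
Proof.
move=> pl.
pose phi (x : 'I_n -> V) := psi (letters x).
have [r|g gE] := @pgen_ext k _ (@tpow_rel k V n) W phi; last first.
  exists g => s sn; rewrite -[in RHS](wordK sn); exact: gE.
have [F FE] : exists F : {linear {freeg ('I_n -> V) / k} -> W}, F =1 fglift phi.
  by exists (mklin (fglift_linear phi)).
have FU x : F << x >> = psi (letters x) by rewrite FE liftU scale1r.
rewrite -FE => -[c x i v v'].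
rewrite !linearB linearZ_LR !FU !letters_upd.
have -> : psi (take i (letters x) ++ (c *: v + v') :: drop i.+1 (letters x)) =
  c *: psi (take i (letters x) ++ v :: drop i.+1 (letters x)) +
  psi (take i (letters x) ++ v' :: drop i.+1 (letters x)).
  apply: (pl (take i (letters x)) (drop i.+1 (letters x))).
  by rewrite size_take size_letters ltn_ord size_drop size_letters -addSn subnKC.
by rewrite addrAC addrK subrr.
Qed.

Lemma eq_tpow (V : lmodType k) n (f g : {linear tpow V n -> W}) :
  (forall s, size s = n -> f (ppow (word n s)) = g (ppow (word n s))) -> f =1 g.
Proof.
move=> fg; apply: pgen_ind => [|x].
  split=> [|x y hx hy|c x hx]; first by rewrite !linear0.
    by rewrite !linearD hx hy.
  by rewrite !linearZ_LR hx.
by rewrite -[x]lettersK; apply: fg; exact: size_letters.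
Qed.

Section Quotient.
Variables (V : lmodType k) (R : set V).

Lemma wclsE n s : size s = n -> wcls R n s = word n (map (cls R) s).
Proof.
move=> sn; apply: functional_extensionality_dep => i.
by rewrite /wcls /word (nth_map 0) // sn.
Qed.

(** A letter and the chosen representative of its class differ by an element of the span of R, which
    the functional does not see; letters are exchanged one at a time. *)
Lemma svan_cls n (psi : seq V -> W) s : slin n psi -> svan R n psi ->
  size s = n -> psi (map repr (map (cls R) s)) = psi s.
Proof.
elim: s n psi => [|x s IHs] [|n] psi // pl pv [sn] /=.
rewrite -(IHs n (fun u => psi (x :: u))) //; last 2 first.
- exact: slin_cons.
- exact: svan_cons.
set t := map _ _; have tn : (size ([::] : seq V) + size t).+1 = n.+1.
  by rewrite /= add0n !size_map sn.
have pl0 := pl [::] t tn; apply/eqP; rewrite -subr_eq0 -(linfB pl0); apply/eqP.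
apply: (@spanp_lin0 _ _ _ R (mklin pl0)); first by move=> r; exact: pv.
by apply/clsE; rewrite clsK.
Qed.

Lemma slin_repr n (psi : seq V -> W) : slin n psi -> svan R n psi ->
  slin n (fun s : seq (quotm R) => psi (map repr s)).
Proof.
move=> pl pv s1 s2 sn c x y; rewrite !map_cat /=.
set t1 := map _ s1; set t2 := map _ s2.
have tn : (size t1 + size t2).+1 = n by rewrite !size_map.
have pl0 := pl t1 t2 tn; rewrite -pl0.
apply/eqP; rewrite -subr_eq0 -(linfB pl0); apply/eqP.
apply: (@spanp_lin0 _ _ _ R (mklin pl0)); first by move=> r; exact: pv.
by apply/clsE; rewrite cls_linear !clsK.
Qed.

(** Letters of V/R are lifted by [repr]. The lift is not linear, but vanishing on R hides the
    defect, so the lifted functional is multilinear and extends to the tensor power. *)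
Lemma tw_ext (M : lmodType k) n (phi : M -> seq V -> W) :
  (forall s, size s = n -> linear (phi^~ s)) -> (forall m, slin n (phi m)) ->
  (forall m, svan R n (phi m)) ->
  exists g : {linear twT M R n -> W},
    forall m s, size s = n -> g (tw_gen n R m s) = phi m s.
Proof.
move=> pm pl pv.
have hE m := tpow_ext (slin_repr (pl m) (@pv m)).
pose h m := projT1 (cid (hE m)).
have hP m s : size s = n -> h m (ppow (word n s)) = phi m (map repr s).
  exact: (projT2 (cid (hE m))).
have [x|m|g gE] := @tens_ext2 _ _ _ _ (fun m x => h m x).
- move=> c m m'; have hl : linear (fun x => c *: h m x + h m' x) by lin.
  apply: (@eq_tpow _ _ (h (c *: m + m')) (mklin hl)) => s sn /=.
  by rewrite !hP // pm // size_map.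
- by lin.
- exists g => m s sn; rewrite [LHS]gE wclsE // [LHS]hP ?size_map //.
  by rewrite (svan_cls (n := n)).
Qed.

Lemma eq_tw (M : lmodType k) n (f g : {linear twT M R n -> W}) :
  (forall m s, size s = n ->
    f (tw_gen n R m s) = g (tw_gen n R m s)) -> f =1 g.
Proof.
move=> fg; apply: eq_tens => m x.
have fl : linear (fun x => f (m \ox x)) by lin.
have gl : linear (fun x => g (m \ox x)) by lin.
apply: (@eq_tpow _ _ (mklin fl) (mklin gl)) => s sn /=.
have := fg m (map repr s); rewrite /tw_gen wclsE ?size_map // -map_comp.
by rewrite map_id_in => [|y _]; [exact | rewrite /= clsK].
Qed.

End Quotient.

Lemma te_ext (V M : lmodType k) n (phi : M -> seq V -> W) :
  (forall s, size s = n -> linear (phi^~ s)) -> (forall m, slin n (phi m)) ->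
  exists g : {linear tens M (tpow V n) -> W},
    forall m s, size s = n -> g (m \ox ppow (word n s)) = phi m s.
Proof.
move=> pm pl; have hE m := tpow_ext (pl m).
pose h m := projT1 (cid (hE m)).
have hP m s : size s = n -> h m (ppow (word n s)) = phi m s.
  exact: (projT2 (cid (hE m))).
have [x|m|g gE] := @tens_ext2 _ _ _ _ (fun m x => h m x).
- move=> c m m'; have hl : linear (fun x => c *: h m x + h m' x) by lin.
  apply: (@eq_tpow _ _ (h (c *: m + m')) (mklin hl)) => s sn /=.
  by rewrite !hP // pm.
- by lin.
- by exists g => m s sn; rewrite gE hP.
Qed.

Lemma eq_te (V M : lmodType k) n (f g : {linear tens M (tpow V n) -> W}) :
  (forall m s, size s = n ->
    f (m \ox ppow (word n s)) = g (m \ox ppow (word n s))) -> f =1 g.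
Proof.
move=> fg; apply: eq_tens => m x.
have fl : linear (fun x => f (m \ox x)) by lin.
have gl : linear (fun x => g (m \ox x)) by lin.
by apply: (@eq_tpow _ _ (mklin fl) (mklin gl)) => s sn; exact: fg.
Qed.

End WordExtension.

Section Multilinear.
Variables (k : comNzRingType).

Section Power.
Variables (V : lmodType k) (n : nat).

Lemma word_upd s1 s2 (v : V) (i : 'I_n) : (size s1 + size s2).+1 = n ->
  i = size s1 :> nat ->
  word n (s1 ++ v :: s2) = upd (word n (s1 ++ 0 :: s2)) i v.
Proof.
move=> sn iE; apply: functional_extensionality_dep => j; rewrite /upd /word.
rewrite !nth_cat; case: eqP => [->|ji]; first by rewrite iE ltnn subnn.
case: ltngtP => // [ij|ji']; last by case: ji; apply: val_inj; rewrite /= iE.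
by case: (j - size s1)%N (subn_gt0 (size s1) j) => //; rewrite ij.
Qed.

Lemma ppow_slin : slin n (fun s : seq V => ppow (word n s)).
Proof.
move=> s1 s2 sn c v v'.
have lt_i : (size s1 < n)%N by rewrite -sn ltnS leq_addr.
pose X := word n (s1 ++ 0 :: s2).
have uE z : word n (s1 ++ z :: s2) = upd X (Ordinal lt_i) z by exact: word_upd.
rewrite (uE (c *: v + v')) (uE v) (uE v') /ppow /pgen.
have cl := @cls_linear _ _ (@tpow_rel k V n) c << upd X (Ordinal lt_i) v >>.
rewrite -(cl << upd X (Ordinal lt_i) v' >>).
by apply/clsE; rewrite opprD addrA; apply/spanp_sub/TpowRel.
Qed.

End Power.

Variables (V : lmodType k) (n : nat) (M : lmodType k) (R : set V).

Lemma tw_gen_linl s : linear (fun m : M => tw_gen n R m s).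
Proof. exact/lin_tensl/lin_id. Qed.

Lemma tw_gen_slin (m : M) : slin n (tw_gen n R m).
Proof.
move=> s1 s2 sn; apply: lin_tensr => c x y.
have sz z : size (s1 ++ z :: s2) = n by rewrite size_cat /= addnS.
rewrite ?/tw_gen !wclsE // !map_cat /= cls_linear.
have h := @ppow_slin (quotm R) n (map (cls R) s1) (map (cls R) s2).
by apply: h; rewrite !size_map.
Qed.

Lemma tw_gen_svan (m : M) : svan R n (tw_gen n R m).
Proof.
move=> s1 s2 x sn Rx; rewrite /tw_gen wclsE; last by rewrite size_cat /= addnS.
have -> : map (cls R) (s1 ++ x :: s2) = map (cls R) s1 ++ 0 :: map (cls R) s2.
  rewrite map_cat /=; congr (_ ++ _ :: _).
  by apply/cls_eq0/spanp_sub.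
apply: etrans (linf0 (ptens_linr m)); congr (m \ox _).
have h := @ppow_slin (quotm R) n (map (cls R) s1) (map (cls R) s2).
by apply: (linf0 (h _)); rewrite !size_map.
Qed.

End Multilinear.

Section Merge.
Variables (k : comNzRingType) (T : algType k) (W : lmodType k).

Lemma front_word n (s : seq T) z : size s = n ->
  front (word n.+1 (rcons s z)) = word n s.
Proof.
move=> sn; apply: functional_extensionality_dep => i.
by rewrite /front /word lift_max nth_rcons sn ltn_ord.
Qed.

Lemma merge_word0 n x y (t : seq T) :
  Defs.merge ord0 (word n.+2 (x :: y :: t)) = word n.+1 (x * y :: t).
Proof.
apply: functional_extensionality_dep => j; rewrite /Defs.merge /front /tail /word.
by case: (unliftP ord0 j) => [j' ->|->].
Qed.

Lemma merge_wordS n x (s : seq T) (i : 'I_n) :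
  Defs.merge (lift ord0 i) (word n.+2 (x :: s)) =
  fun j => if unlift ord0 j is Some j' then Defs.merge i (word n.+1 s) j' else x.
Proof.
apply: functional_extensionality_dep => j; rewrite /Defs.merge /front /tail /word.
case: (unliftP ord0 j) => [j' ->|->] //.
rewrite !lift_max !lift0 ltnS /=.
by case: ifP => // _; rewrite (inj_eq (@lift_inj _ ord0)).
Qed.

Lemma mid_merge n (F : ('I_n -> T) -> W) (s : seq T) : size s = n.+1 ->
  \sum_(i < n) (-1) ^+ i.+1 *: F (Defs.merge i (word n.+1 s)) =
  - mid s (fun u => F (word n u)).
Proof.
elim: n F s => [|n IHn] F; first by case=> [|x [|y t]] // _; rewrite big_ord0 oppr0.
case=> [|x [|y t]] // sn.
rewrite big_ord_recl merge_word0 mid_cons expr1 scaleN1r opprB addrC.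
congr (_ - _).
pose F' (v : 'I_n -> T) := F (fun j => if unlift ord0 j is Some j' then v j' else x).
have -> : mid (y :: t) (fun u => F (word n.+1 (x :: u))) =
    mid (y :: t) (fun u => F' (word n u)).
  apply: eq_mid => u su; congr F; apply: functional_extensionality_dep => j.
  by rewrite /word; case: (unliftP ord0 j) => [j' ->|->].
have sn' : size (y :: t) = n.+1 by case: sn => <-.
rewrite -[RHS]opprK -(IHn F' _ sn') (big_morph _ (@opprD _) (oppr0 _)).
apply: eq_bigr => i _.
by rewrite merge_wordS lift0 exprS mulN1r scaleNr.
Qed.

(** The bridge from the boundary of the definitions, written with [merge], [tail] and [front] on
    indexed families, to the recursive form on lists. *)
Lemma bd_word (M : bimodule T) n (F : M -> ('I_n -> T) -> W) m (x : 'I_n.+1 -> T) :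
  F (bm_r m (x ord0)) (tail x) + \sum_(i < n) (-1) ^+ i.+1 *: F m (Defs.merge i x)
  + (-1) ^+ n.+1 *: F (bm_l (x ord_max) m) (front x) =
  bd (fun m s => F m (word n s)) m (letters x).
Proof.
have sx := size_letters x; rewrite -{1 2 3 4 5}[x]lettersK.
move: (letters x) sx => {x} s sx.
rewrite mid_merge // /bd sx; congr (_ + _ *: _); first congr (_ + _).
  by case: s sx.
case/lastP: s sx => [|u z] //; rewrite size_rcons => -[su].
by rewrite lst_face_rcons front_word // /word nth_rcons /= su ltnn eqxx.
Qed.

End Merge.

(** * Complexes with a universal property on words, and their contraction *)

Section Family.
Variables (k : comNzRingType) (T : algType k) (S : set T).

(* W n is the target of the universal good functional on words with n letters. *)
Record is_fam (M : bimodule T) (W : nat -> lmodType k)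
    (g : forall n, M -> seq T -> W n) : Prop := {
  fam_good : forall n, good S n (g n);
  fam_ext : forall n (W' : lmodType k) (phi : M -> seq T -> W'), good S n phi ->
    exists h : {linear W n -> W'}, forall m s, size s = n -> h (g n m s) = phi m s;
  fam_eq : forall n (W' : lmodType k) (h h' : {linear W n -> W'}),
    (forall m s, size s = n -> h (g n m s) = h' (g n m s)) -> h =1 h'
}.

Lemma bd_map (M N : bimodule T) (W W' : lmodType k) (phi : M -> seq T -> W)
    (phi' : N -> seq T -> W') n (q : M -> N) (h : {linear W -> W'}) m s :
  is_bmor q -> (forall m s, size s = n -> h (phi m s) = phi' (q m) s) ->
  size s = n.+1 -> h (bd phi m s) = bd phi' (q m) s.
Proof.
move=> [ql qr] hE sn; rewrite /bd linearD linearB linearZ_LR.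
congr (_ - _ + _ *: _).
- by case: s sn => [|x t] [tn]; rewrite ?linear0 //= hE // qr.
- rewrite (mid_map s (phi m) (linearP h)); apply: eq_mid => u.
  by rewrite sn => -[un]; exact: hE.
- case/lastP: s sn => [|t z]; rewrite ?linear0 // size_rcons => -[tn].
  by rewrite !lst_face_rcons hE // ql.
Qed.

Section Maps.
Variables (M N : bimodule T) (W W' : nat -> lmodType k).
Variables (g : forall n, M -> seq T -> W n) (g' : forall n, N -> seq T -> W' n).
Hypotheses (famM : is_fam g) (famN : is_fam g').

(** Linearity over S on both sides is what the balancing relations ask of phi. Hence the averaged
    splittings, which need not be linear over T, induce maps as well. *)
Lemma fam_map_ex n (phi : {linear M -> N}) :
  (forall s m, S s -> phi (bm_l s m) = bm_l s (phi m)) ->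
  (forall s m, S s -> phi (bm_r m s) = bm_r (phi m) s) ->
  exists h : {linear W n -> W' n},
    forall m s, size s = n -> h (g n m s) = g' n (phi m) s.
Proof.
move=> phil phir; apply: (fam_ext famM).
have [gm gl gv [gs g0 gL gR]] := fam_good famN n; split; last split.
- move=> s sn; apply: (@lin_comp _ _ _ _ (fun m => g' n m s)); last by lin.
  exact: gm.
- by move=> m; exact: gl.
- by move=> m; exact: gv.
- by move=> m; exact: gs.
- by move=> n0 m s Ss; rewrite phil ?phir // g0.
- by move=> m s x t tn Ss; rewrite phir // gL.
- by move=> m s x t tn Ss; rewrite phil // gR.
Qed.

End Maps.

Variables (M : bimodule T) (W : nat -> lmodType k).
Variable g : forall n, M -> seq T -> W n.
Hypothesis fam : is_fam g.

Lemma fam_diff_ex n : exists d : {linear W n.+1 -> W n},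
  forall m s, size s = n.+1 -> d (g n.+1 m s) = bd (g n) m s.
Proof. exact/(fam_ext fam)/bd_good/(fam_good fam). Qed.

Variable d : forall n, {linear W n.+1 -> W n}.
Hypothesis dE : forall n m s, size s = n.+1 -> d n (g n.+1 m s) = bd (g n) m s.

Lemma fam_dd n x : d n (d n.+1 x) = 0.
Proof.
have hl : linear (fun x => d n (d n.+1 x)) by lin.
apply: (fam_eq fam (h := mklin hl) (h' := \0)) => m s sn.
rewrite -[LHS]/(d n (d n.+1 _)) dE // -[RHS](bd_bd (g n) m s).
by apply: (@bd_map M M _ _ (g n.+1) (bd (g n)) n.+1 id (d n)) => // *; exact: dE.
Qed.

Section Contraction.
Variables (Y : lmodType k) (D : {linear M -> tens T Y}) (J : {linear Y -> M}).
Variable rho : T -> {linear Y -> Y}.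
Hypothesis D_l : forall t m, D (bm_l t m) = tmap2 (mull t) (idfun : {linear Y -> Y}) (D m).
Hypothesis D_r : forall t m, D (bm_r m t) = tmap2 (idfun : {linear T -> T}) (rho t) (D m).
Hypothesis J_r : forall t y, J (rho t y) = bm_r (J y) t.

(** The building block of the contraction: a (x) y becomes J y followed by the letters s and then a.
    The predecessor and the zero map on other lengths make it total in n and s. *)
Lemma ctr_ex n s : exists L : {linear tens T Y -> W n},
  forall a y, size s = n.-1 -> (0 < n)%N -> L (a \ox y) = g n (J y) (rcons s a).
Proof.
have [gm gl _ _] := fam_good fam n.
case: n gm gl => [|n] gm gl; first by exists \0.
case: (eqVneq (size s) n) => [sn|sn]; last first.
  by exists \0 => a y sn'; rewrite sn' eqxx in sn.
have [||L LE] := @tens_ext2 _ _ _ _ (fun a y => g n.+1 (J y) (rcons s a)).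
- move=> y c a a'; rewrite -!cats1; apply: (gl _ s [::]).
  by rewrite addn0 sn.
- move=> a; apply: (@lin_comp _ _ _ _ (fun m => g n.+1 m (rcons s a))); last by lin.
  by apply: gm; rewrite size_rcons sn.
- by exists L => a y _ _; exact: LE.
Qed.

Definition ctr n s : {linear tens T Y -> W n.+1} := projT1 (cid (ctr_ex n.+1 s)).

Lemma ctrE n s a y : size s = n -> ctr n s (a \ox y) = g n.+1 (J y) (rcons s a).
Proof. by move=> sn; exact: (projT2 (cid (ctr_ex n.+1 s))). Qed.

(** By [D_l] and [D_r] a factor of m from S becomes a left factor of a or a right factor of y. These
    sit at the last letter and next to J y in the lengthened word, where g is balanced. For n = 0
    both meet at a. *)
Lemma ctr_good n : good S n (fun m s => ctr n s (D m)).
Proof.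
have [gm gl gv [gs g0 gL gR]] := fam_good fam n.+1.
have ext (F G : {linear tens T Y -> W n.+1}) m :
    (forall a y, F (a \ox y) = G (a \ox y)) -> F (D m) = G (D m).
  by move=> FG; exact: eq_tens.
split; last split.
- by move=> s sn; lin.
- move=> m s1 s2 sn c x y.
  have hl : linear (fun t => c *: ctr n (s1 ++ x :: s2) t + ctr n (s1 ++ y :: s2) t).
    by lin.
  have sz z : size (s1 ++ z :: s2) = n by rewrite size_cat /= addnS.
  apply: (ext (ctr n _) (mklin hl)) => a v; rewrite /= !ctrE // !rcons_cat /=.
  by apply: (gl (J v) s1 (rcons s2 a)); rewrite size_rcons addnS sn.
- move=> m s1 s2 x sn Sx; apply: (ext _ \0) => a v.
  rewrite ctrE; last by rewrite size_cat /= addnS.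
  by rewrite rcons_cat /= gv // size_rcons addnS sn.
- move=> m s1 s2 x s y sn Ss; apply: ext => a v.
  rewrite !ctrE; try by rewrite size_cat /= !addnS.
  by rewrite !rcons_cat /= gs // size_rcons addnS sn.
- move=> n0 m s Ss; rewrite D_r D_l.
  have al : linear (fun t => ctr n [::] (tmap2 idfun (rho s) t)) by lin.
  have bl : linear (fun t => ctr n [::] (tmap2 (mull s) idfun t)) by lin.
  apply: (ext (mklin al) (mklin bl)) => a v /=.
  by rewrite !tmap2E !ctrE //= J_r gL // n0.
- move=> m s x t tn Ss; rewrite D_r.
  have al : linear (fun u => ctr n (x :: t) (tmap2 idfun (rho s) u)) by lin.
  apply: (ext (mklin al) (ctr n (s * x :: t))) => a v /=.
  by rewrite !tmap2E !ctrE //= J_r gL // size_rcons tn.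
- move=> m s x t tn Ss; rewrite D_l.
  have al : linear (fun u => ctr n (rcons t x) (tmap2 (mull s) idfun u)) by lin.
  apply: (ext (ctr n (rcons t (x * s))) (mklin al)) => a v /=.
  rewrite !tmap2E !ctrE ?size_rcons // -!cats1 -!catA.
  by apply: gs => //; rewrite addn0 tn.
Qed.

Lemma fam_ctr_ex n : exists kap : {linear W n -> W n.+1},
  forall m s, size s = n -> kap (g n m s) = ctr n s (D m).
Proof. exact/(fam_ext fam)/ctr_good. Qed.

Definition fam_ctr n := projT1 (cid (fam_ctr_ex n)).

Lemma fam_ctrE n m s : size s = n -> fam_ctr n (g n m s) = ctr n s (D m).
Proof. exact: (projT2 (cid (fam_ctr_ex n))). Qed.

Lemma mul_ex : exists mu : {linear tens T Y -> M}, forall a y, mu (a \ox y) = bm_l a (J y).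
Proof. by apply: (tens_ext2 (b := fun a y => bm_l a (J y))) => ?; lin. Qed.
Definition fam_mul := projT1 (cid mul_ex).
Lemma fam_mulE a y : fam_mul (a \ox y) = bm_l a (J y).
Proof. exact: (projT2 (cid mul_ex)). Qed.

Lemma right_mul_ex : exists mu : {linear tens T Y -> M}, forall a y, mu (a \ox y) = bm_r (J y) a.
Proof. by apply: (tens_ext2 (b := fun a y => bm_r (J y) a)) => ?; lin. Qed.
Definition fam_rmul := projT1 (cid right_mul_ex).
Lemma fam_rmulE a y : fam_rmul (a \ox y) = bm_r (J y) a.
Proof. exact: (projT2 (cid right_mul_ex)). Qed.

(** The word J y, a has only two faces, J y a and a J y. The former has no counterpart that could
    cancel it, so degree 0 is contracted only up to moving a to the right. *)
Lemma fam_contraction0 m :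
  d 0 (fam_ctr 0 (g 0 m [::])) = g 0 (fam_rmul (D m)) [::] - g 0 (fam_mul (D m)) [::].
Proof.
rewrite fam_ctrE //; have [gm _ _ _] := fam_good fam 0.
have gl := gm [::] (erefl _).
have hl : linear (fun t => d 0 (ctr 0 [::] t)) by lin.
have al : linear (fun t => g 0 (fam_rmul t) [::]).
  by apply: (@lin_comp _ _ _ _ (fun m => g 0 m [::])); last lin.
have bl : linear (fun t => g 0 (fam_mul t) [::]).
  by apply: (@lin_comp _ _ _ _ (fun m => g 0 m [::])); last lin.
apply: (@eq_tens _ _ _ _ (mklin hl) (mklin (lin_add al (lin_opp bl)))) => a y.
by rewrite /= ctrE // dE // fam_mulE fam_rmulE /bd /= subr0 expr1 scaleN1r.
Qed.

(** Every face of the lengthened word but the last is the contraction of a face of m, s; the face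
    merging the last letter z of s with a corresponds to z m, by [D_l]. The last face restores a J y
    in front of s, which is the extra term. *)
Lemma fam_contraction n m s : size s = n.+1 ->
  d n.+1 (fam_ctr n.+1 (g n.+1 m s)) =
  fam_ctr n (d n (g n.+1 m s)) + (-1) ^+ n *: g n.+1 (fam_mul (D m)) s.
Proof.
move=> sn; rewrite dE // fam_ctrE //.
have [gm _ _ _] := fam_good fam n.+1; have gl := gm s sn.
have -> : fam_ctr n (bd (g n) m s) = bd (fun m s => ctr n s (D m)) m s.
  apply: (@bd_map M M _ _ (g n) _ n id (fam_ctr n)) => // *; exact: fam_ctrE.
case/lastP: s sn gl => [|u z] // sn gl.
have un : size u = n by case: sn; rewrite size_rcons => -[].
rewrite /bd lst_face_rcons sn D_l.
have [x [t xE]] : exists x t, rcons u z = x :: t by case: (u) => [|a b]; do 2!eexists.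
have tn : size t = n by move: sn; rewrite xE => -[].
have -> : fst_face (fun m s => ctr n s (D m)) m (rcons u z) =
    ctr n t (tmap2 idfun (rho x) (D m)) by rewrite xE /= D_r.
have hl : linear (fun v => d n.+1 (ctr n.+1 (rcons u z) v)) by lin.
have fl : linear (fun v => ctr n t (tmap2 idfun (rho x) v)) by lin.
have ml : linear (fun v => mid (rcons u z) (fun s => ctr n s v)).
  by apply: (@mid_lin _ _ _ _ (rcons u z) (fun v s => ctr n s v)) => w _; lin.
have ll : linear (fun v => ctr n u (tmap2 (mull z) idfun v)) by lin.
have nl : linear (fun v => g n.+1 (fam_mul v) (rcons u z)).
  by apply: (@lin_comp _ _ _ _ (fun m => g n.+1 m (rcons u z))); last lin.
have rl := lin_add (lin_add (lin_add fl (lin_opp ml)) (lin_scale ((-1) ^+ n.+1) ll))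
  (lin_scale ((-1) ^+ n) nl).
apply: (@eq_tens _ _ _ _ (mklin hl) (mklin rl)) => a y /=.
rewrite !tmap2E !ctrE // dE; last by rewrite !size_rcons un.
rewrite /bd lst_face_rcons mid_rcons fam_mulE !size_rcons un J_r !exprS.
rewrite (@eq_mid _ _ _ (rcons u z) _ (fun s => ctr n s (a \ox y))); last first.
  by move=> w; rewrite size_rcons un => -[wn]; rewrite ctrE.
have -> : fst_face (g n.+1) (J y) (rcons (rcons u z) a) =
    g n.+1 (bm_r (J y) x) (rcons t a) by rewrite xE.
by rewrite !mulN1r opprK scaleNr opprD addrA.
Qed.

End Contraction.

End Family.

(** * Hochschild homology *)

Section HochschildTheory.
Variables (k : comNzRingType) (E : algType k).

Section Coefficients.
Variable M : bimodule E.

Definition hgen n (m : M) (s : seq E) : cobj (hochschild M) n :=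
  hoch_gen (m, word n s).

(** For S empty the vanishing and balancing conditions are void, so the Hochschild complex is a case
    of the general theory. *)
Lemma hgen_good n : good set0 n (hgen n).
Proof.
split; last by split=> [m s1 s2 x s y _ []|_ m s []|m s x t _ []|m s x t _ []].
- by move=> s sn; exact: (@ptens_linl k M (tpow E n) (ppow (word n s))).
- move=> m s1 s2 sn; apply: (@lin_tensr k E M (tpow E n) (fun x => ppow (word n (s1 ++ x :: s2))) m).
  exact: ppow_slin.
- by move=> m s1 s2 x _ [].
Qed.

Lemma hoch_fam : is_fam set0 hgen.
Proof.
split; first exact: hgen_good.
- by move=> n W phi [pm pl _ _]; exact: te_ext.
- by move=> n W h h' hh'; apply: eq_te => m s sn; exact: hh'.
Qed.

(** [linext] takes the intended values once some linear extension exists; [fam_diff_ex] provides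
    it. *)
Lemma hoch_diffE n m s : size s = n.+1 ->
  hoch_diff M n (hgen n.+1 m s) = bd (hgen n) m s.
Proof.
move=> sn; pose F (m : M) (x : 'I_n -> E) := hoch_gen (m, x).
rewrite -(wordK sn) -(bd_word F) wordK //.
apply: (linextE (gen := @hoch_gen k E M n.+1) _ (m, word n.+1 s)).
have [g gE] := fam_diff_ex hoch_fam n.
exists g => -[m' x]; rewrite -[in LHS](lettersK x).
by rewrite (bd_word F); apply: gE; exact: size_letters.
Qed.

Lemma hoch_cdiffE n m s : size s = n.+1 ->
  cdiff (hochschild M) n (hgen n.+1 m s) = bd (hgen n) m s.
Proof. exact: hoch_diffE. Qed.

Lemma hoch_dd n x : cdiff (hochschild M) n (cdiff (hochschild M) n.+1 x) = 0.
Proof. exact: (fam_dd hoch_fam hoch_diffE). Qed.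

Lemma hoch_aug_ex : exists aug : {linear cobj (hochschild M) 0 -> M},
  forall m, aug (hgen 0 m [::]) = m.
Proof.
have [|m s1 s2 sn|g gE] // := @te_ext k M E M 0 (fun m s => m).
by exists g => m; exact: (gE m [::]).
Qed.
Definition hoch_aug := projT1 (cid hoch_aug_ex).
Lemma hoch_augE m : hoch_aug (hgen 0 m [::]) = m.
Proof. exact: (projT2 (cid hoch_aug_ex)). Qed.

Lemma hoch_augK x : hgen 0 (hoch_aug x) [::] = x.
Proof.
have hl : linear (fun x => hgen 0 (hoch_aug x) [::]).
  apply: (@lin_comp _ _ _ _ (fun m => hgen 0 m [::])); last by lin.
  by have [gm _ _ _] := hgen_good 0; exact: gm.
apply: (fam_eq hoch_fam (h := mklin hl) (h' := idfun)) => m [|//] _.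
by rewrite /= hoch_augE.
Qed.

Definition hoch_theta : {linear cobj (hochschild M) 0 -> quotm (@comm k E M)} :=
  mklin (lin_cls (@comm k E M) (linearP hoch_aug)).

Lemma hoch_theta_surj y : exists x, hoch_theta x = y.
Proof.
elim/quotm_ind: y => m; exists (hgen 0 m [::]).
by rewrite /= hoch_augE.
Qed.

Lemma is_bdry_submod (C : cplx k) n (U : lmodType k) (f : U -> cobj C n) :
  linear f -> is_submod (fun u => is_bdry (f u)).
Proof.
move=> fl; split=> [|u v [x hx] [y hy]|c u [x hx]].
- by exists 0; rewrite linear0 (linf0 fl).
- by exists (x + y); rewrite linearD (linfD fl) hx hy.
- by exists (c *: x); rewrite linearZ_LR (linfZ fl) hx.
Qed.

Lemma hoch_theta0 x : hoch_theta x = 0 <-> is_bdry x.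
Proof.
split=> [|[y ->]]; last first.
  have hl : linear (fun y => hoch_theta (cdiff (hochschild M) 0 y)) by lin.
  apply: (fam_eq hoch_fam (h := mklin hl) (h' := \0)) => m [|e [|//]] // _.
  rewrite -[LHS]/(hoch_theta (cdiff (hochschild M) 0 (hgen 1 m [:: e]))).
  rewrite hoch_cdiffE // /bd [fst_face _ _ _]/= [lst_face _ _ _]/= subr0 expr1.
  rewrite scaleN1r linearB -linearB /= linearB !hoch_augE; apply/cls_eq0.
  rewrite -opprB rpredN; apply/spanp_sub.
  by exists e, m.
move=> /cls_eq0; rewrite -[in is_bdry _](hoch_augK x).
have gl : linear (fun m => hgen 0 m [::]).
  by have [gm _ _ _] := hgen_good 0; exact: gm.
move=> /spanpP /(_ (fun m => is_bdry (hgen 0 m [::]))).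
apply; first exact: (is_bdry_submod gl).
(* The boundary of m, e is m e - e m, the negative of the commutator in the order of [comm], hence
   the sign. *)
move=> _ [e [m ->]]; exists (hgen 1 (- m) [:: e]).
rewrite hoch_cdiffE // /bd /= subr0 expr1.
rewrite scaleN1r (linfN (@bm_l_linr _ _ M e)) (linfN (@bm_r_linl _ _ M e)).
by rewrite (linfB gl) !(linfN gl) opprK addrC.
Qed.

End Coefficients.

Section FreeCoefficients.
Variable V : lmodType k.
Local Notation P := (free_bim E V).

Definition free_J : {linear tens V E -> P} :=
  mklin (lin_tensr (1 : E) (@lin_id k (tens V E))).

Lemma hoch_acyclic n x : cdiff (hochschild P) n x = 0 -> is_bdry x.
Proof.
move=> dx.
pose rho (e : E) : {linear tens V E -> tens V E} := tmap2 (idfun : {linear V -> V}) (mulr_by e).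
(* The free bimodule is E (x) (V (x) E) by definition, so the identity decomposes it and multiplying
   back returns m. *)
pose D : {linear P -> tens E (tens V E)} := idfun.
have D_l t m : D (bm_l t m) = tmap2 (mull t) (idfun : {linear tens V E -> tens V E}) (D m) by [].
have D_r t m : D (bm_r m t) = tmap2 (idfun : {linear E -> E}) (rho t) (D m) by [].
have J_r t y : free_J (rho t y) = bm_r (free_J y) t.
  by rewrite /= /free_r tmap2E.
have muE m : fam_mul free_J (D m) = m.
  apply: (@eq_tens _ _ _ _ (fam_mul free_J) idfun) => a y.
  by rewrite fam_mulE /= free_lE mulr1.
have [kap kapE] : exists kap : forall n, {linear hoch_obj P n -> hoch_obj P n.+1},
    forall n y, cdiff (hochschild P) n.+1 (kap n.+1 y) =
    kap n (cdiff (hochschild P) n y) + (-1) ^+ n *: y.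
  exists (fam_ctr (hoch_fam P) D_l D_r J_r) => j y; move: y.
  have hl := lin_app (hoch_diff P j.+1) (linearP (fam_ctr (hoch_fam P) D_l D_r J_r j.+1)).
  have rl := lin_add (lin_app (fam_ctr (hoch_fam P) D_l D_r J_r j) (linearP (hoch_diff P j)))
    (lin_scale ((-1) ^+ j) (@lin_id k (hoch_obj P j.+1))).
  apply: (fam_eq (hoch_fam P) (h := mklin hl) (h' := mklin rl)) => m s sn /=.
  by rewrite (fam_contraction (hoch_fam P) (@hoch_diffE P) D_l D_r J_r) // muE.
(* On a cycle the contraction formula reads d (kap x) = (-1)^n x. *)
exists ((-1) ^+ n *: kap n.+1 x).
by rewrite linearZ_LR kapE dx linear0 add0r scalerA -expr2 sqrr_sign scale1r.
Qed.

End FreeCoefficients.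

Lemma hoch_map_ex (M N : bimodule E) (q : {linear M -> N}) n :
  exists h : {linear cobj (hochschild M) n -> cobj (hochschild N) n},
    forall m s, size s = n -> h (hgen n m s) = hgen n (q m) s.
Proof. exact: (fam_map_ex (hoch_fam M) (hoch_fam N)). Qed.

Definition hoch_map (M N : bimodule E) (q : {linear M -> N}) :
  degmap (hochschild M) (hochschild N) := fun n => projT1 (cid (hoch_map_ex q n)).
Lemma hoch_mapE (M N : bimodule E) (q : {linear M -> N}) n m s : size s = n ->
  hoch_map q n (hgen n m s) = hgen n (q m) s.
Proof. exact: (projT2 (cid (hoch_map_ex q n))). Qed.

Lemma hoch_map_chain (M N : bimodule E) (q : {linear M -> N}) :
  is_bmor q -> chain_map (hoch_map q).
Proof.
move=> q_mor n.
have hl := lin_app (hoch_map q n) (linearP (cdiff (hochschild M) n)).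
have rl := lin_app (cdiff (hochschild N) n) (linearP (hoch_map q n.+1)).
apply: (fam_eq (hoch_fam M) (h := mklin hl) (h' := mklin rl)) => m s sn.
apply: etrans (_ : hoch_map q n (hoch_diff M n (hgen n.+1 m s)) = _) _ => //.
apply: etrans (_ : _ = hoch_diff N n (hoch_map q n.+1 (hgen n.+1 m s))) _ => //.
rewrite hoch_mapE // !hoch_diffE //.
by apply: (@bd_map _ _ _ _ _ _ _ (hgen n) n) => // *; exact: hoch_mapE.
Qed.

Lemma comm_map (M N : bimodule E) (q : {linear M -> N}) x y : is_bmor q ->
  cls (@comm k E M) x = cls (@comm k E M) y ->
  cls (@comm k E N) (q x) = cls (@comm k E N) (q y).
Proof.
move=> [ql qr] /clsE/spanpP /(_ (fun m => q m \in spanp (@comm k E N))) h.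
apply/clsE; rewrite -linearB; apply: h.
  have [h0 hL] := spanp_submod (@comm k E N).
  split=> [|u v hu hv|c u hu]; rewrite ?linear0 ?linearD ?linearZ_LR //.
    by rewrite -[q u]scale1r; exact: hL.
  by rewrite -[_ *: _]addr0; exact: hL.
move=> _ [e [z ->]]; rewrite linearB ql qr; apply/spanp_sub.
by exists e, (q z).
Qed.

Lemma hoch_resolving : resolving hoch_theta.
Proof.
split=> [K P M i p r s i_mor p_mor riK psK isp|V n x|V n x|M|M].
- exists (hoch_map i), (hoch_map p), (hoch_map r), (hoch_map s); split; first split.
  + exact: hoch_map_chain.
  + exact: hoch_map_chain.
  + move=> n; have hl := lin_app (hoch_map r n) (linearP (hoch_map i n)).
    apply: (fam_eq (hoch_fam K) (h := mklin hl) (h' := idfun)) => m t tn /=.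
    by rewrite !hoch_mapE // riK.
  + move=> n; have hl := lin_app (hoch_map p n) (linearP (hoch_map s n)).
    apply: (fam_eq (hoch_fam M) (h := mklin hl) (h' := idfun)) => m t tn /=.
    by rewrite !hoch_mapE // psK.
  + move=> n; have hl := lin_app (hoch_map i n) (linearP (hoch_map r n)).
    have rl := lin_app (hoch_map s n) (linearP (hoch_map p n)).
    apply: (fam_eq (hoch_fam P) (h := mklin (lin_add hl rl)) (h' := idfun)) => m t tn /=.
    rewrite !hoch_mapE // -(linfD (f := fun m => hgen n m t)) ?isp //.
    by have [gm _ _ _] := hgen_good P n; exact: gm.
  + move=> x m; rewrite -[in hoch_map _ _ _](hoch_augK x) => e.
    apply: etrans (comm_map i_mor e).
    by rewrite /= hoch_mapE // hoch_augE.
- exact: hoch_dd.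
- exact: hoch_acyclic.
- exact: hoch_theta_surj.
- exact: hoch_theta0.
Qed.

End HochschildTheory.

(** * Sweedler calculus *)

Section Sweedler.
Variables (k : comNzRingType) (H : algType k) (hH : hopf H).

(** Splits off two legs at a time; nesting gives longer Sweedler sums with explicit bracketing. The
    list chosen by [trep] is immaterial for bilinear b, which is why linearity in each leg is
    checked along the way. *)
Definition sws (W : nmodType) (h : H) (b : H -> H -> W) : W :=
  \sum_(p <- trep (comul hH h)) b p.1 p.2.

Definition eps (h : H) : k := counit hH h.

Lemma eps_lin : linear (eps : H -> k^o).
Proof. by move=> c x y; rewrite /eps linearP. Qed.
Lemma eps1 : eps 1 = 1.
Proof. exact: rmorph1. Qed.
Lemma epsM x y : eps (x * y) = eps x * eps y.
Proof. exact: rmorphM. Qed.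

Lemma eq_sws (W : nmodType) h (b b' : H -> H -> W) :
  (forall x y, b x y = b' x y) -> sws h b = sws h b'.
Proof. by move=> bb'; apply: eq_bigr => p _; exact: bb'. Qed.

Lemma sws_sw1 (W : nmodType) h (b : H -> H -> W) :
  \sum_(x <- sw hH 1 h) b x`_0 x`_1 = sws h b.
Proof. exact: sw1E. Qed.

Lemma sws_sw2 (W : nmodType) h (b : H -> H -> H -> W) :
  \sum_(x <- sw hH 2 h) b x`_0 x`_1 x`_2 = sws h (fun x r => sws r (b x)).
Proof. exact: sw2E. Qed.

Section Values.
Variable W : lmodType k.
Implicit Types (b : H -> H -> W) (F : H -> H -> H -> W).

Definition bilin b := (forall y, linear (b^~ y)) /\ (forall x, linear (b x)).
Definition trilin F := [/\ forall y z, linear (fun x => F x y z),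
  forall x z, linear (fun y => F x y z) & forall x y, linear (F x y)].

Lemma sws_lin b : bilin b -> linear (fun h => sws h b).
Proof.
move=> [bl br]; have [g _ gE] := trep_sum bl br.
by move=> c x y; rewrite /sws !gE !linearP.
Qed.

Lemma sws_linf (W' : lmodType k) (g : W -> W') h b :
  linear g -> g (sws h b) = sws h (fun x y => g (b x y)).
Proof. by move=> gl; rewrite /sws (linf_sum gl). Qed.

Lemma scale_sws c h b : c *: sws h b = sws h (fun x y => c *: b x y).
Proof. exact: scaler_sumr. Qed.

Lemma sws_exchange h l (b : H -> H -> H -> H -> W) :
  sws h (fun x y => sws l (fun z t => b x y z t)) =
  sws l (fun z t => sws h (fun x y => b x y z t)).
Proof. exact: exchange_big. Qed.

Lemma swsA F h : trilin F ->
  sws h (fun x z => sws x (fun x' y => F x' y z)) =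
  sws h (fun x r => sws r (fun y z => F x y z)).
Proof.
move=> [F1 F2 F3]; have [G GE] := tens_ext3 F1 F2 F3.
have := congr1 G (comulA hH h); rewrite !linear_sum /sws.
have e I (r : seq I) (u : I -> seq (H * H)) (v w : I -> H * H -> H) (z : I -> H * H -> H) :
    G (\sum_(p <- r) \sum_(q <- u p) v p q \ox (w p q \ox z p q)) =
    \sum_(p <- r) \sum_(q <- u p) F (v p q) (w p q) (z p q).
  rewrite linear_sum; apply: eq_bigr => p _; rewrite linear_sum.
  by apply: eq_bigr => q _; rewrite GE.
rewrite -!linear_sum => h1; apply: etrans (etrans h1 _); first exact/esym/e.
exact: e.
Qed.

(** Regroups (h1 h2)(h3 h4) as h1 ((h2 h3) h4): the two middle legs come together, so that an
    antipode identity can act on them. *)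
Lemma swsA4 h (F : H -> H -> H -> H -> W) :
  (forall y z t, linear (fun x => F x y z t)) ->
  (forall x z t, linear (fun y => F x y z t)) ->
  (forall x y t, linear (fun z => F x y z t)) ->
  (forall x y z, linear (F x y z)) ->
  sws h (fun u v => sws u (fun x y => sws v (F x y))) =
  sws h (fun x r => sws r (fun m t => sws m (fun y z => F x y z t))).
Proof.
move=> F1 F2 F3 F4.
have sl3 x y : linear (fun v => sws v (F x y)) by apply: sws_lin.
rewrite (@swsA (fun x y v => sws v (F x y))); last first.
  by split=> // *; apply: linear_sumf => p; [exact: F1 | exact: F2].
by apply: eq_sws => x r; rewrite -(@swsA (fun y z t => F x y z t)).
Qed.

Lemma sws_counitl h (G : H -> W) : linear G -> sws h (fun x y => eps x *: G y) = G h.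
Proof.
move=> Gl; rewrite -[in RHS](counitl hH h) (linf_sum Gl).
by apply: eq_bigr => p _; rewrite (linfZ Gl).
Qed.

Lemma sws_counitr h (G : H -> W) : linear G -> sws h (fun x y => eps y *: G x) = G h.
Proof.
move=> Gl; rewrite -[in RHS](counitr hH h) (linf_sum Gl).
by apply: eq_bigr => p _; rewrite (linfZ Gl).
Qed.

Lemma sws_antipl h (G : H -> W) :
  linear G -> sws h (fun x y => G (antip hH x * y)) = eps h *: G 1.
Proof.
by move=> Gl; rewrite -(linfZ Gl) -[_ *: 1]/((counit hH h : k)%:A) -(antipl hH h) (linf_sum Gl).
Qed.

Lemma sws_antipr h (G : H -> W) :
  linear G -> sws h (fun x y => G (x * antip hH y)) = eps h *: G 1.
Proof.
by move=> Gl; rewrite -(linfZ Gl) -[_ *: 1]/((counit hH h : k)%:A) -(antipr hH h) (linf_sum Gl).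
Qed.

Lemma sws1 b : bilin b -> sws 1 b = b 1 1.
Proof.
move=> [bl br]; have [g gE gS] := trep_sum bl br.
by rewrite /sws gS comul1 gE.
Qed.

Lemma swsM b h l : bilin b ->
  sws (h * l) b = sws h (fun x y => sws l (fun x' y' => b (x * x') (y * y'))).
Proof.
move=> [bl br]; have [g gE gS] := trep_sum bl br.
rewrite /sws gS comulM linear_sum; apply: eq_bigr => p _.
by rewrite linear_sum; apply: eq_bigr => q _; rewrite gE.
Qed.

End Values.
End Sweedler.

Section SweedlerLin.
Variables (k : comNzRingType) (H : algType k) (hH : hopf H) (U W : lmodType k).

Lemma lin_sws1 h (F : U -> H -> H -> W) :
  (forall x y, linear (fun z => F z x y)) -> linear (fun z => sws hH h (F z)).
Proof. by move=> Fl; apply: linear_sumf => p; exact: Fl. Qed.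

Lemma lin_sws2 (f : U -> H) (b : H -> H -> W) :
  linear f -> (forall y, linear (b^~ y)) -> (forall x, linear (b x)) ->
  linear (fun z => sws hH (f z) b).
Proof. by move=> fl bl br; apply: (lin_comp (g := fun h => sws hH h b)) fl; exact: sws_lin. Qed.

Variables (A : algType k) (w : weakAction hH A).

Lemma lin_wactl (f : U -> H) (a : A) : linear f -> linear (fun z => w (f z) a).
Proof. by move=> fl c x y; rewrite fl wact_linl. Qed.
Lemma lin_wactr h (f : U -> A) : linear f -> linear (fun z => w h (f z)).
Proof. by move=> fl c x y; rewrite fl wact_linr. Qed.

End SweedlerLin.

Ltac lin_hook2 := fail.
Ltac lin_hook ::= match goal with
  | |- GRing.linear_for _ (eps ?hH) => exact: (eps_lin hH)
  | |- GRing.linear_for _ (fun z => eps ?hH z) => exact: (eps_lin hH)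
  | |- GRing.linear_for _ (fun z => eps ?hH (@?f z)) =>
    apply: (lin_comp (f := f) (eps_lin hH))
  | |- GRing.linear_for _ (fun z => sws ?hH ?h (@?F z)) =>
    apply: (@lin_sws1 _ _ hH _ _ h F) => ? ?
  | |- GRing.linear_for _ (fun z => sws ?hH (@?f z) ?b) =>
    apply: (@lin_sws2 _ _ hH _ _ f b); [ | move=> ? | move=> ?]
  | |- GRing.linear_for _ (wact ?w ?h) => exact: wact_linr
  | |- GRing.linear_for _ (fun z => wact ?w (@?f z) ?a) =>
    apply: (@lin_wactl _ _ _ _ _ w f a)
  | |- GRing.linear_for _ (fun z => wact ?w ?h (@?f z)) =>
    apply: (@lin_wactr _ _ _ _ _ w h f)
  | _ => lin_hook2
  end.

Ltac bilin := split=> [?|?]; lin.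
Ltac trilin := split=> [? ?|? ?|? ?]; lin.

Section Antipode.
Variables (k : comNzRingType) (H : algType k) (hH : hopf H) (W : lmodType k).
Local Notation S := (antip hH).

(* Both sides are convolution inverse to the comultiplication. *)
Lemma sws_antip_tens (g : {linear tens H H -> W}) h :
  sws hH (S h) (fun x y => g (x \ox y)) = sws hH h (fun x y => g (S y \ox S x)).
Proof.
(* The triple convolution of the comultiplication after S, the comultiplication, and the flipped S
   (x) S after the comultiplication. Cancelling y against z leaves the left side, cancelling x
   against y the right side. *)
pose F x y z := sws hH (S x) (fun u v => sws hH y (fun y1 y2 =>
  sws hH z (fun z1 z2 => g ((u * (y1 * S z2)) \ox (v * (y2 * S z1)))))).
have F_tri : trilin F by rewrite /F; trilin.
transitivity (sws hH h (fun x r => sws hH r (fun y z => F x y z))).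
  transitivity (sws hH h (fun x r => eps hH r *: sws hH (S x) (fun x y => g (x \ox y)))).
    by rewrite (sws_counitr hH h (G := fun x => sws hH (S x) _)) //; lin.
  apply: eq_sws => x r; rewrite /F.
  transitivity (sws hH (S x) (fun u v => sws hH r (fun y z => sws hH y (fun y1 y2 =>
    sws hH z (fun z1 z2 => g ((u * (y1 * S z2)) \ox (v * (y2 * S z1)))))))); last first.
    by rewrite sws_exchange.
  rewrite scale_sws.
  apply: eq_sws => u v.
  rewrite (@swsA4 _ _ hH _ r (fun y1 y2 z1 z2 =>
    g ((u * (y1 * S z2)) \ox (v * (y2 * S z1))))) => *; try lin.
  transitivity (sws hH r (fun y1 t => sws hH t (fun m z2 =>
      eps hH m *: g ((u * (y1 * S z2)) \ox (v * 1))))); last first.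
    apply: eq_sws => y1 t; apply: eq_sws => m z2.
    by rewrite (sws_antipr hH m (G := fun y => g ((u * (y1 * S z2)) \ox (v * y)))) //; lin.
  transitivity (sws hH r (fun y1 t => g ((u * (y1 * S t)) \ox (v * 1)))); last first.
    apply: eq_sws => y1 t.
    by rewrite (sws_counitl hH t (G := fun t => g ((u * (y1 * S t)) \ox (v * 1)))) //; lin.
  rewrite (sws_antipr hH r (G := fun y => g ((u * y) \ox (v * 1)))); last by lin.
  by rewrite !mulr1.
rewrite -(swsA hH h F_tri).
transitivity (sws hH h (fun x z => eps hH x *:
    sws hH z (fun z1 z2 => g (S z2 \ox S z1)))); last first.
  by rewrite (sws_counitl hH h (G := fun z => sws hH z _)) //; lin.
apply: eq_sws => t z; rewrite /F.
pose b' p q := sws hH z (fun z1 z2 => g ((p * S z2) \ox (q * S z1))).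
transitivity (sws hH t (fun x y => sws hH (S x * y) b')).
  apply: eq_sws => x y; rewrite swsM; last by rewrite /b'; bilin.
  apply: eq_sws => u v; apply: eq_sws => y1 y2; apply: eq_sws => z1 z2.
  by rewrite !mulrA.
rewrite (sws_antipl hH t (G := fun y => sws hH y b')); last by rewrite /b'; lin.
rewrite sws1; last by rewrite /b'; bilin.
by congr (_ *: _); apply: eq_sws => z1 z2; rewrite !mul1r.
Qed.

Lemma sws_antip (b : H -> H -> W) h : bilin b ->
  sws hH (S h) b = sws hH h (fun x y => b (S y) (S x)).
Proof.
move=> [bl br]; have [g gE] := tens_ext2 bl br.
rewrite (@eq_sws _ _ _ _ _ _ (fun x y => g (x \ox y))) => [|x y]; last by rewrite gE.
by rewrite sws_antip_tens; apply: eq_sws => x y; rewrite gE.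
Qed.

Lemma eps_antip h : eps hH (S h) = eps hH h.
Proof.
have := @sws_antipl _ _ hH k^o h (eps hH) (eps_lin hH).
rewrite eps1 => h1; have h2 : eps hH h *: (1 : k^o) = eps hH h by exact: mulr1.
rewrite -h2 -h1.
have -> : sws hH h (fun x y => eps hH (S x * y) : k^o) =
   sws hH h (fun x y => eps hH y *: (eps hH (S x) : k^o)).
  by apply: eq_sws => x y; rewrite epsM mulrC.
rewrite (sws_counitr hH h (G := fun x => eps hH (S x) : k^o)) //.
by apply: (lin_comp (eps_lin hH)); exact: linearP.
Qed.

End Antipode.

(** * Crossed products *)

Section PureTensors.
Variables (k : comNzRingType) (H : algType k) (hH : hopf H) (A : algType k).
Variables (w : weakAction hH A) (f : {linear tens H H -> A}) (wf : is_crossed w f).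
Local Notation E := (crossed wf).

(** The tensor a (x) h typed in E, so that products are those of the crossed product. *)
Definition pureE (a : A) (h : H) : E := a \ox h.

Lemma pureE_linl h : linear (pureE^~ h).
Proof. exact: ptens_linl. Qed.
Lemma pureE_linr a : linear (pureE a).
Proof. exact: ptens_linr. Qed.

Lemma lin_pureEl (U : lmodType k) (q : U -> A) h :
  linear q -> linear (fun x => pureE (q x) h).
Proof. by move=> ql c x y; rewrite ql pureE_linl. Qed.
Lemma lin_pureEr (U : lmodType k) (q : U -> H) a :
  linear q -> linear (fun x => pureE a (q x)).
Proof. by move=> ql c x y; rewrite ql pureE_linr. Qed.

Lemma lin_inA (U : lmodType k) (q : U -> A) :
  linear q -> linear (fun x => inA wf (q x)).
Proof. exact: lin_pureEl. Qed.
Lemma lin_inH (U : lmodType k) (q : U -> H) :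
  linear q -> linear (fun x => inH wf (q x)).
Proof. exact: lin_pureEr. Qed.

End PureTensors.

Ltac lin_hook3 := fail.
Ltac lin_hook2 ::= match goal with
  | |- GRing.linear_for _ (pureE ?wf ?a) => exact: pureE_linr
  | |- GRing.linear_for _ (fun z => pureE ?wf (@?f z) ?h) =>
    apply: (lin_pureEl wf h (q := f))
  | |- GRing.linear_for _ (fun z => pureE ?wf ?a (@?f z)) =>
    apply: (lin_pureEr wf a (q := f))
  | |- GRing.linear_for _ (inA ?wf) => exact: (lin_inA wf (@lin_id _ _))
  | |- GRing.linear_for _ (inH ?wf) => exact: (lin_inH wf (@lin_id _ _))
  | |- GRing.linear_for _ (fun z => inA ?wf (@?f z)) => apply: (lin_inA wf (q := f))
  | |- GRing.linear_for _ (fun z => inH ?wf (@?f z)) => apply: (lin_inH wf (q := f))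
  | _ => lin_hook3
  end.

Section CrossedProduct.
Variables (k : comNzRingType) (H : algType k) (hH : hopf H) (A : algType k).
Variables (w : weakAction hH A) (f : {linear tens H H -> A}) (wf : is_crossed w f).
Local Notation E := (crossed wf).
Local Notation sws := (sws hH).
Local Notation eps := (eps hH).
Local Notation inA := (inA wf).
Local Notation inH := (inH wf).
Local Notation pureE := (pureE wf).

Lemma wM h a b : w h (a * b) = sws h (fun x y => w x a * w y b).
Proof. by rewrite wactM; exact: (sws_sw1 hH h (fun x y => w x a * w y b)). Qed.

Lemma w1 h : w h 1 = eps h *: 1.
Proof. exact: wact_1r. Qed.

Lemma pureE_mul a h b l : pureE a h * pureE b l =
  sws h (fun x r => sws r (fun y z => sws l (fun l1 l2 =>
    pureE (a * w x b * f (y \ox l1)) (z * l2)))).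
Proof.
have [_ _ e] := crossed_mul_bilin w f.
apply: etrans (e a h b l) _; rewrite /crossed_mul_pure.
rewrite -(sws_sw2 hH h (fun x y z => sws l (fun l1 l2 =>
    pureE (a * w x b * f (y \ox l1)) (z * l2)))).
by apply: eq_bigr => x _; exact: (sws_sw1 hH l (fun l1 l2 =>
    pureE (a * w x`_0 b * f (x`_1 \ox l1)) (x`_2 * l2))).
Qed.

(** The map id (x) eps from E to A. Since [is_crossed] is stated as associativity and unit laws of
    E, applying this map to them is how the identities for f in A are recovered. *)
Lemma counitE_ex : exists th : {linear E -> A}, forall a h, th (pureE a h) = eps h *: a.
Proof.
by apply: (@tens_ext2 _ A H A (fun a h => eps h *: a)) => ?; lin.
Qed.
Definition counitE := projT1 (cid counitE_ex).
Lemma counitEE a h : counitE (pureE a h) = eps h *: a.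
Proof. exact: (projT2 (cid counitE_ex)). Qed.

Lemma counitE_mul a h b l : counitE (pureE a h * pureE b l) =
  sws h (fun x y => a * w x b * f (y \ox l)).
Proof.
rewrite pureE_mul (sws_linf hH h _ (linearP counitE)); apply: eq_sws => x r.
rewrite (sws_linf hH r _ (linearP counitE)).
transitivity (sws r (fun y z => eps z *: (a * w x b * f (y \ox l)))); last first.
  by rewrite (sws_counitr hH r (G := fun y => a * w x b * f (y \ox l))) //; lin.
apply: eq_sws => y z; rewrite (sws_linf hH l _ (linearP counitE)).
rewrite -(sws_counitr hH l (G := fun l => a * w x b * f (y \ox l))); last by lin.
rewrite scale_sws; apply: eq_sws => l1 l2.
by rewrite counitEE epsM scalerA.
Qed.

(** The unit law (1 # 1)(1 # h) = 1 # h, read through id (x) eps. *)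
Lemma f1l h : f (1 \ox h) = eps h *: 1.
Proof.
have := counitE_mul 1 1 1 h; rewrite [pureE 1 1 * _](mul1r (pureE 1 h)) counitEE => ->.
rewrite sws1; first by rewrite wact_1l !mul1r.
by split=> ?; lin.
Qed.

Lemma f1r h : f (h \ox 1) = eps h *: 1.
Proof.
have := counitE_mul 1 h 1 1; rewrite [_ * pureE 1 1](mulr1 (pureE 1 h)) counitEE => ->.
rewrite -(sws_counitl hH h (G := fun h => f (h \ox 1))); last by lin.
by apply: eq_sws => x y; rewrite w1 mul1r -scalerAl mul1r.
Qed.

Lemma inA_pure a b l : inA a * pureE b l = pureE (a * b) l.
Proof.
rewrite -[inA a]/(pureE a 1) pureE_mul sws1; last by split=> ?; lin.
rewrite sws1; last by split=> ?; lin.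
rewrite -[RHS](sws_counitl hH l (G := fun l => pureE (a * b) l)); last by lin.
apply: eq_sws => l1 l2; rewrite wact_1l mul1r f1l -scalerAr mulr1.
exact: (linfZ (pureE_linl wf l2)).
Qed.

Lemma pure_inA b h a : pureE b h * inA a = sws h (fun x y => pureE (b * w x a) y).
Proof.
rewrite -[inA a]/(pureE a 1) pureE_mul.
apply: eq_sws => x r; rewrite -[RHS](sws_counitl hH r (G := fun y => pureE (b * w x a) y)).
  apply: eq_sws => y z; rewrite sws1; last by split=> ?; lin.
  rewrite f1r mulr1 -scalerAr mulr1; exact: (linfZ (pureE_linl wf z)).
by lin.
Qed.

Lemma pureEE a h : pureE a h = inA a * inH h.
Proof. by rewrite -[inH h]/(pureE 1 h) inA_pure mulr1. Qed.

Lemma inH_inH h l : inH h * inH l =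
  sws h (fun x y => sws l (fun x' y' => pureE (f (x \ox x')) (y * y'))).
Proof.
rewrite -[inH h]/(pureE 1 h) -[inH l]/(pureE 1 l) pureE_mul.
transitivity (sws h (fun x r => eps x *: sws r (fun x y => sws l (fun x' y' =>
  pureE (f (x \ox x')) (y * y'))))).
  apply: eq_sws => x r; rewrite scale_sws; apply: eq_sws => y z.
  rewrite scale_sws; apply: eq_sws => x' y'.
  rewrite w1 mul1r -scalerAl mul1r; exact: (linfZ (pureE_linl wf _)).
by rewrite (sws_counitl hH h (G := fun r => sws r _)) //; lin.
Qed.

Lemma inAM a b : inA (a * b) = inA a * inA b.
Proof. by rewrite -[inA b]/(pureE b 1) inA_pure. Qed.
Lemma inA1 : inA 1 = 1.
Proof. by []. Qed.
Lemma inH1 : inH 1 = 1.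
Proof. by []. Qed.
Lemma inA_lin : linear inA.
Proof. exact: pureE_linl. Qed.
Lemma inH_lin : linear inH.
Proof. exact: pureE_linr. Qed.

Lemma inH_inA h a : inH h * inA a = sws h (fun x y => inA (w x a) * inH y).
Proof.
rewrite -[inH h]/(pureE 1 h) pure_inA; apply: eq_sws => x y.
by rewrite mul1r pureEE.
Qed.

(** Associativity for 1 # h, 1 # l and a # 1, read through id (x) eps. *)
Lemma twisted a h l :
  sws h (fun x y => sws l (fun x' y' => w x (w x' a) * f (y \ox y'))) =
  sws h (fun x y => sws l (fun x' y' => f (x \ox x') * w (y * y') a)).
Proof.
have := congr1 counitE (mulrA (inH h) (inH l) (inA a)).
have -> : inH l * inA a = sws l (fun x y => pureE (w x a) y).
  by rewrite inH_inA; apply: eq_sws => x y; rewrite pureEE.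
rewrite inH_inH (sws_linf hH l _ (lin_mulr _ (@lin_id _ E))).
rewrite (sws_linf hH l _ (linearP counitE)) => e; apply: etrans (etrans _ e) _.
  rewrite sws_exchange; apply: eq_sws => x' y'.
  rewrite -[inH h]/(pureE 1 h) counitE_mul; apply: eq_sws => x y.
  by rewrite mul1r.
rewrite (sws_linf hH h _ (lin_mull (inA a) (@lin_id _ E))).
rewrite (sws_linf hH h _ (linearP counitE)); apply: eq_sws => x y.
rewrite (sws_linf hH l _ (lin_mull (inA a) (@lin_id _ E))).
rewrite (sws_linf hH l _ (linearP counitE)); apply: eq_sws => x' y'.
rewrite pure_inA (sws_linf hH _ _ (linearP counitE)).
rewrite -(sws_counitr hH (y * y') (G := fun z => f (x \ox x') * w z a)); last by lin.
by apply: eq_sws => u v; rewrite counitEE.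
Qed.

(** Associativity for 1 # h, 1 # l and 1 # m, read through id (x) eps. *)
Lemma cocycle h l m :
  sws h (fun h1 h2 => sws l (fun l1 l2 => sws m (fun m1 m2 =>
    w h1 (f (l1 \ox m1)) * f (h2 \ox (l2 * m2))))) =
  sws h (fun h1 h2 => sws l (fun l1 l2 => f (h1 \ox l1) * f ((h2 * l2) \ox m))).
Proof.
have := congr1 counitE (mulrA (inH h) (inH l) (inH m)).
rewrite !inH_inH (sws_linf hH l _ (lin_mulr _ (@lin_id _ E))).
rewrite (sws_linf hH l _ (linearP counitE)) => e; apply: etrans (etrans _ e) _.
  rewrite sws_exchange; apply: eq_sws => l1 l2.
  rewrite (sws_linf hH m _ (lin_mulr _ (@lin_id _ E))).
  rewrite (sws_linf hH m _ (linearP counitE)) sws_exchange; apply: eq_sws => m1 m2.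
  rewrite -[inH h]/(pureE 1 h) counitE_mul; apply: eq_sws => x y.
  by rewrite mul1r.
rewrite (sws_linf hH h _ (lin_mull _ (@lin_id _ E))).
rewrite (sws_linf hH h _ (linearP counitE)); apply: eq_sws => h1 h2.
rewrite (sws_linf hH l _ (lin_mull _ (@lin_id _ E))).
rewrite (sws_linf hH l _ (linearP counitE)); apply: eq_sws => l1 l2.
rewrite -[inH m]/(pureE 1 m) counitE_mul.
rewrite -(sws_counitl hH (h2 * l2) (G := fun z => f (h1 \ox l1) * f (z \ox m))); last by lin.
by apply: eq_sws => u v; rewrite w1 -scalerAr mulr1 scalerAl.
Qed.

End CrossedProduct.

(** * The two-sided convolution inverse of 1 # h *)

Section Inverse.
Variables (k : comNzRingType) (H : algType k) (hH : hopf H) (A : algType k).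
Variables (w : weakAction hH A) (f g : {linear tens H H -> A}) (wf : is_crossed w f).
Hypothesis f_g : conv_inverse hH f g.
Local Notation E := (crossed wf).
Local Notation sws := (sws hH).
Local Notation eps := (eps hH).
Local Notation S := (antip hH).
Local Notation inA := (inA wf).
Local Notation inH := (inH wf).
Local Notation J := (inH_inv g wf).

Lemma sws2E (W : nmodType) h l (b : H -> H -> H -> H -> W) :
  \sum_(x <- sw hH 1 h) \sum_(y <- sw hH 1 l) b x`_0 x`_1 y`_0 y`_1 =
  sws h (fun h1 h2 => sws l (fun l1 l2 => b h1 h2 l1 l2)).
Proof.
rewrite -(sws_sw1 hH h (fun h1 h2 => sws l (b h1 h2))).
by apply: eq_bigr => x _; exact: (sws_sw1 hH l (b x`_0 x`_1)).
Qed.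

Lemma fg_inv h l : sws h (fun h1 h2 => sws l (fun l1 l2 =>
  f (h1 \ox l1) * g (h2 \ox l2))) = (eps h * eps l) *: 1.
Proof.
have [<- _] := f_g h l.
by rewrite -(sws2E h l (fun h1 h2 l1 l2 => f (h1 \ox l1) * g (h2 \ox l2))).
Qed.

Lemma gf_inv h l : sws h (fun h1 h2 => sws l (fun l1 l2 =>
  g (h1 \ox l1) * f (h2 \ox l2))) = (eps h * eps l) *: 1.
Proof.
have [_ <-] := f_g h l.
by rewrite -(sws2E h l (fun h1 h2 l1 l2 => g (h1 \ox l1) * f (h2 \ox l2))).
Qed.

Lemma g1l h : g (1 \ox h) = eps h *: 1.
Proof.
have := fg_inv 1 h; rewrite sws1; last by bilin.
rewrite eps1 mul1r => <-; rewrite -(sws_counitl hH h (G := fun h => g (1 \ox h))); last by lin.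
apply: eq_sws => x y; rewrite (f1l wf) -scalerAl mul1r; by [].
Qed.

(** The A-part of the inverse: (1 # h)^-1 is kap (h2) # S (h1). *)
Definition kap (h : H) : A := sws h (fun y z => g (S y \ox z)).

Lemma inH_invE h : J h = sws h (fun x r => inA (kap r) * inH (S x)).
Proof.
rewrite /inH_inv (sws_sw2 hH h (fun x y z => pureE wf (g (S y \ox z)) (S x))).
apply: eq_sws => x r; rewrite -pureEE.
by rewrite (sws_linf hH r _ (pureE_linl wf (S x))).
Qed.

Lemma inH_inv_lin : linear J.
Proof.
have jl : linear (fun h => sws h (fun x r => inA (kap r) * inH (S x))).
  by rewrite /kap; lin.
by move=> c x y; rewrite !inH_invE; exact: jl.
Qed.

(** Because S reverses the comultiplication, the sum is the convolution product of g and f at S (h1)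
    (x) h2, and eps S = eps. *)
Lemma kap_f h : sws h (fun t v => sws t (fun x r => kap r * f (S x \ox v))) = eps h *: 1.
Proof.
transitivity (sws h (fun t v => sws t (fun p z => sws p (fun x y =>
    g (S y \ox z) * f (S x \ox v))))).
  apply: eq_sws => t v; rewrite (swsA hH t (F := fun x y z => g (S y \ox z) * f (S x \ox v))).
    apply: eq_sws => x r; rewrite /kap.
    by rewrite (sws_linf hH r _ (lin_mull _ (@lin_id _ A))).
  by trilin.
rewrite (swsA hH h (F := fun p z v => sws p (fun x y => g (S y \ox z) * f (S x \ox v)))); last by trilin.
transitivity (sws h (fun p q => eps p *: (eps q *: (1 : A)))); last first.
  by rewrite (sws_counitl hH h (G := fun h => eps h *: (1 : A))) //; lin.
apply: eq_sws => p q; rewrite scalerA -(eps_antip hH p) -gf_inv.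
rewrite (sws_antip hH p (b := fun s1 s2 => sws q (fun z v => g (s1 \ox z) * f (s2 \ox v)))).
  by rewrite sws_exchange.
by bilin.
Qed.

(** Multiplying 1 # S (h1) by 1 # v produces a value of f that [kap_f] cancels against kap; what
    remains is S (h1) h2 in the H-part. *)
Lemma inH_invl h : sws h (fun u v => J u * inH v) = eps h *: 1.
Proof.
pose G x x2 r v := sws v (fun v1 v2 =>
  inA (kap r * f (S x2 \ox v1)) * inH (S x * v2)).
have G_lin x2 r v : linear (fun x => G x x2 r v) by rewrite /G; lin.
have G_lin2 x r v : linear (fun x2 => G x x2 r v) by rewrite /G; lin.
have G_lin3 x x2 v : linear (fun r => G x x2 r v) by rewrite /G /kap; lin.
have G_lin4 x x2 r : linear (fun v => G x x2 r v) by rewrite /G; lin.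
transitivity (sws h (fun u v => sws u (fun x t => sws t (fun x2 r => G x x2 r v)))).
  apply: eq_sws => u v; rewrite inH_invE.
  rewrite (sws_linf hH u _ (lin_mull (inH v) (@lin_id _ E))).
  transitivity (sws u (fun x r => sws x (fun x1 x2 => G x1 x2 r v))).
    apply: eq_sws => x r; rewrite -mulrA inH_inH.
    rewrite (sws_antip hH x (b := fun x y => sws v (fun x' y' => pureE wf (f (x \ox x')) (y * y')))); last by bilin.
    rewrite (sws_linf hH x _ (lin_mulr (inA (kap r)) (@lin_id _ E))).
    apply: eq_sws => x1 x2; rewrite (sws_linf hH v _ (lin_mulr (inA (kap r)) (@lin_id _ E))).
    by apply: eq_sws => v1 v2; rewrite pureEE mulrA inAM.
  by rewrite (swsA hH u (F := fun x1 x2 r => G x1 x2 r v)).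
rewrite (swsA hH h (F := fun x t v => sws t (fun x2 r => G x x2 r v))); last first.
  by split=> ? ?; [apply: lin_sws1 | apply: sws_lin | apply: lin_sws1].
rewrite -inH1 -(sws_antipl hH h (G := inH)); last by lin.
apply: eq_sws => x s.
transitivity (sws s (fun t v => sws v (fun v1 v2 => sws t (fun x2 r =>
    inA (kap r * f (S x2 \ox v1)) * inH (S x * v2))))).
  by apply: eq_sws => t v; rewrite sws_exchange.
rewrite -(swsA hH s (F := fun t v1 v2 => sws t (fun x2 r =>
    inA (kap r * f (S x2 \ox v1)) * inH (S x * v2)))); last first.
  by rewrite /kap; trilin.
rewrite -(sws_counitl hH s (G := fun s => inH (S x * s))); last by lin.
apply: eq_sws => t' v2.
have cl : linear (fun a => inA a * inH (S x * v2)) by lin.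
have := congr1 (fun a => inA a * inH (S x * v2)) (kap_f t').
rewrite (linfZ cl) inA1 mul1r => <-; rewrite (sws_linf hH t' _ cl).
by apply: eq_sws => t v; rewrite (sws_linf hH t _ cl).
Qed.

Section Multi.
Variable W : lmodType k.

Lemma trilin1 (F : H -> H -> H -> W) y z : trilin F -> linear (fun x => F x y z).
Proof. by case. Qed.
Lemma trilin2 (F : H -> H -> H -> W) x z : trilin F -> linear (fun y => F x y z).
Proof. by case. Qed.
Lemma trilin3 (F : H -> H -> H -> W) x y : trilin F -> linear (F x y).
Proof. by case. Qed.

Lemma trilin_sum (T : Type) (X : seq T) (F : T -> H -> H -> H -> W) :
  (forall t, trilin (F t)) -> trilin (fun x y z => \sum_(t <- X) F t x y z).
Proof.
move=> Ft; split=> ? ?; apply: linear_sumf => ?.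
- exact: (trilin1 _ _ (Ft _)).
- exact: (trilin2 _ _ (Ft _)).
- exact: (trilin3 _ _ (Ft _)).
Qed.

Lemma trilin_sws h (F : H -> H -> H -> H -> H -> W) :
  (forall u v, trilin (F u v)) -> trilin (fun x y z => sws h (fun u v => F u v x y z)).
Proof. by move=> Fuv; apply: trilin_sum => p; exact: Fuv. Qed.

Lemma swsA2 h l (F : H -> H -> H -> H -> H -> H -> W) :
  (forall l1 l2 l3, trilin (fun h1 h2 h3 => F h1 h2 h3 l1 l2 l3)) ->
  (forall h1 h2 h3, trilin (F h1 h2 h3)) ->
  sws h (fun a h3 => sws l (fun b l3 => sws a (fun h1 h2 => sws b (fun l1 l2 =>
    F h1 h2 h3 l1 l2 l3)))) =
  sws h (fun h1 c => sws l (fun l1 d => sws c (fun h2 h3 => sws d (fun l2 l3 =>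
    F h1 h2 h3 l1 l2 l3)))).
Proof.
move=> Fh Fl.
transitivity (sws h (fun a h3 => sws a (fun h1 h2 => sws l (fun b l3 => sws b (fun l1 l2 =>
    F h1 h2 h3 l1 l2 l3))))).
  by apply: eq_sws => a h3; exact: sws_exchange.
rewrite (swsA hH h (F := fun h1 h2 h3 => sws l (fun b l3 => sws b (fun l1 l2 =>
    F h1 h2 h3 l1 l2 l3)))); last by do 2!apply: trilin_sws => ? ?; exact: Fh.
apply: eq_sws => h1 c; rewrite [RHS]sws_exchange; apply: eq_sws => h2 h3.
by rewrite (swsA hH l (F := F h1 h2 h3)).
Qed.

Lemma swsA3 h l m (F : H -> H -> H -> H -> H -> H -> H -> H -> H -> W) :
  (forall l1 l2 l3 m1 m2 m3, trilin (fun h1 h2 h3 => F h1 h2 h3 l1 l2 l3 m1 m2 m3)) ->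
  (forall h1 h2 h3 m1 m2 m3, trilin (fun l1 l2 l3 => F h1 h2 h3 l1 l2 l3 m1 m2 m3)) ->
  (forall h1 h2 h3 l1 l2 l3, trilin (F h1 h2 h3 l1 l2 l3)) ->
  sws h (fun a h3 => sws l (fun b l3 => sws m (fun c m3 =>
    sws a (fun h1 h2 => sws b (fun l1 l2 => sws c (fun m1 m2 =>
    F h1 h2 h3 l1 l2 l3 m1 m2 m3)))))) =
  sws h (fun h1 a => sws l (fun l1 b => sws m (fun m1 c =>
    sws a (fun h2 h3 => sws b (fun l2 l3 => sws c (fun m2 m3 =>
    F h1 h2 h3 l1 l2 l3 m1 m2 m3)))))).
Proof.
move=> Fh Fl Fm.
pose G h1 h2 h3 l1 l2 l3 := sws m (fun c m3 => sws c (fun m1 m2 =>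
  F h1 h2 h3 l1 l2 l3 m1 m2 m3)).
transitivity (sws h (fun a h3 => sws l (fun b l3 => sws a (fun h1 h2 =>
    sws b (fun l1 l2 => G h1 h2 h3 l1 l2 l3))))).
  apply: eq_sws => a h3; apply: eq_sws => b l3; rewrite sws_exchange.
  by apply: eq_sws => h1 h2; rewrite sws_exchange.
rewrite swsA2; last 2 first.
- by move=> l1 l2 l3; do 2!apply: trilin_sws => ? ?; exact: Fh.
- by move=> h1 h2 h3; do 2!apply: trilin_sws => ? ?; exact: Fl.
apply: eq_sws => h1 a; apply: eq_sws => l1 b; rewrite [RHS]sws_exchange.
apply: eq_sws => h2 h3; rewrite [RHS]sws_exchange; apply: eq_sws => l2 l3.
by rewrite /G (swsA hH m (F := F h1 h2 h3 l1 l2 l3)).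
Qed.

End Multi.

(** The expression that arises in the product (1 # h1)(1 # h2)^-1, where h acts on a value of g.
    [YfE] rewrites it without any action, as the cocycle identity does for f. *)
Definition Yf h l m := sws h (fun h1 h2 => sws l (fun l1 l2 =>
  w h1 (g (l1 \ox m)) * f (h2 \ox l2))).

(** The cocycle identity turns f (h2, l2) f (h3 l3, m2) into a product starting with h2 acting on f
    (l2, m2). Joined with h1 acting on g (l1, m1) this is the action on a convolution product of g
    and f, hence trivial. *)
Lemma Yf_f h l m :
  sws h (fun a h3 => sws l (fun b l3 => sws m (fun m1 m2 =>
    Yf a b m1 * f ((h3 * l3) \ox m2)))) = f (h \ox (l * m)).
Proof.
transitivity (sws h (fun h1 c => sws l (fun l1 d => sws c (fun h2 h3 => sws d (fun l2 l3 =>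
    sws m (fun m1 m2 => w h1 (g (l1 \ox m1)) * (f (h2 \ox l2) * f ((h3 * l3) \ox m2)))))))).
  rewrite -swsA2; first last; try by move=> *; trilin.
  apply: eq_sws => a h3; apply: eq_sws => b l3.
  transitivity (sws a (fun h1 h2 => sws m (fun m1 m2 => sws b (fun l1 l2 =>
    w h1 (g (l1 \ox m1)) * (f (h2 \ox l2) * f ((h3 * l3) \ox m2)))))); last first.
    by apply: eq_sws => h1 h2; exact: sws_exchange.
  rewrite [RHS]sws_exchange; apply: eq_sws => m1 m2.
  rewrite /Yf (sws_linf hH a _ (lin_mull _ (@lin_id _ A))); apply: eq_sws => h1 h2.
  rewrite (sws_linf hH b _ (lin_mull _ (@lin_id _ A))); apply: eq_sws => l1 l2.
  by rewrite mulrA.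
transitivity (sws h (fun h1 c => sws l (fun l1 d => sws m (fun m1 e =>
    sws c (fun h2 h3 => sws d (fun l2 l3 => sws e (fun m2 m3 =>
    w h1 (g (l1 \ox m1)) * (w h2 (f (l2 \ox m2)) * f (h3 \ox (l3 * m3)))))))))).
  apply: eq_sws => h1 c; apply: eq_sws => l1 d.
  transitivity (sws m (fun m1 m2 => w h1 (g (l1 \ox m1)) *
      sws c (fun h2 h3 => sws d (fun l2 l3 => f (h2 \ox l2) * f ((h3 * l3) \ox m2))))).
    transitivity (sws c (fun h2 h3 => sws m (fun m1 m2 => sws d (fun l2 l3 =>
      w h1 (g (l1 \ox m1)) * (f (h2 \ox l2) * f ((h3 * l3) \ox m2)))))).
      by apply: eq_sws => h2 h3; exact: sws_exchange.
    rewrite sws_exchange; apply: eq_sws => m1 m2.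
    rewrite (sws_linf hH c _ (lin_mulr _ (@lin_id _ A))); apply: eq_sws => h2 h3.
    by rewrite (sws_linf hH d _ (lin_mulr _ (@lin_id _ A))).
  apply: eq_sws => m1 e; rewrite -(cocycle wf).
  rewrite (sws_linf hH c _ (lin_mulr _ (@lin_id _ A))); apply: eq_sws => h2 h3.
  rewrite (sws_linf hH d _ (lin_mulr _ (@lin_id _ A))); apply: eq_sws => l2 l3.
  by rewrite (sws_linf hH e _ (lin_mulr _ (@lin_id _ A))).
rewrite -swsA3; first last; try by move=> *; trilin.
rewrite -(sws_counitl hH h (G := fun h => f (h \ox (l * m)))); last by lin.
apply: eq_sws => a h3.
rewrite -(sws_counitl hH l (G := fun l => eps a *: f (h3 \ox (l * m)))); last by lin.
apply: eq_sws => b l3.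
rewrite -(sws_counitl hH m (G := fun m => eps b *: (eps a *: f (h3 \ox (l3 * m))))); last by lin.
apply: eq_sws => c m3.
have fl : linear (fun x => w a x * f (h3 \ox (l3 * m3))) by lin.
have := congr1 (fun x => w a x * f (h3 \ox (l3 * m3))) (gf_inv b c).
rewrite (linfZ fl) w1 -scalerAl mul1r => e; rewrite (scalerA (eps c)) (mulrC (eps c)) -e.
rewrite (sws_linf hH b _ fl) sws_exchange; apply: eq_sws => l1 l2.
rewrite (sws_linf hH c _ fl) sws_exchange; apply: eq_sws => m1 m2.
rewrite wM (sws_linf hH a _ (lin_mull _ (@lin_id _ A))); apply: eq_sws => h1 h2.
by rewrite mulrA.
Qed.

(** Convolve [Yf_f] on the right with g (h l, m), which cancels f (h l, m). *)
Lemma YfE h l m : Yf h l m =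
  sws h (fun h1 h2 => sws l (fun l1 l2 => sws m (fun m1 m2 =>
    f (h1 \ox (l1 * m1)) * g ((h2 * l2) \ox m2)))).
Proof.
have Y1 l' m' : linear (fun h => Yf h l' m') by rewrite /Yf; lin.
have Y2 h' m' : linear (fun l => Yf h' l m') by rewrite /Yf; lin.
have Y3 h' l' : linear (Yf h' l') by rewrite /Yf; lin.
have linY1 (U : lmodType k) (q : U -> H) l' m' :
    linear q -> linear (fun x => Yf (q x) l' m').
  exact: (@lin_comp _ _ _ _ (fun h => Yf h l' m') q (Y1 _ _)).
have linY2 (U : lmodType k) (q : U -> H) h' m' :
    linear q -> linear (fun x => Yf h' (q x) m').
  exact: (@lin_comp _ _ _ _ (fun l => Yf h' l m') q (Y2 _ _)).
have linY3 (U : lmodType k) (q : U -> H) h' l' :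
    linear q -> linear (fun x => Yf h' l' (q x)).
  exact: (@lin_comp _ _ _ _ (Yf h' l') q (Y3 _ _)).
transitivity (sws h (fun a h3 => sws l (fun b l3 => sws m (fun c m3 =>
    sws a (fun h1 h2 => sws b (fun l1 l2 => sws c (fun m1 m2 =>
      Yf h1 l1 m1 * (f ((h2 * l2) \ox m2) * g ((h3 * l3) \ox m3))))))))); last first.
  apply: eq_sws => a h3; apply: eq_sws => b l3; apply: eq_sws => c m3.
  rewrite -Yf_f (sws_linf hH a _ (lin_mull _ (@lin_id _ A))); apply: eq_sws => h1 h2.
  rewrite (sws_linf hH b _ (lin_mull _ (@lin_id _ A))); apply: eq_sws => l1 l2.
  rewrite (sws_linf hH c _ (lin_mull _ (@lin_id _ A))); apply: eq_sws => m1 m2.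
  by rewrite mulrA.
rewrite swsA3; first last.
- by move=> *; split=> ? ?; lin; apply: linY3; lin.
- by move=> *; split=> ? ?; lin; apply: linY2; lin.
- by move=> *; split=> ? ?; lin; apply: linY1; lin.
rewrite -[LHS](sws_counitr hH h (G := fun h => Yf h l m)) //; apply: eq_sws => h1 a.
rewrite -[LHS](sws_counitr hH l (G := fun l => eps a *: Yf h1 l m)); last by apply: lin_scale.
apply: eq_sws => l1 b.
rewrite -[LHS](sws_counitr hH m (G := fun m => eps b *: (eps a *: Yf h1 l1 m))); last first.
  by do 2!apply: lin_scale.
apply: eq_sws => m1 c.
have -> x : eps c *: (eps b *: (eps a *: x)) = (eps a * eps b * eps c) *: (x : A).
  rewrite !scalerA; congr (_ *: _).
  by rewrite [LHS]mulrC (mulrC (eps c)) mulrA.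
have := fg_inv (a * b) c; rewrite epsM swsM; last by bilin.
move=> /(congr1 (fun x => Yf h1 l1 m1 * x)); rewrite -scalerAr mulr1.
move=> <-.
rewrite (sws_linf hH a _ (lin_mulr _ (@lin_id _ A))); apply: eq_sws => h2 h3.
rewrite (sws_linf hH b _ (lin_mulr _ (@lin_id _ A))); apply: eq_sws => l2 l3.
by rewrite (sws_linf hH c _ (lin_mulr _ (@lin_id _ A))).
Qed.

(** The sum is [Yf] at h1, S (h2), h3, which by [YfE] equals f (h1, S (h4) h5) g (h2 S (h3), h6).
    Here h2 S (h3) collapses, then g (1, h6), then S (h4) h5. It is the A-part of the right inverse
    law. *)
Lemma w_kap h : sws h (fun h1 t => sws t (fun h2 s => sws s (fun h3 r =>
  w h1 (kap r) * f (h2 \ox S h3)))) = eps h *: 1.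
Proof.
transitivity (sws h (fun a t => sws t (fun p m => Yf a (S p) m))).
  transitivity (sws h (fun a t => sws a (fun h1 h2 => sws t (fun h3 r =>
      w h1 (kap r) * f (h2 \ox S h3))))).
    by rewrite (swsA hH h (F := fun h1 h2 t => sws t (fun h3 r =>
      w h1 (kap r) * f (h2 \ox S h3)))) // /kap; trilin.
  apply: eq_sws => a t.
  transitivity (sws t (fun p m => sws p (fun p1 p2 => sws a (fun h1 h2 =>
      w h1 (g (S p2 \ox m)) * f (h2 \ox S p1))))).
    rewrite (swsA hH t (F := fun p1 p2 m => sws a (fun h1 h2 =>
      w h1 (g (S p2 \ox m)) * f (h2 \ox S p1)))); last by trilin.
    rewrite sws_exchange; apply: eq_sws => p1 r.
    rewrite sws_exchange; apply: eq_sws => h1 h2; rewrite /kap.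
    have wl : linear (fun x => w h1 x * f (h2 \ox S p1)) by lin.
    by rewrite (sws_linf hH r _ wl).
  apply: eq_sws => p m; rewrite sws_exchange; apply: eq_sws => h1 h2.
  by rewrite (sws_antip hH p (b := fun l1 l2 => w h1 (g (l1 \ox m)) * f (h2 \ox l2))) //; bilin.
transitivity (sws h (fun a t => sws t (fun p m => sws a (fun h1 h2 =>
    sws p (fun p1 p2 => sws m (fun m1 m2 =>
      f (h1 \ox (S p2 * m1)) * g ((h2 * S p1) \ox m2))))))).
  apply: eq_sws => a t; apply: eq_sws => p m; rewrite YfE; apply: eq_sws => h1 h2.
  by rewrite (sws_antip hH p (b := fun l1 l2 => sws m (fun m1 m2 =>
    f (h1 \ox (l1 * m1)) * g ((h2 * l2) \ox m2)))) //; bilin.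
pose M h1 h2 p1 q := sws q (fun p2 m => sws m (fun m1 m2 =>
  f (h1 \ox (S p2 * m1)) * g ((h2 * p1) \ox m2))).
transitivity (sws h (fun h1 c => sws c (fun h2 t => sws t (fun p1 q => M h1 h2 (S p1) q)))).
  rewrite -(swsA hH h (F := fun h1 h2 t => sws t (fun p1 q => M h1 h2 (S p1) q))); last first.
    by rewrite /M; trilin.
  apply: eq_sws => a t.
  transitivity (sws a (fun h1 h2 => sws t (fun p m => sws p (fun p1 p2 =>
    sws m (fun m1 m2 => f (h1 \ox (S p2 * m1)) * g ((h2 * S p1) \ox m2)))))).
    exact: sws_exchange.
  apply: eq_sws => h1 h2.
  by rewrite (swsA hH t (F := fun p1 p2 m => sws m (fun m1 m2 =>
    f (h1 \ox (S p2 * m1)) * g ((h2 * S p1) \ox m2)))) //; trilin.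
rewrite -(sws_counitr hH h (G := fun h => eps h *: (1 : A))); last by lin.
apply: eq_sws => h1 c.
rewrite -(swsA hH c (F := fun h2 p1 q => M h1 h2 (S p1) q)); last by rewrite /M; trilin.
rewrite -(f1r wf) -(sws_antipl hH c (G := fun y => f (h1 \ox y))); last by lin.
rewrite -(sws_counitl hH c (G := fun q => sws q (fun p2 m => f (h1 \ox (S p2 * m))))); last by lin.
apply: eq_sws => d q.
have Ml : linear (fun y => M h1 1 y q) by rewrite /M; lin.
transitivity (eps d *: M h1 1 1 q).
  rewrite -(sws_antipr hH d Ml); apply: eq_sws => h2 p1.
  by apply: eq_sws => p2 m; apply: eq_sws => m1 m2; rewrite mul1r.
congr (_ *: _); apply: eq_sws => p2 m.
rewrite -(sws_counitr hH m (G := fun m => f (h1 \ox (S p2 * m)))); last by lin.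
by apply: eq_sws => m1 m2; rewrite mul1r g1l -scalerAr mulr1.
Qed.

(** In the H-part of (1 # h1)(1 # h2)^-1 the last leg of h1 meets S of the first leg of h2 and
    cancels; the A-part is then the sum in [w_kap]. *)
Lemma inH_invr h : sws h (fun u v => inH u * J v) = eps h *: 1.
Proof.
pose G x v r := sws r (fun y t => inA (w x (kap t) * f (v \ox S y))).
transitivity (sws h (fun u v => sws v (fun x r => sws u (fun u1 u' => sws u' (fun u2 u3 =>
    sws x (fun x1 x2 => inA (w u1 (kap r) * f (u2 \ox S x2)) * inH (u3 * S x1))))))).
  apply: eq_sws => u v; rewrite inH_invE.
  rewrite (sws_linf hH v _ (lin_mulr (inH u) (@lin_id _ E))); apply: eq_sws => x r.
  rewrite mulrA inH_inA (sws_linf hH u _ (lin_mull (inH (S x)) (@lin_id _ E))).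
  apply: eq_sws => u1 u'; rewrite -mulrA inH_inH.
  rewrite (sws_linf hH u' _ (lin_mulr _ (@lin_id _ E))); apply: eq_sws => u2 u3.
  rewrite (sws_antip hH x (b := fun x1 x2 => pureE wf (f (u2 \ox x1)) (u3 * x2))); last by bilin.
  rewrite (sws_linf hH x _ (lin_mulr _ (@lin_id _ E))); apply: eq_sws => x1 x2.
  by rewrite pureEE mulrA inAM.
pose F u1 u2 u3 x1 x2 r := inA (w u1 (kap r) * f (u2 \ox S x2)) * inH (u3 * S x1).
transitivity (sws h (fun u v => sws u (fun u1 u' => sws v (fun x r => sws x (fun x1 x2 =>
    sws u' (fun u2 u3 => F u1 u2 u3 x1 x2 r)))))).
  apply: eq_sws => u v; rewrite sws_exchange; apply: eq_sws => u1 u'.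
  by apply: eq_sws => x r; exact: sws_exchange.
rewrite (swsA hH h (F := fun u1 u' v => sws v (fun x r => sws x (fun x1 x2 =>
    sws u' (fun u2 u3 => F u1 u2 u3 x1 x2 r))))); last by rewrite /F /kap; trilin.
have il : linear inA by lin.
have := congr1 inA (w_kap h); rewrite (linfZ il) inA1 => <-.
rewrite (sws_linf hH h _ il); apply: eq_sws => h1 c; rewrite (sws_linf hH c _ il).
transitivity (sws c (fun u' v => sws u' (fun u2 u3 => sws v (fun x1 t =>
    sws t (fun x2 r => F h1 u2 u3 x1 x2 r))))).
  apply: eq_sws => u' v; rewrite [RHS]sws_exchange.
  rewrite (swsA hH v (F := fun x1 x2 r => sws u' (fun u2 u3 => F h1 u2 u3 x1 x2 r))).
    by apply: eq_sws => x1 t; rewrite sws_exchange.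
  by rewrite /F /kap; trilin.
rewrite (swsA hH c (F := fun u2 u3 v => sws v (fun x1 t => sws t (fun x2 r =>
    F h1 u2 u3 x1 x2 r)))); last by rewrite /F /kap; trilin.
apply: eq_sws => u2 s.
rewrite -(swsA hH s (F := fun u3 x1 t => sws t (fun x2 r => F h1 u2 u3 x1 x2 r))); last first.
  by rewrite /F /kap; trilin.
rewrite (sws_linf hH s _ il).
transitivity (sws s (fun d t => eps d *: sws t (fun x2 r =>
    inA (w h1 (kap r) * f (u2 \ox S x2)) * inH 1))); last first.
  rewrite (sws_counitl hH s (G := fun t => sws t (fun x2 r =>
    inA (w h1 (kap r) * f (u2 \ox S x2)) * inH 1))); last by rewrite /kap; lin.
  by apply: eq_sws => x2 r; rewrite inH1 mulr1.
apply: eq_sws => d t.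
rewrite -(sws_antipr hH d (G := fun y => sws t (fun x2 r =>
    inA (w h1 (kap r) * f (u2 \ox S x2)) * inH y))) //; by rewrite /kap; lin.
Qed.

Lemma inH_inv1 : J 1 = 1.
Proof.
have := inH_invl 1; rewrite eps1 scale1r sws1; first by rewrite inH1 mulr1.
have jl := inH_inv_lin; split=> ?; last by lin.
exact/lin_mull.
Qed.

(** Insert (1 # h1)^-1 (1 # h2) in front of a and move 1 # h2 past a, where it cancels against (1 #
    h3)^-1 up to the leg acting on a. *)
Lemma inA_inv a h : inA a * J h = sws h (fun x y => J x * inA (w y a)).
Proof.
have jl := inH_inv_lin.
have linJ (U : lmodType k) (q : U -> H) : linear q -> linear (fun x => J (q x)).
  exact: lin_comp.
transitivity (sws h (fun x r => sws r (fun y z => J x * inH y * inA a * J z))).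
  rewrite -(swsA hH h (F := fun x y z => J x * inH y * inA a * J z)); last first.
    by split=> ? ?; lin; apply: linJ; lin.
  rewrite -(sws_counitl hH h (G := fun h => inA a * J h)); last by lin; apply: linJ; lin.
  apply: eq_sws => x z.
  have ml : linear (fun e => e * inA a * J z) by lin.
  have := congr1 (fun e => e * inA a * J z) (inH_invl x).
  by rewrite (linfZ ml) mul1r => <-; rewrite (sws_linf hH x _ ml).
apply: eq_sws => x r.
transitivity (J x * sws r (fun y z => sws y (fun y1 y2 => inA (w y1 a) * (inH y2 * J z)))).
  rewrite (sws_linf hH r _ (lin_mulr _ (@lin_id _ E))); apply: eq_sws => y z.
  rewrite -(mulrA (J x)) inH_inA -mulrA; congr (_ * _).
  rewrite (sws_linf hH y _ (lin_mull _ (@lin_id _ E))); apply: eq_sws => y1 y2.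
  by rewrite mulrA.
congr (_ * _).
rewrite (swsA hH r (F := fun y1 y2 z => inA (w y1 a) * (inH y2 * J z))); last first.
  by split=> ? ?; lin; apply: linJ; lin.
rewrite -[RHS](sws_counitr hH r (G := fun y => inA (w y a))); last by lin.
apply: eq_sws => y1 t.
have ml : linear (fun e => inA (w y1 a) * e) by lin.
have := congr1 (fun e => inA (w y1 a) * e) (inH_invr t).
by rewrite (linfZ ml) mulr1 => <-; rewrite (sws_linf hH t _ ml).
Qed.

(** The product of 1 # h and 1 # l is f (h1, l1) # h2 l2, and this is the corresponding rule for
    inverses. Both sides are compared with the middle term [T], which contains 1 # h, 1 # l and the
    inverse of 1 # h l. *)
Lemma inH_inv_mul h l :
  sws h (fun h1 h2 => sws l (fun l1 l2 => J l1 * J h1 * inA (f (h2 \ox l2)))) = J (h * l).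
Proof.
have jl := inH_inv_lin.
have linJ (U : lmodType k) (q : U -> H) : linear q -> linear (fun x => J (q x)).
  exact: lin_comp.
pose T h1 h2 h3 l1 l2 l3 := J l1 * J h1 * (inH h2 * inH l2) * J (h3 * l3).
have T_h l1 l2 l3 : trilin (fun h1 h2 h3 => T h1 h2 h3 l1 l2 l3).
  by split=> ? ?; rewrite /T; lin; apply: linJ; lin.
have T_l h1 h2 h3 : trilin (T h1 h2 h3).
  by split=> ? ?; rewrite /T; lin; apply: linJ; lin.
transitivity (sws h (fun h1 c => sws l (fun l1 d => sws c (fun h2 h3 => sws d (fun l2 l3 =>
    T h1 h2 h3 l1 l2 l3))))).
  apply: eq_sws => h1 c; apply: eq_sws => l1 d.
  transitivity (J l1 * J h1 * sws c (fun a h' => sws d (fun b l' =>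
      inH a * inH b * J (h' * l')))); last first.
    rewrite (sws_linf hH c _ (lin_mulr _ (@lin_id _ E))); apply: eq_sws => a h'.
    rewrite (sws_linf hH d _ (lin_mulr _ (@lin_id _ E))); apply: eq_sws => b l'.
    by rewrite mulrA.
  congr (_ * _).
  transitivity (sws c (fun a h' => sws d (fun b l' => sws a (fun h2 h3 => sws b (fun l2 l3 =>
      inA (f (h2 \ox l2)) * (inH (h3 * l3) * J (h' * l'))))))); last first.
    apply: eq_sws => a h'; apply: eq_sws => b l'; rewrite inH_inH.
    rewrite (sws_linf hH a _ (lin_mull _ (@lin_id _ E))); apply: eq_sws => h2 h3.
    rewrite (sws_linf hH b _ (lin_mull _ (@lin_id _ E))); apply: eq_sws => l2 l3.
    by rewrite pureEE mulrA.
  rewrite swsA2; first last; try by move=> *; split=> ? ?; lin; apply: linJ; lin.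
  rewrite -(sws_counitr hH c (G := fun c => inA (f (c \ox d)))); last by lin.
  apply: eq_sws => h2 e.
  rewrite -(sws_counitr hH d (G := fun d => eps e *: inA (f (h2 \ox d)))); last by lin.
  apply: eq_sws => l2 e'; rewrite scalerA mulrC -epsM.
  have ml : linear (fun x => inA (f (h2 \ox l2)) * x) by lin.
  have := congr1 (fun x => inA (f (h2 \ox l2)) * x) (inH_invr (e * e')).
  rewrite (linfZ ml) mulr1 => <-.
  rewrite swsM; last by split=> ?; lin; apply: linJ; lin.
  rewrite (sws_linf hH e _ ml); apply: eq_sws => h3 h'.
  by rewrite (sws_linf hH e' _ ml).
rewrite -swsA2 //.
rewrite -[RHS](sws_counitl hH h (G := fun h => J (h * l))); last by apply: linJ; lin.
apply: eq_sws => a h'.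
rewrite -[RHS](sws_counitl hH l (G := fun l => eps a *: J (h' * l))); last first.
  by apply: lin_scale; apply: linJ; lin.
apply: eq_sws => b l'; rewrite sws_exchange.
have ml : linear (fun x => x * J (h' * l')) by lin.
transitivity (sws b (fun l1 l2 => eps a *: (J l1 * inH l2 * J (h' * l')))).
  apply: eq_sws => l1 l2.
  have nl : linear (fun x => J l1 * x * inH l2 * J (h' * l')) by lin.
  have := congr1 (fun x => J l1 * x * inH l2 * J (h' * l')) (inH_invl a).
  rewrite (linfZ nl) mulr1 => <-; rewrite (sws_linf hH a _ nl).
  by apply: eq_sws => h1 h2; rewrite /T !mulrA.
rewrite -scale_sws scalerA mulrC -scalerA; congr (_ *: _).
have := congr1 (fun x => x * J (h' * l')) (inH_invl b).
by rewrite (linfZ ml) mul1r => <-; rewrite (sws_linf hH b _ ml).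
Qed.

Lemma lin_inH_inv (U : lmodType k) (q : U -> H) :
  linear q -> linear (fun x => J (q x)).
Proof. exact: (lin_comp inH_inv_lin). Qed.

End Inverse.

Ltac lin_hook4 := fail.
Ltac lin_hook3 ::= match goal with
  | |- GRing.linear_for _ (inH_inv ?g ?wf) => exact: inH_inv_lin
  | |- GRing.linear_for _ (fun z => inH_inv ?g ?wf (@?f z)) =>
    apply: (lin_inH_inv g wf (q := f))
  | _ => lin_hook4
  end.

(** * The cyclic complex and the action of H *)

Section Restriction.
Variables (k : comNzRingType) (H : algType k) (hH : hopf H) (A : algType k).
Variables (w : weakAction hH A) (f : {linear tens H H -> A}) (wf : is_crossed w f).
Variable M : bimodule (crossed wf).

Definition res_l (a : A) (m : M) : M := bm_l (inA wf a) m.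
Definition res_r (m : M) (a : A) : M := bm_r m (inA wf a).

Lemma res_l_linl m : linear (res_l^~ m). Proof. by rewrite /res_l; lin. Qed.
Lemma res_l_linr a : linear (res_l a). Proof. by rewrite /res_l; lin. Qed.
Lemma res_r_linl a : linear (res_r^~ a). Proof. by rewrite /res_r; lin. Qed.
Lemma res_r_linr m : linear (res_r m). Proof. by rewrite /res_r; lin. Qed.
Lemma res_l1 m : res_l 1 m = m. Proof. exact: bm_l1. Qed.
Lemma res_r1 m : res_r m 1 = m. Proof. exact: bm_r1. Qed.
Lemma res_lA a b m : res_l (a * b) m = res_l a (res_l b m).
Proof. by rewrite /res_l inAM bm_lA. Qed.
Lemma res_rA m a b : res_r m (a * b) = res_r (res_r m a) b.
Proof. by rewrite /res_r inAM bm_rA. Qed.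
Lemma res_lrA a m b : res_r (res_l a m) b = res_l a (res_r m b).
Proof. exact: bm_lrA. Qed.

(** The letters, the balancing and the boundary of the cyclic complex involve M only as an
    A-bimodule, so words are taken over A. *)
Definition resA : bimodule A :=
  Bimodule res_l_linl res_l_linr res_r_linl res_r_linr res_l1 res_r1 res_lA res_rA res_lrA.

End Restriction.
Arguments resA {k H hH A w f wf} M.

Section CyclicFamily.
Variables (k : comNzRingType) (H : algType k) (hH : hopf H) (A : algType k).
Variables (w : weakAction hH A) (f : {linear tens H H -> A}) (wf : is_crossed w f).
Variables (M : bimodule (crossed wf)) (S : subalgClosed A).

Definition Sset : set A := [set a : A | a \in (S : {pred A})].

Definition cgen r (m : resA M) (s : seq A) : cobj (cyc M S) r :=
  cyc_gen S ((m, word r s) : cword M r).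

Lemma cgenE r m s : cgen r m s = cls (@cyc_rel _ _ _ _ w f wf M S r) (@tw_gen k A M r Sset m s).
Proof. by []. Qed.

Lemma cyc_gen_bal r (j : 'I_r.+1) (x : cword M r) s : s \in (S : {pred A}) ->
  cyc_gen S (crmul j x s) = cyc_gen S (clmul (ordS j) s x).
Proof. by move=> Ss; apply/clsE/spanp_sub; exact: CycRel. Qed.

(** Reads the uniform relation of [cyc_rel], from a position to its cyclic successor [ordS j], as
    the four clauses of [bal]. *)
Lemma cgen_bal r : bal Sset r (@cgen r).
Proof.
split.
- move=> m s1 s2 x s y sr Ss; rewrite /cgen.
  have lt1 : (size s1 < r)%N by rewrite -sr ltnS -addnS leq_addr.
  have lt2 : ((size s1).+1 < r)%N by rewrite -sr !ltnS leq_addr.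
  have := cyc_gen_bal (lift ord0 (Ordinal lt1)) (m, word r (s1 ++ x :: y :: s2)) Ss.
  have -> : ordS (lift ord0 (Ordinal lt1)) = lift ord0 (Ordinal lt2).
    by apply: val_inj; rewrite /= /bump !add1n modn_small // ltnS.
  rewrite /crmul /clmul !liftK /=.
  have -> : word r (s1 ++ x :: y :: s2) (Ordinal lt1) = x.
    by rewrite /word nth_cat ltnn subnn.
  have -> : word r (s1 ++ x :: y :: s2) (Ordinal lt2) = y.
    by rewrite /word nth_cat /= ltnNge leqnSn subSnn.
  have e1 v : upd (word r (s1 ++ x :: y :: s2)) (Ordinal lt1) v =
      word r (s1 ++ v :: y :: s2).
    have sr' : (size s1 + size (y :: s2)).+1 = r by rewrite /= addnS.
    rewrite [RHS](@word_upd k A r s1 (y :: s2) v (Ordinal lt1)) //.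
    rewrite (@word_upd k A r s1 (y :: s2) x (Ordinal lt1)) //.
    apply: functional_extensionality_dep => i.
    by rewrite /upd; case: eqP.
  have e2 v : upd (word r (s1 ++ x :: y :: s2)) (Ordinal lt2) v =
      word r (s1 ++ x :: v :: s2).
    have c z : s1 ++ x :: z :: s2 = rcons s1 x ++ z :: s2 by rewrite cat_rcons.
    have sr' : (size (rcons s1 x) + size s2).+1 = r by rewrite size_rcons.
    have iE : Ordinal lt2 = size (rcons s1 x) :> nat by rewrite size_rcons.
    rewrite !c [RHS](@word_upd k A r _ s2 v (Ordinal lt2)) //.
    rewrite (@word_upd k A r _ s2 y (Ordinal lt2)) //.
    apply: functional_extensionality_dep => i.
    by rewrite /upd; case: eqP.
  by rewrite e1 e2.
- move=> r0 m s Ss; rewrite /cgen; subst r.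
  have := cyc_gen_bal ord0 ((m, word 0 [::]) : cword M 0) Ss.
  have -> : ordS (ord0 : 'I_1) = ord0 by apply: val_inj; rewrite /= modnn.
  by rewrite /crmul /clmul unlift_none.
- move=> m s x t tr Ss; rewrite /cgen; subst r.
  have := cyc_gen_bal ord0 ((m, word (size t).+1 (x :: t)) : cword M (size t).+1) Ss.
  have -> : ordS (ord0 : 'I_(size t).+2) = lift ord0 ord0.
    by apply: val_inj; rewrite /= modn_small.
  rewrite /crmul /clmul unlift_none liftK /= => ->; congr (cyc_gen _ (_, _)).
  apply: functional_extensionality_dep => i; rewrite /upd /word.
  by case: (unliftP ord0 i) => [j ->|->].
- move=> m s x t tr Ss; rewrite /cgen; subst r.
  pose X : cword M (size t).+1 := (m, word (size t).+1 (rcons t x)).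
  have := cyc_gen_bal (lift ord0 ord_max) X Ss.
  have -> : ordS (lift ord0 (ord_max : 'I_(size t).+1)) = ord0.
    by apply: val_inj; rewrite /= /bump add1n modnn.
  rewrite /crmul /clmul unlift_none liftK /= => <-; congr (cyc_gen _ (_, _)).
  apply: functional_extensionality_dep => i; rewrite /upd /word.
  rewrite !nth_rcons ltnn eqxx; have [->|ni] := eqVneq i ord_max.
    by rewrite /= ltnn eqxx.
  by case: (ltngtP i (size t)) => // e; case/eqP: ni; apply: val_inj.
Qed.

Lemma cgen_good r : good Sset r (@cgen r).
Proof.
split; last exact: cgen_bal.
- move=> s sr; apply: lin_cls; exact: tw_gen_linl.
- move=> m s1 s2 sr; apply: lin_cls; exact: tw_gen_slin.
- move=> m s1 s2 x sr Sx; rewrite cgenE (tw_gen_svan _ sr Sx).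
  exact: linear0.
Qed.

(** The converse of [cgen_bal]: each relation of [cyc_rel] is one of the clauses of [bal], according
    to whether j is a letter with a successor, the last letter, or m with or without letters after
    it. *)
Lemma bal_crmul (W : lmodType k) r (phi : resA M -> seq A -> W) (j : 'I_r.+1)
    (x : cword M r) s : bal Sset r phi -> s \in (S : {pred A}) ->
  phi (crmul j x s).1 (letters (crmul j x s).2) =
  phi (clmul (ordS j) s x).1 (letters (clmul (ordS j) s x).2).
Proof.
case: x => m a [ps p0 pL pR] Ss; rewrite /crmul /clmul.
have sa := size_letters a.
have aE i : a i = nth 0 (letters a) i by rewrite nth_letters.
case: (unliftP ord0 j) => [i ->|->] /=.
  rewrite letters_upd aE.
  have li := ltn_ord i; have [lti|gei] := ltnP i.+1 r.
    have -> : ordS (lift ord0 i) = lift ord0 (Ordinal lti).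
      by apply: val_inj; rewrite /= /bump !add1n modn_small // ltnS.
    rewrite liftK /= letters_upd aE /=.
    rewrite (drop_nth 0) ?sa // (take_nth 0) ?sa // cat_rcons ps //.
    by rewrite size_take sa li size_drop sa -!addSn subnKC.
  have iE : i.+1 = r by apply/eqP; rewrite eqn_leq li.
  have -> : ordS (lift ord0 i) = ord0.
    by apply: val_inj; rewrite /= /bump add1n iE modnn.
  rewrite unlift_none /= drop_oversize ?sa // cats1 pR ?size_take ?sa ?li //.
  by rewrite -take_nth ?sa // take_oversize ?sa.
case: r phi j m a ps p0 pL pR sa aE => [|r] phi j m a ps p0 pL pR sa aE.
  have -> : ordS (ord0 : 'I_1) = ord0 by apply: val_inj; rewrite /= modnn.
  rewrite unlift_none /=; case: (letters a) sa => // _; exact: p0.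
have -> : ordS (ord0 : 'I_r.+2) = lift ord0 ord0.
  by apply: val_inj; rewrite /= modn_small.
rewrite liftK /= letters_upd aE /= take0 /=.
by case: (letters a) sa => // x t [tr]; rewrite /= drop0 pL // tr.
Qed.

Lemma cyc_fam : is_fam Sset cgen.
Proof.
split; first exact: cgen_good.
- move=> r W phi [pm pl pv pb].
  have [g gE] := tw_ext pm pl pv.
  have gC (x : cword M r) : g (cpure S x) = phi x.1 (letters x.2).
    by rewrite -gE ?size_letters // /tw_gen /wcls lettersK.
  have [|h hE] := @quotm_ext _ _ _ (@cyc_rel _ _ _ _ w f wf M S r) g.
    move=> _ [j x s Ss]; rewrite linearB !gC.
    by apply/eqP; rewrite subr_eq0; apply/eqP/bal_crmul.
  by exists h => m s sr; apply: etrans (hE _) (gE m s sr).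
- move=> r W h h' hh' x; elim/quotm_ind: x => x.
  pose Q := twT M Sset r.
  pose c (x : Q) := cls (@cyc_rel _ _ _ _ w f wf M S r) x.
  have hl : linear (fun x : Q => h (c x)) by rewrite /c; lin.
  have hl' : linear (fun x : Q => h' (c x)) by rewrite /c; lin.
  (* Hiding the bodies of the two maps keeps unification from unfolding them. *)
  have [F FE] : exists F : {linear Q -> W}, F =1 (fun x => h (c x)).
    by exists (mklin hl).
  have [F' FE'] : exists F : {linear Q -> W}, F =1 (fun x => h' (c x)).
    by exists (mklin hl').
  rewrite -[LHS](FE x) -[RHS](FE' x); apply: (@eq_tw k W A Sset M r F F') => m s sr.
  by rewrite FE FE'; move: (hh' m s sr); rewrite !cgenE; exact.
Qed.

Lemma cyc_diffE r m s : size s = r.+1 ->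
  cdiff (cyc M S) r (cgen r.+1 m s) = bd (cgen r) m s.
Proof.
move=> sr; pose F (m : resA M) (x : 'I_r -> A) : cobj (cyc M S) r :=
  cyc_gen S ((m, x) : cword M r).
rewrite -(wordK sr) -(bd_word F) wordK //.
apply: (linextE (gen := @cyc_gen _ _ _ _ w f wf M S r.+1) _ (m, word r.+1 s)).
have [g gE] := fam_diff_ex cyc_fam r.
exists g => -[m' x]; rewrite -[in LHS](lettersK x).
by rewrite (bd_word F); apply: gE; exact: size_letters.
Qed.

End CyclicFamily.

(** * The action of H on words *)

Section LetterAction.
Variables (k : comNzRingType) (H : algType k) (hH : hopf H) (A : algType k).
Variable w : weakAction hH A.
Local Notation sws := (sws hH).

Section Target.
Variable W : lmodType k.
Implicit Types (phi : seq A -> H -> W) (s t u : seq A).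

(* The legs h^(1), .., h^(n) act on the letters of s, and h^(n+1) is passed on. *)
Fixpoint actL (h : H) s phi : W :=
  if s is a :: t then sws h (fun x r => actL r t (fun u g => phi (w x a :: u) g))
  else phi [::] h.

Lemma eq_actL h s phi phi' :
  (forall u g, size u = size s -> phi u g = phi' u g) -> actL h s phi = actL h s phi'.
Proof.
elim: s h phi phi' => [|a s IHs] h phi phi' e /=; first exact: e.
by apply: eq_sws => x r; apply: IHs => u g su; apply: e; rewrite /= su.
Qed.

(** The bridge from the sum over [sw], which the definition of the action uses, to the recursion. *)
Lemma sw_actL h s phi :
  \sum_(y <- sw hH (size s) h) phi (mkseq (fun i => w y`_i s`_i) (size s)) y`_(size s)
  = actL h s phi.
Proof.
elim: s h phi => [|a s IHs] h phi; first by rewrite /= big_seq1.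
rewrite swS big_allpairs_dep /=; apply: eq_bigr => p _.
rewrite -IHs; apply: eq_bigr => y _; congr phi.
rewrite /mkseq /= -[1%N]/(1 + 0)%N iotaDl -map_comp.
by congr cons; apply: eq_map.
Qed.

Lemma actL_cat h s1 s2 phi :
  actL h (s1 ++ s2) phi = actL h s1 (fun u g => actL g s2 (fun v => phi (u ++ v))).
Proof. by elim: s1 h phi => [|a s1 IHs] h phi //=; apply: eq_sws => x r; rewrite IHs. Qed.

Lemma actL_rcons h s z phi :
  actL h (rcons s z) phi =
  actL h s (fun u g => sws g (fun y g' => phi (rcons u (w y z)) g')).
Proof.
rewrite -cats1 actL_cat; apply: eq_actL => u g _ /=.
by apply: eq_sws => y g'; rewrite cats1.
Qed.

Definition good_act n phi : Prop :=
  (forall g, slin n (phi^~ g)) /\ (forall u, size u = n -> linear (phi u)).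

Lemma good_act_cons n a phi :
  good_act n.+1 phi -> good_act n (fun u g => phi (a :: u) g).
Proof.
move=> [pl ph]; split=> [g|u un]; first exact: (@slin_cons _ _ A n (phi^~ g)).
by apply: ph; rewrite /= un.
Qed.

Lemma good_act_letter n phi t g : good_act n.+1 phi -> size t = n ->
  linear (fun a => phi (a :: t) g).
Proof. by move=> [pl _] tn; apply: (pl g [::]); rewrite /= add0n tn. Qed.

Lemma actL_lin_param (U : lmodType k) h s (F : U -> seq A -> H -> W) :
  (forall u g, size u = size s -> linear (fun z => F z u g)) ->
  linear (fun z => actL h s (F z)).
Proof.
elim: s h F => [|a s IHs] h F Fl /=; first exact: Fl.
apply: lin_sws1 => x r; apply: (IHs r (fun z u g => F z (w x a :: u) g)) => u g su.
by apply: Fl; rewrite /= su.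
Qed.

Lemma actL_linh s phi : good_act (size s) phi -> linear (fun h => actL h s phi).
Proof.
elim: s phi => [|a s IHs] phi pg /=; first by have [_] := pg; exact.
apply: sws_lin; split=> [r|x]; last exact/IHs/good_act_cons.
apply: (@actL_lin_param _ r s (fun x u g => phi (w x a :: u) g)) => u g su.
apply: (lin_comp (g := fun a => phi (a :: u) g)); last by lin.
exact: good_act_letter su.
Qed.

Lemma actL_slin h n phi : good_act n phi -> slin n (fun s => actL h s phi).
Proof.
move=> pg s1 s2 sn.
have -> : (fun x => actL h (s1 ++ x :: s2) phi) = (fun x =>
   actL h s1 (fun u g => actL g (x :: s2) (fun v => phi (u ++ v)))).
  by apply: functional_extensionality_dep => x; rewrite actL_cat.
apply: (@actL_lin_param _ h s1 (fun x u g => actL g (x :: s2) (fun v => phi (u ++ v)))).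
move=> u g su /=; apply: lin_sws1 => y r.
apply: (@actL_lin_param _ r s2 (fun x v g' => phi (u ++ w y x :: v) g')) => v g' sv.
apply: (lin_comp (g := fun a => phi (u ++ a :: v) g')); last by lin.
by have [pl _] := pg; apply: pl; rewrite su sv.
Qed.

Lemma good_act_cat n1 n2 phi u : good_act (n1 + n2) phi -> size u = n1 ->
  good_act n2 (fun v => phi (u ++ v)).
Proof.
move=> [pl ph] un; split=> [g s1 s2 sn|v vn].
  have e : (size (u ++ s1) + size s2).+1 = (n1 + n2)%N.
    by rewrite size_cat un -sn -addnA addnS.
  by have h := pl g _ _ e => c x y; have := h c x y; rewrite -!catA.
by apply: ph; rewrite size_cat un vn.
Qed.

Lemma actL_svan (S : set A) h n phi : (forall x a, S a -> S (w x a)) ->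
  (forall g, svan S n (phi^~ g)) -> svan S n (fun s => actL h s phi).
Proof.
move=> Sw pv s1 s2 x sn Sx; rewrite actL_cat.
rewrite (@eq_actL _ _ _ (fun _ _ => 0)) => [|u g su].
  elim: s1 h {sn} => [|a s1 IHs] h //=.
  by rewrite /sws big1 // => p _; exact: IHs.
rewrite /= /sws big1 // => p _.
rewrite (@eq_actL _ _ _ (fun _ _ => 0)) => [|v g' sv].
  by elim: (s2) p.2 => [|a s2' IHs] h' //=; rewrite /sws big1 // => q _; exact: IHs.
by apply: pv; [rewrite su sv | exact: Sw].
Qed.

Lemma actL_sws h s l (F : H -> H -> seq A -> H -> W) :
  actL h s (fun u g => sws l (fun x y => F x y u g)) =
  sws l (fun x y => actL h s (F x y)).
Proof.
elim: s h F => [|a s IHs] h F //=.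
transitivity (sws h (fun x r => sws l (fun x' y =>
    actL r s (fun u g => F x' y (w x a :: u) g)))).
  by apply: eq_sws => x r; rewrite IHs.
exact: sws_exchange.
Qed.

(** The letter (x s)^h splits as x^h1 s^h2 with s^h2 in S, which crosses over to y^h3; by
    coassociativity the result is (s y)^h2. *)
Lemma actL_sbal (S : set A) h n phi : (forall x a, S a -> S (w x a)) ->
  good_act n phi -> (forall g, sbal S n (phi^~ g)) -> sbal S n (fun s => actL h s phi).
Proof.
move=> Sw pg pb s1 s2 x s y sn Ss; rewrite !actL_cat; apply: eq_actL => u g su /=.
pose K p q r := actL r s2 (fun v => phi (u ++ p :: q :: v)).
have sz v : size v = size s2 -> (size u + (size v).+1).+1 = n.
  by move=> ->; rewrite su addnS.
(* The two letters around the tensor sign and the leg passed on enter linearly, so the rest of the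
   word can be hidden in one linear map. *)
have [G GE] : exists G : {linear tens A (tens A H) -> W},
    forall p q r, G (p \ox (q \ox r)) = K p q r.
  have [pl ph] := pg; apply: tens_ext3 => [q r|p r|p q].
  - apply: (@actL_lin_param _ r s2 (fun p v => phi (u ++ p :: q :: v))) => v g' sv.
    by apply: pl; exact: sz.
  - apply: (@actL_lin_param _ r s2 (fun q v => phi (u ++ p :: q :: v))) => v g' sv.
    have := pl g' (rcons u p) v; rewrite size_rcons addSnnS sz // => h0.
    by have := h0 erefl => l c y1 y2; have := l c y1 y2; rewrite !cat_rcons.
  - rewrite /K; have -> : (fun v => phi (u ++ p :: q :: v)) = (fun v => phi ((u ++ [:: p; q]) ++ v)).
      by apply: functional_extensionality_dep => v; rewrite -catA.
    apply: actL_linh; apply: (@good_act_cat (size u + 2)); last by rewrite size_cat.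
    by rewrite addn2 2!addSn su sn.
have GM a b c r : G ((w a x * w b s) \ox (w c y \ox r)) = G (w a x \ox ((w b s * w c y) \ox r)).
  by rewrite !GE; apply: eq_actL => v g' sv; apply: pb; [rewrite su sv | exact: Sw].
transitivity (sws g (fun a q => sws q (fun b r => sws r (fun c r' =>
    G ((w a x * w b s) \ox (w c y \ox r')))))).
  rewrite -(swsA hH g (F := fun a b r => sws r (fun c r' =>
    G ((w a x * w b s) \ox (w c y \ox r'))))); last by trilin.
  apply: eq_sws => a r; rewrite sws_exchange; apply: eq_sws => b r'.
  rewrite -[LHS](GE (w a (x * s)) (w b y) r') wM.
  have gl : linear (fun z => G (z \ox (w b y \ox r'))) by lin.
  by rewrite (sws_linf hH a _ gl).
apply: eq_sws => a q.
transitivity (sws q (fun b r => sws r (fun c r' =>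
    G (w a x \ox ((w b s * w c y) \ox r'))))).
  by apply: eq_sws => b r; apply: eq_sws => c r'; rewrite GM.
rewrite -(swsA hH q (F := fun b c r' => G (w a x \ox ((w b s * w c y) \ox r')))); last by trilin.
apply: eq_sws => c r'; rewrite -[RHS](GE (w a x) (w c (s * y)) r') wM.
have gl : linear (fun z => G (w a x \ox (z \ox r'))) by lin.
by rewrite (sws_linf hH c _ gl).
Qed.

Lemma swsB h (b b' : H -> H -> W) :
  sws h (fun x y => b x y - b' x y) = sws h b - sws h b'.
Proof. exact: sumrB. Qed.

Lemma swsD h (b b' : H -> H -> W) :
  sws h (fun x y => b x y + b' x y) = sws h b + sws h b'.
Proof. exact: big_split. Qed.

Lemma actLD h s phi phi' :
  actL h s (fun u g => phi u g + phi' u g) = actL h s phi + actL h s phi'.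
Proof.
elim: s h phi phi' => [|a s IHs] h phi phi' //=.
by rewrite -swsD; apply: eq_sws => x r; rewrite IHs.
Qed.

Lemma actLB h s phi phi' :
  actL h s (fun u g => phi u g - phi' u g) = actL h s phi - actL h s phi'.
Proof.
elim: s h phi phi' => [|a s IHs] h phi phi' //=.
by rewrite -swsB; apply: eq_sws => x r; rewrite IHs.
Qed.

Lemma mid_sws h s (F : H -> H -> seq A -> W) :
  mid s (fun u => sws h (fun x y => F x y u)) = sws h (fun x y => mid s (F x y)).
Proof.
elim: s F => [|a [|b t] IHs] F; try by rewrite /= /sws big1.
by rewrite mid_cons (IHs (fun x y u => F x y (a :: u))) -swsB.
Qed.

Lemma actL_pair n t phi : good_act n.+1 phi -> size t = n ->
  exists G : {linear tens A H -> W}, forall p r,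
    G (p \ox r) = actL r t (fun u g => phi (p :: u) g).
Proof.
move=> pg tn; apply: (tens_ext2 (b := fun p r => actL r t (fun u g => phi (p :: u) g))).
  move=> r; apply: (@actL_lin_param _ r t (fun p u g => phi (p :: u) g)) => u g su.
  by apply: good_act_letter pg _; rewrite su.
by move=> p; apply: actL_linh; rewrite tn; exact: good_act_cons.
Qed.

Lemma actL_mul n h x y t phi : good_act n.+1 phi -> size t = n ->
  sws h (fun a r => sws r (fun b r' => actL r' t (fun u g => phi (w a x * w b y :: u) g)))
  = actL h (x * y :: t) phi.
Proof.
move=> pg tn; have [G GE] := actL_pair pg tn.
transitivity (sws h (fun a r => sws r (fun b r' => G ((w a x * w b y) \ox r')))).
  by apply: eq_sws => a r; apply: eq_sws => b r'; rewrite GE.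
rewrite -(swsA hH h (F := fun a b r' => G ((w a x * w b y) \ox r'))); last by trilin.
apply: eq_sws => a r; rewrite -[RHS]GE wM.
have gl : linear (fun z => G (z \ox r)) by lin.
by rewrite (sws_linf hH a _ gl).
Qed.

(** Merging two letters commutes with the action because (x y)^h = x^h1 y^h2, and the later legs are
    passed on unchanged. *)
Lemma actL_mid h n s phi : size s = n.+1 -> good_act n phi ->
  actL h s (fun u g => mid u (phi^~ g)) = mid s (fun u => actL h u phi).
Proof.
elim: s n h phi => [|x [|y t] IHs] // n h phi [tn] pg.
  by rewrite /= /sws big1.
case: n tn pg => [|n] // [tn] pg.
rewrite [RHS]mid_cons -(actL_mul h x y pg tn).
have -> : mid (y :: t) (fun u => actL h (x :: u) phi) =
    sws h (fun a r => actL r (y :: t) (fun u g => mid u (fun v => phi (w a x :: v) g))).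
  rewrite [LHS](mid_sws h (y :: t) (fun a r u => actL r u (fun v g => phi (w a x :: v) g))).
  apply: eq_sws => a r.
  rewrite -(IHs n r (fun v g => phi (w a x :: v) g)) //=; first by rewrite tn.
  exact: good_act_cons.
rewrite -swsB; apply: eq_sws => a r /=; rewrite -swsB.
by apply: eq_sws => b r'; rewrite -actLB.
Qed.

End Target.
End LetterAction.

Section Passing.
Variables (k : comNzRingType) (H : algType k) (hH : hopf H) (A : algType k).
Variables (w : weakAction hH A) (f g : {linear tens H H -> A}) (wf : is_crossed w f).
Hypothesis f_g : conv_inverse hH f g.
Variable S : set A.
Hypotheses (Sw : forall h a, S a -> S (w h a)) (fS : forall h l, S (f (h \ox l))).
Local Notation E := (crossed wf).
Local Notation sws := (sws hH).
Local Notation J := (inH_inv g wf).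
Local Notation inA := (inA wf).
Local Notation inH := (inH wf).
Variable W : lmodType k.

(** Functionals on a word with an extra slot e in E behind it, into which S can cross from the last
    letter. The slot receives the factor 1 # h that multiplies m on the left, cyclically the
    neighbour of the last letter. *)
Definition goodE n (L : seq A -> E -> W) : Prop :=
  [/\ forall e, slin n (L^~ e), forall s, size s = n -> linear (L s),
      forall e, sbal S n (L^~ e) &
      forall s x t e, (size s).+1 = n -> S t ->
        L (rcons s (x * t)) e = L (rcons s x) (inA t * e)].

Lemma goodE_cons n b L : goodE n.+1 L -> goodE n (fun s => L (b :: s)).
Proof.
move=> [pl pe pb pr]; split=> [e|s sn|e|s x t e sn St].
- exact: (@slin_cons _ _ A n (L^~ e)).
- by apply: pe; rewrite /= sn.
- exact: (@sbal_cons _ _ _ _ n (L^~ e)).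
- by rewrite -!rcons_cons pr //= sn.
Qed.

Lemma goodE_act n L : goodE n L -> good_act n (fun u x => L u (inH x)).
Proof.
move=> [pl pe _ _]; split=> [x|u un]; first exact: pl.
by apply: (lin_comp (g := L u)); [exact: pe | lin].
Qed.

(** Acting by r and then by q leaves a value of f in (1 # q)(1 # r). By induction on the word this
    value travels from the end to b: [twisted] exchanges it with a letter, and balancing over S,
    where f takes its values, carries it across the next tensor. The letters are then acted on by
    the product. *)
Lemma actL_pass n q r b s L : goodE n.+1 L -> size s = n ->
  actL w r s (fun u y => actL w q u (fun v x => L (b :: v) (inH x * inH y))) =
  sws q (fun q1 c => sws r (fun r1 d =>
    actL w (c * d) s (fun v x => L (b * f (q1 \ox r1) :: v) (inH x)))).
Proof.
elim: s n q r b L => [|a s IHs] [|n] q r b L // pg => [_|[sn]].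
  have [pl pe pb pr] := pg.
  rewrite /= inH_inH (sws_linf hH q _ (pe [:: b] erefl)); apply: eq_sws => q1 c.
  rewrite (sws_linf hH r _ (pe [:: b] erefl)); apply: eq_sws => r1 d.
  by rewrite pureEE; have := pr [::] b (f (q1 \ox r1)) (inH (c * d)) erefl (fS _ _).
have pg' := goodE_cons b pg.
have [G GE] := actL_pair w (goodE_act pg') sn.
transitivity (sws q (fun q1 q' => sws r (fun r1 r' => sws q' (fun q2 c =>
    sws r' (fun r2 d => G ((w q1 (w r1 a) * f (q2 \ox r2)) \ox (c * d))))))).
  rewrite /= sws_exchange; apply: eq_sws => r1 r'.
  transitivity (actL w r' s (fun u y => sws q (fun q1 q' =>
      actL w q' u (fun v x => L [:: b, w q1 (w r1 a) & v] (inH x * inH y))))) => //.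
  rewrite actL_sws; apply: eq_sws => q1 q'.
  rewrite (IHs n q' r' _ _ pg' sn); apply: eq_sws => q2 c; apply: eq_sws => r2 d.
  by rewrite GE.
rewrite -swsA2; first last; try by move=> *; trilin.
transitivity (sws q (fun e c => sws r (fun e' d => sws e (fun q1 q2 => sws e' (fun r1 r2 =>
    G ((f (q1 \ox r1) * w (q2 * r2) a) \ox (c * d))))))).
  apply: eq_sws => e c; apply: eq_sws => e' d.
  have gl : linear (fun z => G (z \ox (c * d))) by lin.
  have := congr1 (fun z => G (z \ox (c * d))) (twisted wf a e e').
  rewrite (sws_linf hH e _ gl) (sws_linf hH e _ gl) => h0; apply: etrans (etrans _ h0) _.
    by apply: eq_sws => q1 q2; rewrite (sws_linf hH e' _ gl).
  by apply: eq_sws => q1 q2; rewrite (sws_linf hH e' _ gl).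
rewrite swsA2; first last; try by move=> *; trilin.
apply: eq_sws => q1 c'; apply: eq_sws => r1 d' /=.
transitivity (sws (c' * d') (fun z y => G ((f (q1 \ox r1) * w z a) \ox y))).
  by rewrite swsM //; bilin.
apply: eq_sws => z y; rewrite GE; apply: eq_actL => v x sv.
have [pl pe pb pr] := pg.
by rewrite (pb _ [::] v) //= sv sn.
Qed.

Variable M : bimodule E.
Local Notation N := (resA M).
Variable n : nat.
Variable phi : N -> seq A -> W.
Hypothesis phi_good : good S n phi.

Definition actF (h : H) (m : N) (s : seq A) : W :=
  sws h (fun x r => actL w r s (fun u y => phi (bm_l (inH y) (bm_r (m : M) (J x))) u)).

Lemma phi_act m : good_act n (fun u y => phi (bm_l (inH y) m) u).
Proof.
have [pm pl _ _] := phi_good; split=> [y|u un]; first exact: pl.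
by apply: (lin_comp (g := fun m => phi m u)); [exact: pm | lin].
Qed.

Lemma phi_tri s : size s = n -> exists G : {linear tens M H -> W},
  forall m r, G (m \ox r) = actL w r s (fun u y => phi (bm_l (inH y) m) u).
Proof.
move=> sn; apply: (tens_ext2 (b := fun m r =>
    actL w r s (fun u y => phi (bm_l (inH y) m) u))).
  move=> r; apply: (@actL_lin_param _ _ _ _ w _ _ r s (fun m u y => phi (bm_l (inH y) m) u)).
  move=> u y su; apply: (lin_comp (g := fun m => phi m u)); last by lin.
  by have [pm _ _ _] := phi_good; apply: pm; rewrite su.
move=> m; apply: actL_linh; rewrite sn; exact: phi_act.
Qed.

(** The rule [inA_inv] inside M: a factor t next to m comes out on the far right as t^z2, ready to
    be balanced into the first letter. *)
Lemma res_inv (m : N) t z :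
  bm_r (bm_r m t : M) (J z) =
  sws z (fun p1 p2 => bm_r (bm_r (m : M) (J p1)) (inA (w p2 t))).
Proof.
rewrite -[bm_r m t]/(bm_r (m : M) (inA t)) -bm_rA (inA_inv wf f_g).
rewrite (sws_linf hH z _ (@bm_r_linr _ _ M m)); apply: eq_sws => p1 p2.
by rewrite bm_rA.
Qed.

Lemma actF_bal0 h m t : n = 0%N -> S t -> actF h (bm_r m t) [::] = actF h (bm_l t m) [::].
Proof.
move=> n0 St; have [pm _ _ [_ p0 _ _]] := phi_good.
have [P PE] : exists P : {linear M -> W}, forall m, P m = phi m [::].
  by have pl := pm [::] (esym n0); exists (mklin pl).
transitivity (sws h (fun z r => sws z (fun p1 p2 =>
    P (bm_l (inA (w p2 t) * inH r) (bm_r (m : M) (J p1)))))).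
  apply: eq_sws => z r; rewrite /= res_inv -PE.
  rewrite (sws_linf hH z _ (@bm_l_linr _ _ M (inH r))) (sws_linf hH z _ (linearP P)).
  apply: eq_sws => p1 p2; rewrite -bm_lrA !PE bm_lA.
  by apply: p0 => //; exact: Sw.
rewrite (swsA hH h (F := fun p1 p2 r =>
    P (bm_l (inA (w p2 t) * inH r) (bm_r (m : M) (J p1))))); last by trilin.
apply: eq_sws => p1 q /=; rewrite -PE.
have -> : bm_r (bm_l t m : M) (J p1) = bm_l (inA t) (bm_r (m : M) (J p1)) by exact: bm_lrA.
rewrite -bm_lA inH_inA.
have hl : linear (fun e => P (bm_l e (bm_r (m : M) (J p1)))) by lin.
by rewrite (sws_linf hH q _ hl).
Qed.

Lemma actF_left h m t x s : (size s).+1 = n -> S t ->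
  actF h (bm_r m t) (x :: s) = actF h m (t * x :: s).
Proof.
move=> sn St; have [pm pl _ [_ _ pL _]] := phi_good.
have [G GE] : exists G : {linear tens M (tens A H) -> W}, forall m0 p r,
    G (m0 \ox (p \ox r)) = actL w r s (fun u y => phi (bm_l (inH y) m0) (p :: u)).
  apply: tens_ext3 => [p r|m0 r|m0 p].
  - apply: (@actL_lin_param _ _ _ _ w _ _ r s
      (fun m0 u y => phi (bm_l (inH y) m0) (p :: u))) => u y su.
    apply: (lin_comp (g := fun m => phi m (p :: u))); last by lin.
    by apply: pm; rewrite /= su.
  - apply: (@actL_lin_param _ _ _ _ w _ _ r s
      (fun p u y => phi (bm_l (inH y) m0) (p :: u))) => u y su.
    by apply: (pl _ [::] u); rewrite /= add0n su.
  - apply: actL_linh; have pg := phi_act m0; rewrite -sn in pg.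
    exact: (good_act_cons p pg).
have GL m0 t' p r : S t' -> G (bm_r m0 (inA t') \ox (p \ox r)) =
    G (m0 \ox ((t' * p) \ox r)).
  move=> St'; rewrite !GE; apply: eq_actL => u y su; rewrite -bm_lrA.
  by apply: pL; rewrite ?su.
transitivity (sws h (fun z r => sws z (fun p1 p2 => sws r (fun a r' =>
    G (bm_r (m : M) (J p1) \ox ((w p2 t * w a x) \ox r')))))).
  apply: eq_sws => z r /=; rewrite sws_exchange; apply: eq_sws => a r'.
  rewrite -GE res_inv.
  have hl : linear (fun m0 => G (m0 \ox (w a x \ox r'))) by lin.
  by rewrite (sws_linf hH z _ hl); apply: eq_sws => p1 p2; rewrite GL //; exact: Sw.
rewrite (swsA hH h (F := fun p1 p2 r => sws r (fun a r' =>
    G (bm_r (m : M) (J p1) \ox ((w p2 t * w a x) \ox r'))))); last by trilin.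
apply: eq_sws => p1 q.
rewrite -(swsA hH q (F := fun p2 a r' =>
    G (bm_r (m : M) (J p1) \ox ((w p2 t * w a x) \ox r')))); last by trilin.
apply: eq_sws => c r'.
transitivity (G (bm_r (m : M) (J p1) \ox (w c (t * x) \ox r'))); last exact: GE.
rewrite wM.
have hl : linear (fun p => G (bm_r (m : M) (J p1) \ox (p \ox r'))) by lin.
by rewrite (sws_linf hH c _ hl).
Qed.

(** The last letter (x t)^y is x^y1 t^y2, and t^y2 crosses to the left of m, where t^y2 (1 # y3)
    recombines to (1 # y2) t. *)
Lemma actF_right h m t x s : (size s).+1 = n -> S t ->
  actF h m (rcons s (x * t)) = actF h (bm_l t m) (rcons s x).
Proof.
move=> sn St; have [pm pl _ [_ _ _ pR]] := phi_good.
apply: eq_sws => z r; rewrite !actL_rcons; apply: eq_actL => u y su.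
have -> : bm_r (bm_l t m : M) (J z) = bm_l (inA t) (bm_r (m : M) (J z)) by exact: bm_lrA.
set m0 := bm_r (m : M) (J z).
have [G GE] : exists G : {linear tens E A -> W}, forall e p,
    G (e \ox p) = phi (bm_l e m0) (rcons u p).
  apply: (tens_ext2 (b := fun e p => phi (bm_l e m0) (rcons u p))) => [p|e].
    apply: (lin_comp (g := fun m => phi m (rcons u p))); last by lin.
    by apply: pm; rewrite size_rcons su.
  have := pl (bm_l e m0) u [::]; rewrite addn0 su => /(_ sn) h0 c a b.
  by have := h0 c a b; rewrite !cats1.
have GR e p t' : S t' -> G (e \ox (p * t')) = G ((inA t' * e) \ox p).
  by move=> St'; rewrite !GE bm_lA; apply: pR; rewrite ?su.
transitivity (sws y (fun a y' => sws a (fun a1 a2 =>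
    G ((inA (w a2 t) * inH y') \ox w a1 x)))).
  apply: eq_sws => a y'; rewrite -GE wM.
  have hl : linear (fun p => G (inH y' \ox p)) by lin.
  by rewrite (sws_linf hH a _ hl); apply: eq_sws => a1 a2; rewrite GR //; exact: Sw.
rewrite (swsA hH y (F := fun a1 a2 y' =>
    G ((inA (w a2 t) * inH y') \ox w a1 x))); last by trilin.
apply: eq_sws => a1 q; rewrite -bm_lA -GE inH_inA.
have hl : linear (fun e => G (e \ox w a1 x)) by lin.
by rewrite (sws_linf hH q _ hl).
Qed.

(** So each h acts on the balanced quotient. Stability of S enters here, since a factor from S is
    acted on before it crosses a tensor. *)
Lemma actF_good h : good S n (actF h).
Proof.
have [pm pl pv [ps p0 pL pR]] := phi_good; split; last split.
- move=> s sn; have [G GE] := phi_tri sn.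
  have hl : linear (fun m : M => sws h (fun x r => G (bm_r m (J x) \ox r))) by lin.
  move=> c m m'; have := hl c m m'; rewrite /actF.
  have e (m0 : M) : sws h (fun x r => G (bm_r m0 (J x) \ox r)) = actF h m0 s.
    by apply: eq_sws => x r; rewrite GE.
  by rewrite !e.
- move=> m s1 s2 sn; apply: lin_sws1 => x r.
  exact: (actL_slin w r (phi_act (bm_r (m : M) (J x)))) sn.
- move=> m s1 s2 x sn Sx; rewrite /actF /sws big1 // => p _.
  apply: (@actL_svan _ _ _ _ w _ S _ n _ Sw) => // y; exact: pv.
- move=> m s1 s2 x s y sn Ss; apply: eq_sws => z r.
  by apply: (actL_sbal r Sw (phi_act (bm_r (m : M) (J z)))) => // y'; exact: ps.
- by move=> n0 m s Ss; exact: actF_bal0.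
- by move=> m s x t tn Ss; exact: actF_left.
- by move=> m s x t tn Ss; exact: actF_right.
Qed.

End Passing.

Section ActionTheory.
Variables (k : comNzRingType) (H : algType k) (hH : hopf H) (A : algType k).
Variables (w : weakAction hH A) (f g : {linear tens H H -> A}) (wf : is_crossed w f).
Hypothesis f_g : conv_inverse hH f g.
Variable S : set A.
Hypotheses (Sw : forall h a, S a -> S (w h a)) (fS : forall h l, S (f (h \ox l))).
Local Notation E := (crossed wf).
Local Notation sws := (sws hH).
Local Notation J := (inH_inv g wf).
Local Notation inA := (inA wf).
Local Notation inH := (inH wf).

Lemma actL_linf (W W' : lmodType k) (q : W -> W') h s (phi : seq A -> H -> W) :
  linear q -> q (actL w h s phi) = actL w h s (fun u y => q (phi u y)).
Proof.
move=> ql; elim: s h phi => [|a s IHs] h phi //=.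
by rewrite (sws_linf hH h _ ql); apply: eq_sws => x r; rewrite IHs.
Qed.

Lemma actL1 (W : lmodType k) n s (phi : seq A -> H -> W) : good_act n phi ->
  size s = n -> actL w 1 s phi = phi s 1.
Proof.
elim: s n phi => [|a s IHs] [|n] phi pg // [sn].
have [G GE] := actL_pair w pg sn.
transitivity (sws 1 (fun x r => G (w x a \ox r))).
  by apply: eq_sws => x r; rewrite GE.
rewrite sws1; last by bilin.
rewrite GE wact_1l (IHs n (fun u => phi (a :: u))) //; exact: good_act_cons.
Qed.

Variable M : bimodule E.
Local Notation N := (resA M).

Section OneTarget.
Variables (W : lmodType k) (n : nat) (phi : N -> seq A -> W).
Hypothesis phi_good : good S n phi.
Local Notation actphi := (@actF k H hH A w f g wf W M phi).

Lemma actFE s : size s = n -> exists G : {linear tens M H -> W},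
  (forall m r, G (m \ox r) = actL w r s (fun u y => phi (bm_l (inH y) m) u)) /\
  forall h m, actphi h m s = sws h (fun x r => G (bm_r (m : M) (J x) \ox r)).
Proof.
move=> sn; have [G GE] := phi_tri phi_good sn; exists G; split=> // h m.
by apply: eq_sws => x r; rewrite GE.
Qed.

Lemma actF_linh m s : size s = n -> linear (fun h => actphi h m s).
Proof.
move=> sn; have [G [_ aE]] := actFE sn => c h h'; rewrite !aE.
have hl : linear (fun h => sws h (fun x r => G (bm_r (m : M) (J x) \ox r))) by lin.
exact: hl.
Qed.

Lemma actF1 m s : size s = n -> actphi 1 m s = phi m s.
Proof.
move=> sn; have [G [GE aE]] := actFE sn; rewrite aE sws1; last by bilin.
rewrite GE (actL1 (phi_act phi_good _) sn) inH1 bm_l1.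
by rewrite (inH_inv1 wf f_g) bm_r1.
Qed.

(** The first letter b multiplies m on the right; in this way the value of f that [actL_pass] leaves
    at b lands next to m. *)
Definition slotE (m : M) (s : seq A) (e : E) : W :=
  if s is b :: v then phi (bm_l e (bm_r m (inA b))) v else 0.

Lemma slotE_good m : goodE S n.+1 (slotE m).
Proof.
have [pm pl _ [ps p0 pL pR]] := phi_good; split=> [e s1 s2|[|b v] // [vn]|e s1 s2|s x t e].
- case: s1 => [|b s1] /= [sn].
    by apply: (lin_comp (g := fun m => phi m s2)); [exact: pm | lin].
  exact: pl.
- by apply: (lin_comp (g := fun m => phi m v)); [exact: pm | lin].
- case: s1 => [|b s1] x t y /= [sn] St; last exact: ps.
  rewrite inAM bm_rA -bm_lrA; exact: pL.
- case: s => [|b s] /= [sn] St; last by rewrite pR // bm_lA.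
  by rewrite inAM bm_rA -bm_lrA p0 // bm_lA.
Qed.

(** [actL_pass] with b = 1 brings f to the right of m, behind the inverses of 1 # l1 and 1 # h1;
    [inH_inv_mul] merges the three into the inverse belonging to h l. *)
Lemma actF_mul (a : {linear W -> W}) h l m s :
  (forall m s, size s = n -> a (phi m s) = actphi h m s) -> size s = n ->
  a (actphi l m s) = actphi (h * l) m s.
Proof.
move=> aE sn; have [G [GE acE]] := actFE sn.
transitivity (sws l (fun x r => sws h (fun z q => actL w r s (fun u y => actL w q u
    (fun v y' => slotE (bm_r (m : M) (J x * J z)) (1 :: v) (inH y' * inH y)))))).
  rewrite (sws_linf hH l _ (linearP a)); apply: eq_sws => x r.
  rewrite (actL_linf _ _ _ (linearP a)) -actL_sws; apply: eq_actL => u y su.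
  rewrite aE ?su //; apply: eq_sws => z q; apply: eq_actL => v y' sv /=.
  by rewrite bm_r1 bm_lA bm_rA bm_lrA.
transitivity (sws h (fun z q => sws l (fun x r => sws q (fun q1 c => sws r (fun r1 d =>
    G (bm_r (m : M) (J x * J z * inA (f (q1 \ox r1))) \ox (c * d))))))).
  rewrite sws_exchange; apply: eq_sws => z q; apply: eq_sws => x r.
  rewrite (actL_pass fS q r 1 (slotE_good (bm_r (m : M) (J x * J z))) sn).
  apply: eq_sws => q1 c; apply: eq_sws => r1 d; rewrite GE.
  by apply: eq_actL => v y sv; rewrite /= mul1r -bm_rA.
rewrite -swsA2; first last; try by move=> *; trilin.
rewrite acE swsM; last by bilin.
apply: eq_sws => e c; apply: eq_sws => e' d.
rewrite -(inH_inv_mul wf f_g).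
have hl : linear (fun z => G (bm_r (m : M) z \ox (c * d))) by lin.
rewrite (sws_linf hH e _ hl); apply: eq_sws => z q1.
by rewrite (sws_linf hH e' _ hl).
Qed.

(** The first face uses a (1 # h)^-1 = (1 # h1)^-1 a^h2, the inner faces multiplicativity of the
    weak action, the last face (1 # h) a = a^h1 (1 # h2). The order of the legs in the action is
    made for this. *)
Lemma actF_bd h m s : size s = n.+1 ->
  actF g (bd phi) h m s = bd (actphi h) m s.
Proof.
move=> sn; have [pm pl _ _] := phi_good.
pose T1 := sws h (fun x r => actL w r s (fun u y =>
  fst_face phi (bm_l (inH y) (bm_r (m : M) (J x))) u)).
pose T2 := sws h (fun x r => actL w r s (fun u y =>
  mid u (phi (bm_l (inH y) (bm_r (m : M) (J x)))))).
pose T3 := sws h (fun x r => actL w r s (fun u y =>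
  (-1) ^+ n.+1 *: lst_face phi (bm_l (inH y) (bm_r (m : M) (J x))) u)).
have -> : actF g (bd phi) h m s = T1 - T2 + T3.
  rewrite /T1 /T2 /T3 -swsB -swsD; apply: eq_sws => x r; rewrite -actLB -actLD.
  by apply: eq_actL => u y su; rewrite /bd su sn.
rewrite /bd sn; congr (_ - _ + _).
- rewrite /T1 {T1 T2 T3}; case: s sn => [|a t] [tn] //; rewrite [fst_face _ _ (a :: t)]/=.
  have [G [GE aE]] := actFE tn; rewrite aE.
  transitivity (sws h (fun x r => sws r (fun b r' =>
      G (bm_r (m : M) (J x * inA (w b a)) \ox r')))).
    apply: eq_sws => x r; apply: eq_sws => b r'; rewrite GE; apply: eq_actL => u y su.
    by rewrite /= bm_rA; congr (phi _ _); exact: (@bm_lrA _ _ M).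
  rewrite -(swsA hH h (F := fun x b r' =>
      G (bm_r (m : M) (J x * inA (w b a)) \ox r'))); last by trilin.
  apply: eq_sws => c r'.
  have hl : linear (fun z => G (bm_r (m : M) z \ox r')) by lin.
  have -> : bm_r (bm_r m a : M) (J c) = bm_r (m : M) (inA a * J c) by rewrite bm_rA.
  by rewrite (inA_inv wf f_g) (sws_linf hH c _ hl).
- rewrite (mid_sws hH h s (fun x r u => actL w r u (fun v y =>
    phi (bm_l (inH y) (bm_r (m : M) (J x))) v))).
  apply: eq_sws => x r.
  exact: (actL_mid w r sn (phi_act phi_good (bm_r (m : M) (J x)))).
- rewrite /T3 {T1 T2 T3}; case/lastP: s sn => [|t z] //; rewrite size_rcons => -[tn].
  rewrite lst_face_rcons /actF scale_sws; apply: eq_sws => x r.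
  rewrite (actL_linf _ _ _ (lin_scale _ (@lin_id _ W))) actL_rcons.
  apply: eq_actL => u y su; rewrite -scale_sws; congr (_ *: _).
  have pl0 := pm u (etrans su tn).
  have -> : bm_r (bm_l z m : M) (J x) = bm_l (inA z) (bm_r (m : M) (J x)) by exact: bm_lrA.
  rewrite -bm_lA inH_inA.
  have hl : linear (fun e => phi (bm_l e (bm_r (m : M) (J x))) u).
    by apply: (lin_comp (g := fun m => phi m u)); [exact: pl0 | lin].
  rewrite (sws_linf hH y _ hl); apply: eq_sws => b y'.
  by rewrite lst_face_rcons bm_lA.
Qed.

End OneTarget.

Lemma actF_map (W W' : lmodType k) (M' : bimodule E) (phi : N -> seq A -> W)
    (phi' : resA M' -> seq A -> W') (q : M -> M') (a : {linear W -> W'}) h m s :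
  is_bmor q -> (forall m t, size t = size s -> a (phi m t) = phi' (q m) t) ->
  a (actF g phi h m s) = actF g phi' h (q m) s.
Proof.
move=> [ql qr] aE; rewrite (sws_linf hH h _ (linearP a)); apply: eq_sws => x r.
rewrite (actL_linf _ _ _ (linearP a)); apply: eq_actL => u y su.
by rewrite aE // ql qr.
Qed.

End ActionTheory.

Section CyclicAction.
Variables (k : comNzRingType) (H : algType k) (hH : hopf H) (A : algType k).
Variables (w : weakAction hH A) (f g : {linear tens H H -> A}) (wf : is_crossed w f).
Hypothesis f_g : conv_inverse hH f g.
Variable S : subalgClosed A.
Hypothesis S_stable : forall (h : H) (a : A), a \in S -> w h a \in S.
Hypothesis fS : forall h l : H, f (h \ox l) \in S.
Local Notation E := (crossed wf).

Lemma Sset_stable h a : Sset S a -> Sset S (w h a).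
Proof. exact: S_stable. Qed.
Lemma Sset_f h l : Sset S (f (h \ox l)).
Proof. exact: fS. Qed.

Section OneModule.
Variable M : bimodule E.
Local Notation C := (cyc M S).
Local Notation cgen := (cgen S).

(** [cyc_act] is a [linext]; that its formula respects the relations is [actF_good]. *)
Lemma cyc_actE r h m s : size s = r ->
  cyc_act g M S r h (cgen r m s) = actF g (cgen r) h m s.
Proof.
move=> sr; rewrite -[in RHS](wordK sr).
have phiE (m' : M) (a : 'I_r -> A) :
    \sum_(y <- sw hH r.+1 h) cyc_gen S
      ((bm_l (inH wf y`_(r.+1)) (bm_r m' (inH_inv g wf y`_0)),
       fun i : 'I_r => w y`_(i.+1) (a i)) : cword M r) =
    actF g (cgen r) h m' (letters a).
  rewrite swS big_allpairs_dep; apply: eq_bigr => p _.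
  rewrite -sw_actL size_letters; apply: eq_bigr => y _ /=.
  congr (cyc_gen _ (_, _)); apply: functional_extensionality_dep => i.
  by rewrite /word nth_mkseq // nth_letters.
rewrite -phiE; apply: (linextE (gen := @cyc_gen _ _ _ _ w f wf M S r) _ (m, word r s)).
have [G GE] := fam_ext (cyc_fam M S) (actF_good f_g Sset_stable (cgen_good M S r) h).
exists G => -[m' a]; rewrite -[in LHS](lettersK a) phiE.
by apply: GE; exact: size_letters.
Qed.

Lemma cyc_act_linh r c : linear (fun h => cyc_act g M S r h c : cobj C r).
Proof.
move=> e h h'; move: c.
have hl : linear (fun c => e *: cyc_act g M S r h c + cyc_act g M S r h' c) by lin.
apply: (fam_eq (cyc_fam M S) (h := cyc_act g M S r (e *: h + h')) (h' := mklin hl)).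
move=> m s sr; rewrite -[RHS]/(e *: _ + _) !cyc_actE //.
exact: (actF_linh g (cgen_good M S r)).
Qed.

Lemma cyc_act1 r c : cyc_act g M S r 1 c = c.
Proof.
apply: (fam_eq (cyc_fam M S) (h := cyc_act g M S r 1) (h' := idfun)) => m s sr.
by rewrite cyc_actE // (actF1 f_g (cgen_good M S r)).
Qed.

Lemma cyc_actM r h l c :
  cyc_act g M S r (h * l) c = cyc_act g M S r h (cyc_act g M S r l c).
Proof.
have hl : linear (fun c => cyc_act g M S r h (cyc_act g M S r l c)) by lin.
apply: (fam_eq (cyc_fam M S) (h := cyc_act g M S r (h * l)) (h' := mklin hl)) => m s sr.
rewrite -[RHS]/(cyc_act g M S r h _) !cyc_actE //.
apply: esym; apply: (actF_mul f_g Sset_f (cgen_good M S r)) => // m' s' sr'.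
exact: cyc_actE.
Qed.

Lemma cyc_act_chain r h c :
  cdiff C r (cyc_act g M S r.+1 h c) = cyc_act g M S r h (cdiff C r c).
Proof.
have hl : linear (fun c => cdiff C r (cyc_act g M S r.+1 h c)) by lin.
have hr : linear (fun c => cyc_act g M S r h (cdiff C r c)) by lin.
apply: (fam_eq (cyc_fam M S) (h := mklin hl) (h' := mklin hr)) => m s sr.
rewrite -[LHS]/(cdiff C r _) -[RHS]/(cyc_act g M S r h _) cyc_diffE //.
have -> : cyc_act g M S r h (bd (cgen r) m s) = bd (actF g (cgen r) h) m s.
  by apply: (@bd_map _ _ _ _ _ _ (cgen r) _ r id) => // *; exact: cyc_actE.
rewrite -(actF_bd f_g (cgen_good M S r)) // cyc_actE //.
rewrite (sws_linf hH h _ (linearP (cdiff C r))); apply: eq_sws => x y.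
rewrite (actL_linf _ _ _ _ (linearP (cdiff C r))); apply: eq_actL => u z su.
by rewrite cyc_diffE // su.
Qed.

Lemma cyc_dd r c : cdiff C r (cdiff C r.+1 c) = 0.
Proof. exact: (fam_dd (cyc_fam M S) (@cyc_diffE _ _ _ _ _ _ _ M S)). Qed.

End OneModule.

Section Functor.
Variables (M N : bimodule E) (q : {linear M -> N}).
Hypothesis ql : forall s m, s \in S -> q (bm_l (inA wf s) m) = bm_l (inA wf s) (q m).
Hypothesis qr : forall s m, s \in S -> q (bm_r m (inA wf s)) = bm_r (q m) (inA wf s).

Lemma cyc_map_ex r : exists h : {linear cobj (cyc M S) r -> cobj (cyc N S) r},
  forall m s, size s = r -> h (cgen S r m s) = cgen S r (q m) s.
Proof. exact: (@fam_map_ex _ _ _ _ _ _ _ _ _ (cyc_fam M S) (cyc_fam N S) r q). Qed.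

Definition cyc_map : degmap (cyc M S) (cyc N S) := fun r => projT1 (cid (cyc_map_ex r)).

Lemma cyc_mapE r m s : size s = r ->
  cyc_map r (cgen S r m s) = cgen S r (q m) s.
Proof. exact: (projT2 (cid (cyc_map_ex r))). Qed.

Lemma cyc_map_chain : is_bmor q -> chain_map cyc_map.
Proof.
move=> [Ql Qr] r.
have hl := lin_app (cyc_map r) (linearP (cdiff (cyc M S) r)).
have rl := lin_app (cdiff (cyc N S) r) (linearP (cyc_map r.+1)).
apply: (fam_eq (cyc_fam M S) (h := mklin hl) (h' := mklin rl)) => m s sr.
rewrite -[LHS]/(cyc_map r (cdiff (cyc M S) r (cgen S r.+1 m s))).
rewrite -[RHS]/(cdiff (cyc N S) r (cyc_map r.+1 (cgen S r.+1 m s))).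
rewrite cyc_mapE // !cyc_diffE //.
apply: (@bd_map _ _ (resA M) (resA N) _ _ (cgen S r) (cgen S r) r q (cyc_map r)) => //.
  by split=> e x; [exact: Ql | exact: Qr].
exact: cyc_mapE.
Qed.

Lemma cyc_map_act r h c : is_bmor q ->
  cyc_map r (cyc_act g M S r h c) = cyc_act g N S r h (cyc_map r c).
Proof.
move=> q_mor.
have hl := lin_app (cyc_map r) (linearP (cyc_act g M S r h)).
have rl := lin_app (cyc_act g N S r h) (linearP (cyc_map r)).
apply: (fam_eq (cyc_fam M S) (h := mklin hl) (h' := mklin rl)) => m s sr.
rewrite -[LHS]/(cyc_map r (cyc_act g M S r h (cgen S r m s))).
rewrite -[RHS]/(cyc_act g N S r h (cyc_map r (cgen S r m s))).
rewrite cyc_mapE // !cyc_actE //.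
apply: (@actF_map _ _ _ _ w f g wf M _ _ N (cgen S r) (cgen S r) q (cyc_map r)) => //.
by move=> m' t ts; rewrite cyc_mapE // ts.
Qed.

End Functor.
End CyclicAction.

(** * The total complex *)

Definition unit_set (k : comNzRingType) (H : algType k) : set H := [set (1 : H)].
Arguments unit_set {k} H.

Section Rows.
Variables (k : comNzRingType) (H : algType k) (hH : hopf H) (C : cplx k).
Variable act : forall r, H -> {linear cobj C r -> cobj C r}.
Hypothesis act_linh : forall r c, linear (fun h => act r h c).
Hypothesis act1 : forall r c, act r 1 c = c.
Hypothesis actM : forall r h l c, act r (h * l) c = act r h (act r l c).
Local Notation eps := (eps hH).

Section Row.
Variable r : nat.

Definition row_r (c : cobj C r) (h : H) : cobj C r := eps h *: c.
Lemma row_r_linl h : linear (row_r^~ h).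
Proof. by rewrite /row_r; lin. Qed.
Lemma row_r_linr c : linear (row_r c).
Proof. by rewrite /row_r; lin. Qed.
Lemma row_r1 c : row_r c 1 = c.
Proof. by rewrite /row_r eps1 scale1r. Qed.
Lemma row_rA c h l : row_r c (h * l) = row_r (row_r c h) l.
Proof. by rewrite /row_r epsM scalerA mulrC. Qed.
Lemma row_lrA h c l : row_r (act r h c) l = act r h (row_r c l).
Proof. by rewrite /row_r linearZ_LR. Qed.

(** H acts on the left by [act] and on the right through eps. With these coefficients the row
    differential is the Hochschild boundary of H up to the sign (-1)^r. *)
Definition row_bim : bimodule H :=
  @Bimodule k H (cobj C r) (fun h c => act r h c) row_r (@act_linh r)
    (fun h => linearP (act r h)) row_r_linl row_r_linr (@act1 r) row_r1
    (fun h l c => actM h l c) row_rA row_lrA.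

Definition rgen s (c : row_bim) (hs : seq H) : dbl_obj H C r s :=
  dbl_gen (c, word s hs).

(** For S = {1} the vanishing condition gives letters in H/k, and balancing says only that 1 acts as
    the identity. *)
Lemma rgen_good s : good (unit_set H) s (rgen s).
Proof.
split; last split.
- move=> hs _; exact: (@tw_gen_linl k H s (cobj C r) (unit_set H) hs).
- move=> c; exact: (@tw_gen_slin k H s (cobj C r) (unit_set H) c).
- move=> c; exact: (@tw_gen_svan k H s (cobj C r) (unit_set H) c).
- by move=> c s1 s2 x t y _ ->; rewrite mulr1 mul1r.
- by move=> _ c t ->; rewrite bm_l1 bm_r1.
- by move=> c t x s' _ ->; rewrite bm_r1 mul1r.
- by move=> c t x s' _ ->; rewrite mulr1 bm_l1.
Qed.

Lemma row_fam : is_fam (unit_set H) rgen.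
Proof.
split; first exact: rgen_good.
- by move=> s W phi [pm pl pv _]; exact: (tw_ext pm pl pv).
- move=> s W h h' hh'; exact: (@eq_tw k W H (unit_set H) (cobj C r) s h h').
Qed.

Lemma row_d_ex s : exists d : {linear dbl_obj H C r s.+1 -> dbl_obj H C r s},
  forall c hs, size hs = s.+1 -> d (rgen s.+1 c hs) = bd (rgen s) c hs.
Proof. exact: (fam_diff_ex row_fam). Qed.
Definition row_d s := projT1 (cid (row_d_ex s)).
Lemma row_dE s c hs : size hs = s.+1 -> row_d s (rgen s.+1 c hs) = bd (rgen s) c hs.
Proof. exact: (projT2 (cid (row_d_ex s))). Qed.

Lemma row_dd s x : row_d s (row_d s.+1 x) = 0.
Proof. exact: (fam_dd row_fam row_dE). Qed.

Lemma dbl_hE s x : dbl_h hH act r s x = (-1) ^+ r *: row_d s x.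
Proof.
have rl : linear (fun x => (-1) ^+ r *: row_d s x) by lin.
move: x; apply: (fam_eq row_fam (h := dbl_h hH act r s) (h' := mklin rl)) => c hs sn.
rewrite -[RHS]/(_ *: row_d s _) row_dE //.
pose F (c : row_bim) (x : 'I_s -> H) : dbl_obj H C r s := dbl_gen (c, x).
have FZ (c' : cobj C r) a x : F (row_r c' a) x = eps a *: F c' x.
  exact: (linfZ (@ptens_linl k (cobj C r) _ _)).
have e (c' : cobj C r) (x : 'I_s.+1 -> H) :
    (-1) ^+ r *: (eps (x ord0) *: dbl_gen (c', tail x))
    + \sum_(i < s) (-1) ^+ (r + i.+1) *: dbl_gen (c', Defs.merge i x)
    + (-1) ^+ (r + s.+1) *: dbl_gen (act r (x ord_max) c', front x)
    = (-1) ^+ r *: bd (rgen s) c' (letters x).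
  rewrite -(bd_word F) FZ !scalerDr scaler_sumr.
  congr (_ + _ + _); last by rewrite exprD scalerA.
  by apply: eq_bigr => i _; rewrite exprD scalerA.
rewrite -[in RHS](wordK sn) -e.
apply: (linextE (gen := @dbl_gen k H C r s.+1) _ (c, word s.+1 hs)).
exists (mklin (lin_scale ((-1) ^+ r) (linearP (row_d s)))) => -[c' x].
apply: etrans (esym (e c' x)); rewrite -[in LHS](lettersK x).
by congr (_ *: _); apply: row_dE; exact: size_letters.
Qed.

End Row.

Lemma dbl_vE r s x : dbl_v H C r s x = tmap2 (cdiff C r) idfun x.
Proof.
move: x; apply: (fam_eq (row_fam r.+1)) => c hs sn.
have [g gE] := tmap2_ex (cdiff C r) (idfun : {linear tpow (Hbar H) s -> _}).
rewrite [RHS]tmap2E; apply: (linextE (gen := @dbl_gen k H C r.+1 s) _ (c, word s hs)).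
by exists g => -[c' x]; exact: gE.
Qed.

Lemma dbl_v_gen r s c hs : dbl_v H C r s (rgen s c hs) = @rgen r s (cdiff C r c) hs.
Proof. by rewrite dbl_vE [LHS]tmap2E. Qed.

End Rows.

Section RowMap.
Variables (k : comNzRingType) (H : algType k) (hH : hopf H) (C C' : cplx k).
Variable act : forall r, H -> {linear cobj C r -> cobj C r}.
Hypothesis act_linh : forall r c, linear (fun h => act r h c).
Hypothesis act1 : forall r c, act r 1 c = c.
Hypothesis actM : forall r h l c, act r (h * l) c = act r h (act r l c).
Variable act' : forall r, H -> {linear cobj C' r -> cobj C' r}.
Hypothesis act_linh' : forall r c, linear (fun h => act' r h c).
Hypothesis act1' : forall r c, act' r 1 c = c.
Hypothesis actM' : forall r h l c, act' r (h * l) c = act' r h (act' r l c).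
Local Notation row := (row_bim hH act_linh act1 actM).
Local Notation row' := (row_bim hH act_linh' act1' actM').
Local Notation d := (row_d hH act_linh act1 actM).
Local Notation d' := (row_d hH act_linh' act1' actM').
Local Notation rgen' := (@rgen k H hH C' act' act_linh' act1' actM').
Local Notation rgen := (@rgen k H hH C act act_linh act1 actM).

Lemma row_d_map r r' s (q : {linear cobj C r -> cobj C' r'}) x :
  (forall h c, q (act r h c) = act' r' h (q c)) ->
  d' r' s (tmap2 q idfun x) = tmap2 q idfun (d r s x).
Proof.
move=> q_act.
have hl := lin_app (d' r' s) (linearP (tmap2 q (idfun : {linear tpow (Hbar H) s.+1 -> _}))).
have hr := lin_app (tmap2 q (idfun : {linear tpow (Hbar H) s -> _})) (linearP (d r s)).
move: x; apply: (fam_eq (row_fam hH act_linh act1 actM r) (h := mklin hl) (h' := mklin hr)) => c hs sn.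
rewrite -[LHS]/(d' r' s (tmap2 q idfun (rgen s.+1 c hs))).
rewrite -[RHS]/(tmap2 q idfun (d r s (rgen s.+1 c hs))) row_dE //.
have -> : tmap2 q idfun (rgen s.+1 c hs) = rgen' s.+1 (q c) hs by rewrite [LHS]tmap2E.
rewrite row_dE //; apply: esym.
apply: (@bd_map _ _ (row r) (row' r') _ _ (rgen s) (rgen' s) s q) => //.
  by split=> [e m|e m]; [exact: q_act | rewrite /= /row_r linearZ_LR].
by move=> m t ts; rewrite [LHS]tmap2E.
Qed.

End RowMap.

Section Columns.
Variables (k : comNzRingType) (H : algType k) (hH : hopf H) (C : cplx k).
Variable act : forall r, H -> {linear cobj C r -> cobj C r}.
Hypothesis act_linh : forall r c, linear (fun h => act r h c).
Hypothesis act1 : forall r c, act r 1 c = c.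
Hypothesis actM : forall r h l c, act r (h * l) c = act r h (act r l c).
Hypothesis act_chain : forall r h c, cdiff C r (act r.+1 h c) = act r h (cdiff C r c).
Hypothesis C_dd : forall r c, cdiff C r (cdiff C r.+1 c) = 0.

Lemma dbl_vv r s x : dbl_v H C r s (dbl_v H C r.+1 s x) = 0.
Proof.
have hl := lin_app (dbl_v H C r s) (linearP (dbl_v H C r.+1 s)).
move: x; apply: (fam_eq (row_fam hH act_linh act1 actM r.+2) (h := mklin hl) (h' := \0)) => c hs sn.
rewrite -[LHS]/(dbl_v H C r s (dbl_v H C r.+1 s _)) !(@dbl_v_gen _ _ hH _ _ act_linh act1 actM) C_dd.
exact: (linf0 (@ptens_linl k (cobj C r) _ _)).
Qed.

Lemma dbl_vh r s x :
  dbl_v H C r s (dbl_h hH act r.+1 s x) + dbl_h hH act r s (dbl_v H C r s.+1 x) = 0.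
Proof.
rewrite !(dbl_hE hH act_linh act1 actM) !(dbl_vE hH act_linh act1 actM) linearZ_LR
  (@row_d_map k H hH C C act act_linh act1 actM act act_linh act1 actM); last by move=> h c; rewrite act_chain.
by rewrite exprS mulN1r scaleNr addNr.
Qed.

Lemma dbl_hh r s x : dbl_h hH act r s (dbl_h hH act r s.+1 x) = 0.
Proof. by rewrite !(dbl_hE hH act_linh act1 actM) linearZ_LR row_dd !scaler0. Qed.

Local Notation D := (hopf_cplx hH C act).

(** Components carry a proof of r + s = n. Proofs of a boolean equation are unique, so [tcomp_eta]
    allows any of them and no casts arise. *)
Definition tcomp n (x : tot_obj H C n) r s (e : (r + s == n)%N) : dbl_obj H C r s :=
  x (exist _ (r, s) e).

Lemma tcomp_eta n (x : tot_obj H C n) r s (e e' : (r + s == n)%N) :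
  tcomp x e = tcomp x e'.
Proof. by rewrite (bool_irrelevance e e'). Qed.

Lemma tcomp_ext n (x y : tot_obj H C n) :
  (forall r s (e : (r + s == n)%N), tcomp x e = tcomp y e) -> x = y.
Proof. by move=> xy; apply: functional_extensionality_dep => -[[r s] e]; exact: xy. Qed.

Lemma tcompD n (x : tot_obj H C n.+1) r s (e : (r + s == n)%N)
    (e1 : (r.+1 + s == n.+1)%N) (e2 : (r + s.+1 == n.+1)%N) :
  tcomp (cdiff D n x) e = dbl_v H C r s (tcomp x e1) + dbl_h hH act r s (tcomp x e2).
Proof.
pose p : bideg n := exist _ (r, s) e.
by rewrite (tcomp_eta x e1 (valP p)) (tcomp_eta x e2 (bideg_r_subproof p)).
Qed.

Lemma tot_dd n x : cdiff D n (cdiff D n.+1 x) = 0.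
Proof.
apply: tcomp_ext => r s e.
have e1 : (r.+1 + s == n.+1)%N by [].
have e2 : (r + s.+1 == n.+1)%N by rewrite addnS.
have e12 : (r.+1 + s.+1 == n.+2)%N by rewrite addnS.
have e22 : (r + s.+2 == n.+2)%N by rewrite !addnS.
rewrite (tcompD _ _ e1 e2) (tcompD _ _ (e1 : (r.+2 + s == n.+2)%N) e12) (tcompD _ _ e12 e22).
by rewrite !linearD dbl_vv dbl_hh add0r addr0; exact: dbl_vh.
Qed.

End Columns.

Section TotalContraction.
Variables (k : comNzRingType) (H : algType k) (hH : hopf H) (C : cplx k).
Variable act : forall r, H -> {linear cobj C r -> cobj C r}.
Hypothesis act_linh : forall r c, linear (fun h => act r h c).
Hypothesis act1 : forall r c, act r 1 c = c.
Hypothesis actM : forall r h l c, act r (h * l) c = act r h (act r l c).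

Variable V : forall r, {linear cobj C r -> cobj C r.+1}.
Hypothesis V_act : forall r h c, V r (act r h c) = act r.+1 h (V r c).
Hypothesis V_S : forall r c, cdiff C r.+1 (V r.+1 c) + V r (cdiff C r c) = c.

Variables (X : lmodType k) (alpha : {linear cobj C 0 -> tens H X}).
Variable J : {linear X -> cobj C 0}.
Variable mu : {linear tens H X -> cobj C 0}.
Hypothesis muE : forall h x, mu (h \ox x) = act 0 h (J x).
Hypothesis V_0 : forall c, cdiff C 0 (V 0 c) = c - mu (alpha c).
Hypothesis alpha_d : forall c, alpha (cdiff C 0 c) = 0.
Hypothesis alpha_act : forall h c, alpha (act 0 h c) =
  tmap2 (mull h) (idfun : {linear X -> X}) (alpha c).

Local Notation eps := (eps hH).
Local Notation row0 := (row_bim hH act_linh act1 actM 0).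
Local Notation row_d := (row_d hH act_linh act1 actM).
Local Notation fam0 := (row_fam hH act_linh act1 actM 0).

Definition scale_eps (t : H) : {linear X -> X} := mklin (lin_scale (eps t) (@lin_id k X)).

Lemma alpha_r t (c : row0) : alpha (bm_r c t) =
  tmap2 (idfun : {linear H -> H}) (scale_eps t) (alpha c).
Proof.
apply: etrans (linearZ_LR _ _ _) _; move: (alpha c).
apply: (@eq_tens _ _ _ _ (mklin (lin_scale (eps t) (@lin_id k (tens H X))))) => h x.
by rewrite tmap2E; apply/esym/(linfZ (ptens_linr h)).
Qed.

Lemma J_r t x : J (scale_eps t x) = bm_r (J x : row0) t.
Proof. exact: (linearZ_LR J). Qed.

(** The general contraction, with alpha decomposing C_0. As alpha inverts mu only up to boundaries,
    it leaves mu alpha in place of the identity. *)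
Definition row_ctr s : {linear dbl_obj H C 0 s -> dbl_obj H C 0 s.+1} :=
  fam_ctr fam0 (D := alpha : {linear row0 -> _}) (J := J) alpha_act alpha_r J_r s.

Definition mu_alpha : {linear cobj C 0 -> cobj C 0} := mklin (lin_app mu (linearP alpha)).

Lemma row_ctrP s x : row_d 0 s.+1 (row_ctr s.+1 x) =
  row_ctr s (row_d 0 s x) +
  (-1) ^+ s *: tmap2 mu_alpha (idfun : {linear tpow (Hbar H) s.+1 -> _}) x.
Proof.
have ml : linear (tmap2 mu_alpha (idfun : {linear tpow (Hbar H) s.+1 -> _})).
  exact: linearP.
have hl := lin_app (row_d 0 s.+1) (linearP (row_ctr s.+1)).
have hr := lin_add (lin_app (row_ctr s) (linearP (row_d 0 s))) (lin_scale ((-1) ^+ s) ml).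
move: x; apply: (fam_eq fam0 (h := mklin hl) (h' := mklin hr)) => c hs sn.
have := fam_contraction fam0 (@row_dE _ _ hH _ _ act_linh act1 actM 0) alpha_act alpha_r J_r c sn.
rewrite -/(row_ctr s.+1) -/(row_ctr s) => e; apply: etrans e _.
congr (_ + _ *: _); apply: esym; apply: etrans (tmap2E _ _ _ _) _.
suff -> : mu_alpha c = fam_mul (M := row0) J (alpha c) by [].
apply: (@eq_tens _ _ _ _ mu (fam_mul (M := row0) J)) => h y.
by rewrite fam_mulE muE.
Qed.

(** The contraction begins with alpha, which kills the boundaries of C. *)
Lemma row_ctr_v s x : row_ctr s (dbl_v H C 0 s x) = 0.
Proof.
have hl := lin_app (row_ctr s) (linearP (dbl_v H C 0 s)).
move: x; apply: (fam_eq (row_fam hH act_linh act1 actM 1) (h := mklin hl) (h' := \0)) => c hs sn.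
rewrite -[LHS]/(row_ctr s (dbl_v H C 0 s _)) (@dbl_v_gen _ _ hH _ _ act_linh act1 actM).
rewrite [LHS](fam_ctrE fam0 alpha_act alpha_r J_r) // alpha_d; exact: linear0.
Qed.

Definition tmapV r s : {linear dbl_obj H C r s -> dbl_obj H C r.+1 s} :=
  tmap2 (V r) (idfun : {linear tpow (Hbar H) s -> _}).

Lemma eq_dbl r s (W : lmodType k) (h h' : {linear dbl_obj H C r s -> W}) :
  (forall c t, h (c \ox t) = h' (c \ox t)) -> h =1 h'.
Proof. exact: eq_tens. Qed.

Lemma tmapV_h r s x :
  dbl_h hH act r.+1 s (tmapV r s.+1 x) + tmapV r s (dbl_h hH act r s x) = 0.
Proof.
rewrite !(dbl_hE hH act_linh act1 actM) linearZ_LR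
  (@row_d_map k H hH C C act act_linh act1 actM act act_linh act1 actM); last exact: V_act.
by rewrite exprS mulN1r scaleNr addNr.
Qed.

Lemma tmapV_v r s x :
  dbl_v H C r.+1 s (tmapV r.+1 s x) + tmapV r s (dbl_v H C r s x) = x.
Proof.
have hl := lin_add (lin_app (dbl_v H C r.+1 s) (linearP (tmapV r.+1 s)))
  (lin_app (tmapV r s) (linearP (dbl_v H C r s))).
move: x; apply: (eq_dbl (h := mklin hl) (h' := idfun)) => c t.
rewrite -[LHS]/(dbl_v H C r.+1 s (tmapV r.+1 s _) + tmapV r s (dbl_v H C r s _)).
rewrite !(dbl_vE hH act_linh act1 actM) !tmap2E -[RHS]/(c \ox t).
by rewrite -[in RHS](V_S c); apply/esym/(linfD (ptens_linl t)).
Qed.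

Lemma tmapV_v0 s x :
  dbl_v H C 0 s (tmapV 0 s x) =
  x - tmap2 mu_alpha (idfun : {linear tpow (Hbar H) s -> _}) x.
Proof.
have ml : linear (tmap2 mu_alpha (idfun : {linear tpow (Hbar H) s -> _})).
  exact: linearP.
have hl := lin_app (dbl_v H C 0 s) (linearP (tmapV 0 s)).
have hr := lin_add (@lin_id k (dbl_obj H C 0 s)) (lin_opp ml).
move: x; apply: (eq_dbl (h := mklin hl) (h' := mklin hr)) => c t.
rewrite -[LHS]/(dbl_v H C 0 s (tmapV 0 s _)).
rewrite -[RHS]/(_ - tmap2 mu_alpha (idfun : {linear tpow (Hbar H) s -> _}) _).
rewrite !(dbl_vE hH act_linh act1 actM) !tmap2E V_0.
by rewrite (linfB (ptens_linl t)).
Qed.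

(** The sign turns [row_ctrP] into a homotopy formula without signs, namely [tot_row_h]. *)
Definition tot_row s : {linear dbl_obj H C 0 s -> dbl_obj H C 0 s.+1} :=
  mklin (lin_scale ((-1) ^+ s.+1) (linearP (row_ctr s))).

Lemma tot_row_v s x : tot_row s (dbl_v H C 0 s x) = 0.
Proof. by rewrite -[LHS]/(_ *: row_ctr s _) row_ctr_v scaler0. Qed.

Lemma tot_row_h s x : dbl_h hH act 0 s.+1 (tot_row s.+1 x) + tot_row s (dbl_h hH act 0 s x) =
  tmap2 mu_alpha (idfun : {linear tpow (Hbar H) s.+1 -> _}) x.
Proof.
rewrite !(dbl_hE hH act_linh act1 actM) !expr0 !scale1r.
rewrite -[tot_row s.+1 x]/((-1) ^+ s.+2 *: row_ctr s.+1 x) linearZ_LR row_ctrP.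
rewrite -[tot_row s _]/((-1) ^+ s.+1 *: row_ctr s _) scalerDr scalerA addrAC.
rewrite !exprS !mulN1r opprK scaleNr addrN add0r.
by rewrite -expr2 sqrr_sign scale1r.
Qed.

Local Notation D := (hopf_cplx hH C act).

(* V contracts C onto its degree 0 part, up to the idempotent mu alpha; what is left
   sits in bidegrees (0, s), where tot_row contracts it. *)
Definition tot_ctr n (x : tot_obj H C n) : tot_obj H C n.+1 :=
  fun p => let: exist q e := p in
  match q return (q.1 + q.2 == n.+1)%N -> dbl_obj H C q.1 q.2 with
  | (r.+1, s) => fun e => tmapV r s (tcomp x (e : (r + s == n)%N))
  | (0, s.+1) => fun e => tot_row s (tcomp x (e : (0 + s == n)%N))
  | (0, 0) => fun _ => 0
  end e.

Lemma tot_ctrS n x r s (e : (r.+1 + s == n.+1)%N) (e' : (r + s == n)%N) :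
  tcomp (@tot_ctr n x) e = tmapV r s (tcomp x e').
Proof. by rewrite (tcomp_eta x e' e). Qed.

Lemma tot_ctr0 n x s (e : (0 + s.+1 == n.+1)%N) (e' : (0 + s == n)%N) :
  tcomp (@tot_ctr n x) e = tot_row s (tcomp x e').
Proof. by rewrite (tcomp_eta x e' e). Qed.

Lemma tot_acyclic n x : cdiff D n x = 0 -> is_bdry x.
Proof.
move=> dx; exists (tot_ctr x).
have dxE r s (e : (r + s == n)%N) (e1 : (r.+1 + s == n.+1)%N) (e2 : (r + s.+1 == n.+1)%N) :
    dbl_v H C r s (tcomp x e1) + dbl_h hH act r s (tcomp x e2) = 0.
  by rewrite -(tcompD hH act x e) dx.
apply: tcomp_ext => -[|r] s e; apply: esym.
  case: s e => [|s] e //.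
  have e' : (0 + s == n)%N := e.
  rewrite (tcompD hH act (tot_ctr x) (e : (0 + s.+1 == n.+1)%N) (e : (1 + s.+1 == n.+2)%N)
    (e : (0 + s.+2 == n.+2)%N)).
  rewrite (tot_ctrS x (e : (1 + s.+1 == n.+2)%N) e) (tot_ctr0 x (e : (0 + s.+2 == n.+2)%N) e).
  (* In row 0 the vertical contraction misses mu alpha x, which the row contraction supplies. Its
     second term vanishes: the cycle condition at (0, s) makes it [tot_row] of a vertical boundary,
     up to sign. *)
  have := congr1 (tot_row s) (dxE 0 s e' e' e).
  rewrite linearD tot_row_v add0r linear0 => h0.
  by rewrite tmapV_v0 -tot_row_h h0 addr0 subrK.
have e' : (r + s == n)%N := e.
have f : (r + s.+1 == n.+1)%N by rewrite addnS.
have f2 : (r.+1 + s.+1 == n.+2)%N by rewrite addnS.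
rewrite (tcompD hH act (tot_ctr x) e (e : (r.+2 + s == n.+2)%N) f2).
rewrite (tot_ctrS x (e : (r.+2 + s == n.+2)%N) e) (tot_ctrS x f2 f).
(* V anticommutes with the horizontal differential up here. Adding V of the cycle condition at (r,
   s) completes both homotopy formulas, one giving x and the other zero. *)
have := congr1 (tmapV r s) (dxE r s e' e f); rewrite linearD linear0 => h0.
by rewrite -[LHS]addr0 -[X in _ + X]h0 addrACA tmapV_v tmapV_h addr0.
Qed.

End TotalContraction.

(** * Coefficients in a free bimodule *)

Section FreeGenerators.
Variables (k : comNzRingType) (E : algType k) (N : lmodType k).
(** The free bimodule is E (x) U, with the right action of E on U; its left factor E will be split
    further as A (x) H. *)
Definition freeU : lmodType k := tens N E.
Local Notation U := freeU.

Definition rmulU (e : E) : {linear U -> U} := @tmap2 k N N E E (idfun : {linear N -> N}) (mulr_by e).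

Lemma rmulUE e v b : rmulU e (v \ox b : U) = v \ox (b * e).
Proof. exact: tmap2E. Qed.

Lemma rmulU_linl u : linear (rmulU^~ u).
Proof.
move=> c e e'; have hl : linear (fun y => c *: rmulU e y + rmulU e' y) by lin.
move: u; apply: (@eq_tens k N E U (rmulU (c *: e + e')) (mklin hl)) => v b.
have bl : linear (fun e : E => v \ox (b * e) : U) by lin.
by rewrite -[RHS]/(c *: rmulU e _ + rmulU e' _) !rmulUE; exact: bl.
Qed.

Lemma rmulUM e e' u : rmulU (e * e') u = rmulU e' (rmulU e u).
Proof.
have hl : linear (fun y => rmulU e' (rmulU e y)) by lin.
move: u; apply: (@eq_tens k N E U (rmulU (e * e')) (mklin hl)) => v b.
by rewrite -[RHS]/(rmulU e' (rmulU e _)) !rmulUE mulrA.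
Qed.

Lemma rmulU1 u : rmulU 1 u = u.
Proof.
move: u; apply: (@eq_tens k N E U (rmulU 1) (idfun : {linear _ -> _})) => v b.
by rewrite rmulUE mulr1.
Qed.

Definition fgen (e : E) (u : U) : free_bim E N := e \ox u.

Lemma fgen_linl u : linear (fgen^~ u).
Proof. exact: (@ptens_linl k E U u). Qed.
Lemma fgen_linr e : linear (fgen e).
Proof. exact: (@ptens_linr k E U e). Qed.

Lemma fgen_l t e u : bm_l t (fgen e u) = fgen (t * e) u.
Proof. exact: free_lE. Qed.
Lemma fgen_r t e u : bm_r (fgen e u) t = fgen e (rmulU t u).
Proof. exact: tmap2E. Qed.

Lemma eq_fgen1 (W : lmodType k) (F G : {linear free_bim E N -> W}) :
  (forall u, F \o fgen^~ u =1 G \o fgen^~ u) -> F =1 G.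
Proof. by move=> FG; apply: eq_tens => e u; exact: FG. Qed.

Lemma fgen_ext1 (W : lmodType k) (b : E -> U -> W) :
  (forall u, linear (b^~ u)) -> (forall e, linear (b e)) ->
  exists F : {linear free_bim E N -> W}, forall e u, F (fgen e u) = b e u.
Proof. exact: tens_ext2. Qed.

Lemma incH_ex (H : lmodType k) (q : H -> E) : linear q ->
  exists F : {linear tens H U -> free_bim E N}, forall h u, F (h \ox u) = fgen (q h) u.
Proof.
move=> ql; apply: (tens_ext2 (b := fun h u => fgen (q h) u)) => [u|h].
  exact: (lin_comp (g := fgen^~ u) (fgen_linl u)).
exact: fgen_linr.
Qed.

End FreeGenerators.
Arguments freeU {k} E N.
Arguments fgen {k E N} e u.
Arguments rmulU {k E} N e.

Section FreeCyclic.
Variables (k : comNzRingType) (H : algType k) (hH : hopf H) (A : algType k).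
Variables (w : weakAction hH A) (f : {linear tens H H -> A}) (wf : is_crossed w f).
Variable S : subalgClosed A.
Variable N : lmodType k.
Local Notation E := (crossed wf).
Local Notation U := (freeU E N).
Local Notation P := (free_bim E N).
Local Notation C := (cyc P S).
Local Notation cgen := (cgen S).
Local Notation inA := (inA wf).
Local Notation inH := (inH wf).
Local Notation pureE := (pureE wf).
Local Notation rmulU := (rmulU N).

Lemma eq_fgen (W : lmodType k) (F G : {linear P -> W}) :
  (forall a h u, F (fgen (pureE a h) u) = G (fgen (pureE a h) u)) -> F =1 G.
Proof.
move=> FG; apply: eq_fgen1 => u.
have Fl := lin_app F (fgen_linl u); have Gl := lin_app G (fgen_linl u).
by apply: (@eq_tens k A H W (mklin Fl) (mklin Gl)) => a h; exact: FG.
Qed.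

Lemma fgen_ext (W : lmodType k) (b : A -> H -> U -> W) :
  (forall h u, linear (fun a => b a h u)) -> (forall a u, linear (fun h => b a h u)) ->
  (forall a h, linear (b a h)) ->
  exists F : {linear P -> W}, forall a h u, F (fgen (pureE a h) u) = b a h u.
Proof.
move=> b1 b2 b3; have hE u : exists F : {linear E -> W}, forall a h, F (pureE a h) = b a h u.
  exact: (@tens_ext2 k A H W (fun a h => b a h u)).
pose F u := projT1 (cid (hE u)).
have FE u a h : F u (pureE a h) = b a h u := projT2 (cid (hE u)) a h.
have [u|e|G GE] := @fgen_ext1 k E N W (fun e u => F u e); last first.
- by exists G => a h u; rewrite GE FE.
- move=> c u u'; move: e.
  have hl : linear (fun e => c *: F u e + F u' e) by lin.
  apply: (@eq_tens k A H W (F (c *: u + u')) (mklin hl)) => a h.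
  by apply: etrans (FE _ a h) _; rewrite b3 -!FE.
- exact: linearP.
Qed.

Local Notation Y := (tens H U).

(** Regroups (A # H) (x) U as A (x) (H (x) U), the decomposition over A that drives the contraction
    of the cyclic complex. *)
Lemma unmul_ex : exists D : {linear resA P -> tens A Y},
  forall a h u, D (fgen (pureE a h) u) = a \ox (h \ox u).
Proof.
pose b a h u : tens A Y := a \ox (h \ox u).
by apply: (@fgen_ext (tens A Y) b); rewrite /b => *; lin.
Qed.
Definition unmul := projT1 (cid unmul_ex).
Lemma unmulE a h u : unmul (fgen (pureE a h) u) = a \ox (h \ox u).
Proof. exact: (projT2 (cid unmul_ex)). Qed.

Definition incH : {linear Y -> resA P} := projT1 (cid (incH_ex N (inH_lin wf))).
Lemma incHE h u : incH (h \ox u) = fgen (inH h) u.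
Proof. exact: (projT2 (cid (incH_ex N (inH_lin wf)))). Qed.

Definition rmulY (t : A) : {linear Y -> Y} :=
  tmap2 (idfun : {linear H -> H}) (rmulU (inA t)).
Lemma rmulYE t h u : rmulY t (h \ox u) = h \ox rmulU (inA t) u.
Proof. exact: tmap2E. Qed.

Lemma unmul_l t m : unmul (bm_l t m) = tmap2 (mull t) (idfun : {linear Y -> Y}) (unmul m).
Proof.
have hl := lin_app unmul (@bm_l_linr k A (resA P) t).
have hr := lin_app (tmap2 (mull t) (idfun : {linear Y -> Y})) (linearP unmul).
move: m; apply: (eq_fgen (F := mklin hl) (G := mklin hr)) => a h u.
rewrite -[LHS]/(unmul (bm_l (inA t) (fgen _ _))) -[RHS]/(tmap2 _ _ (unmul _)).
by rewrite fgen_l inA_pure !unmulE tmap2E.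
Qed.

Lemma unmul_r t m : unmul (bm_r m t) = tmap2 (idfun : {linear A -> A}) (rmulY t) (unmul m).
Proof.
have hl := lin_app unmul (@bm_r_linl k A (resA P) t).
have hr := lin_app (tmap2 (idfun : {linear A -> A}) (rmulY t)) (linearP unmul).
move: m; apply: (eq_fgen (F := mklin hl) (G := mklin hr)) => a h u.
rewrite -[LHS]/(unmul (bm_r (fgen _ _) (inA t))) -[RHS]/(tmap2 _ _ (unmul _)).
by rewrite fgen_r !unmulE tmap2E rmulYE.
Qed.

Lemma incH_r t y : incH (rmulY t y) = bm_r (incH y) t.
Proof.
have hl := lin_app incH (linearP (rmulY t)).
have hr : linear (fun y => bm_r (incH y) t) by lin.
move: y; apply: (@eq_tens k H U P (mklin hl) (mklin hr)) => h u.
rewrite -[LHS]/(incH (rmulY t _)) -[RHS]/(bm_r (incH _ : P) (inA t)).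
by rewrite rmulYE !incHE fgen_r.
Qed.

Lemma unmulK m : fam_mul incH (unmul m) = m.
Proof.
have hl := lin_app (fam_mul incH) (linearP unmul).
move: m; apply: (eq_fgen (F := mklin hl) (G := idfun)) => a h u.
rewrite -[LHS]/(fam_mul incH (unmul _)) unmulE fam_mulE incHE.
by rewrite -[LHS]/(bm_l (inA a) (fgen _ _)) fgen_l -pureEE.
Qed.

Local Notation fam := (cyc_fam P S).
Local Notation ctr := (fam_ctr fam unmul_l unmul_r incH_r).

Lemma cyc_ctrE r a h u s : size s = r ->
  ctr r (cgen r (fgen (pureE a h) u) s) = cgen r.+1 (fgen (inH h) u) (rcons s a).
Proof.
by move=> sr; rewrite (fam_ctrE fam unmul_l unmul_r incH_r) // unmulE ctrE // incHE.
Qed.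

Lemma cgen_linl r s : size s = r -> linear (fun m : P => cgen r m s : cobj C r).
Proof. by have [gm _ _ _] := cgen_good P S r; exact: gm. Qed.

(** The sign is chosen so that d V + V d is the identity in positive degrees. *)
Definition cyc_ctr r : {linear cobj C r -> cobj C r.+1} :=
  mklin (lin_scale ((-1) ^+ r.+1) (linearP (ctr r))).

Lemma cyc_ctrS r c : cdiff C r.+1 (cyc_ctr r.+1 c) + cyc_ctr r (cdiff C r c) = c.
Proof.
have hl := lin_add (lin_app (cdiff C r.+1) (linearP (cyc_ctr r.+1)))
  (lin_app (cyc_ctr r) (linearP (cdiff C r))).
move: c; apply: (fam_eq fam (h := mklin hl) (h' := idfun)) => m s sr.
rewrite -[LHS]/(cdiff C r.+1 (_ *: ctr r.+1 _) + _ *: ctr r (cdiff C r _)).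
rewrite linearZ_LR (fam_contraction fam (@cyc_diffE _ _ _ _ _ _ _ P S)) // unmulK.
rewrite scalerDr scalerA addrAC !exprS !mulN1r opprK scaleNr subrr add0r.
by rewrite -expr2 sqrr_sign scale1r.
Qed.

End FreeCyclic.

Lemma bd1 (k : comNzRingType) (T : algType k) (M : bimodule T) (W : lmodType k)
    (phi : M -> seq T -> W) m a :
  bd phi m [:: a] = phi (bm_r m a) [::] - phi (bm_l a m) [::].
Proof. by rewrite /bd /= subr0 expr1 scaleN1r. Qed.

Section FreeCyclicAction.
Variables (k : comNzRingType) (H : algType k) (hH : hopf H) (A : algType k).
Variables (w : weakAction hH A) (f g : {linear tens H H -> A}) (wf : is_crossed w f).
Hypothesis f_g : conv_inverse hH f g.
Variable S : subalgClosed A.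
Hypothesis S_stable : forall (h : H) (a : A), a \in S -> w h a \in S.
Hypothesis fS : forall h l : H, f (h \ox l) \in S.
Variable N : lmodType k.
Local Notation E := (crossed wf).
Local Notation U := (freeU E N).
Local Notation P := (free_bim E N).
Local Notation C := (cyc P S).
Local Notation cgen := (cgen S).
Local Notation sws := (sws hH).
Local Notation inA := (inA wf).
Local Notation inH := (inH wf).
Local Notation inv := (inH_inv g wf).
Local Notation pureE := (pureE wf).
Local Notation rmulU := (rmulU N).
Local Notation act := (cyc_act g P S).
Local Notation fam := (cyc_fam P S).
Local Notation ctr := (fam_ctr fam (@unmul_l _ _ _ _ _ _ wf N) (@unmul_r _ _ _ _ _ _ wf N)
  (@incH_r _ _ _ _ _ _ wf N)).
Local Notation V := (cyc_ctr wf S N).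

Lemma cgen_fgen_lin r u s : size s = r ->
  linear (fun e => cgen r (fgen e u : P) s : cobj C r).
Proof.
move=> sr; apply: (lin_comp (g := fun m : P => cgen r m s)); first exact: cgen_linl.
exact: fgen_linl.
Qed.

Lemma cgen_rmul_lin r e u s : size s = r ->
  linear (fun e' => cgen r (fgen e (rmulU e' u) : P) s : cobj C r).
Proof.
move=> sr; apply: (lin_comp (g := fun m : P => cgen r m s)); first exact: cgen_linl.
by apply: (lin_comp (g := fgen e)); [exact: fgen_linr | exact: rmulU_linl].
Qed.

(** Normalising (1 # y)(b # h) creates b^y1 f (y2, h1), which is moved to the end of the word. There
    f, lying in S, crosses back to m and rebuilds (1 # y2)(1 # h). *)
Lemma ctr_inH r y b h u s : size s = r ->
  ctr r (cgen r (fgen (inH y * pureE b h) u) s) =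
  sws y (fun y1 y2 => cgen r.+1 (fgen (inH y2 * inH h) u) (rcons s (w y1 b))).
Proof.
move=> sr; have l1 := lin_app (ctr r) (cgen_fgen_lin u sr).
rewrite -[inH y]/(pureE 1 y) pureE_mul (sws_linf hH y _ l1); apply: eq_sws => p q.
have sp : size (rcons s (w p b)) = r.+1 by rewrite size_rcons sr.
have l2 := cgen_fgen_lin u sp.
rewrite inH_inH (sws_linf hH q _ l1) (sws_linf hH q _ l2); apply: eq_sws => y1 z.
rewrite (sws_linf hH h _ l1) (sws_linf hH h _ l2); apply: eq_sws => h1 h2.
have [_ _ _ [_ _ _ pR]] := cgen_good P S r.+1.
rewrite cyc_ctrE // mul1r pureEE -fgen_l pR //; last exact: fS.
by rewrite sr.
Qed.

(** In the lengthened word the letter b is acted on by the leg just before the one that multiplies m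
    on the left; [ctr_inH] produces the same order. *)
Lemma ctr_act r l c : ctr r (act r l c) = act r.+1 l (ctr r c).
Proof.
have hl := lin_app (ctr r) (linearP (act r l)).
have hr := lin_app (act r.+1 l) (linearP (ctr r)).
move: c; apply: (fam_eq fam (h := mklin hl) (h' := mklin hr)) => m s sr.
rewrite -[LHS]/(ctr r (act r l _)) -[RHS]/(act r.+1 l (ctr r _)).
have ll : linear (fun m : P => ctr r (act r l (cgen r m s))).
  by apply: (lin_app (ctr r)); apply: (lin_app (act r l)); exact: cgen_linl.
have rl : linear (fun m : P => act r.+1 l (ctr r (cgen r m s))).
  by apply: (lin_app (act r.+1 l)); apply: (lin_app (ctr r)); exact: cgen_linl.
move: m; apply: (eq_fgen (F := mklin ll) (G := mklin rl)) => b h u.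
rewrite -[LHS]/(ctr r (act r l (cgen r _ s))) -[RHS]/(act r.+1 l (ctr r (cgen r _ s))).
rewrite cyc_ctrE // !(cyc_actE f_g S_stable) ?size_rcons ?sr //.
rewrite (sws_linf hH l _ (linearP (ctr r))); apply: eq_sws => x y.
rewrite actL_rcons (actL_linf _ _ _ _ (linearP (ctr r))); apply: eq_actL => v z sv.
rewrite -[bm_r _ _]/(bm_r (fgen (pureE b h) u) (inv x)).
rewrite fgen_r fgen_l ctr_inH; last by rewrite sv.
by apply: eq_sws => y1 y2; rewrite fgen_r fgen_l.
Qed.

Lemma V_act r l c : V r (act r l c) = act r.+1 l (V r c).
Proof. by rewrite -[LHS]/(_ *: ctr r _) ctr_act -linearZ_LR. Qed.

Definition cyc_J : {linear U -> cobj C 0} :=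
  mklin (lin_comp (cgen_linl S (erefl (size ([::] : seq A)))) (@fgen_linr k E N 1)).

Lemma cyc_JE u : cyc_J u = cgen 0 (fgen 1 u) [::].
Proof. by []. Qed.

Lemma cyc_mu_ex : exists mu : {linear tens H U -> cobj C 0},
  forall h u, mu (h \ox u) = act 0 h (cyc_J u).
Proof.
apply: (tens_ext2 (b := fun h u => act 0 h (cyc_J u))) => [u|h]; last by lin.
exact: (cyc_act_linh f_g S_stable).
Qed.
Definition cyc_mu := projT1 (cid cyc_mu_ex).
Lemma cyc_muE h u : cyc_mu (h \ox u) = act 0 h (cyc_J u).
Proof. exact: (projT2 (cid cyc_mu_ex)). Qed.

Lemma act_J h u :
  act 0 h (cyc_J u) = sws h (fun x y => cgen 0 (fgen (inH y) (rmulU (inv x) u)) [::]).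
Proof.
rewrite cyc_JE (cyc_actE f_g S_stable) //; apply: eq_sws => x y.
rewrite -[LHS]/(cgen 0 (bm_l (inH y) (bm_r (fgen 1 u : P) (inv x))) [::]).
by rewrite fgen_r fgen_l mulr1.
Qed.

(** The action puts (1 # h1)^-1 on the right of u; the factor 1 # h1 in this formula is there to
    undo it. *)
Lemma alpha0_ex : exists alpha0 : {linear P -> tens H U}, forall a h u,
  alpha0 (fgen (pureE a h) u) = sws h (fun x y => y \ox rmulU (inA a * inH x) u).
Proof.
pose b a h u : tens H U := sws h (fun x y => y \ox rmulU (inA a * inH x) u).
apply: (@fgen_ext _ _ _ _ _ _ wf N (tens H U) b); rewrite /b.
- move=> h u; apply: lin_sws1 => x y; apply: lin_tensr.
  by apply: (lin_comp (g := rmulU^~ u)); [exact: rmulU_linl | lin].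
- move=> a u; apply: sws_lin; split=> [y|x]; last by lin.
  by apply: lin_tensr; apply: (lin_comp (g := rmulU^~ u)); [exact: rmulU_linl | lin].
- by move=> a h; lin.
Qed.
Definition alpha0 := projT1 (cid alpha0_ex).
Lemma alpha0E a h u : alpha0 (fgen (pureE a h) u) =
  sws h (fun x y => y \ox rmulU (inA a * inH x) u).
Proof. exact: (projT2 (cid alpha0_ex)). Qed.

(** Both sides put t between u and a (1 # h1). Since t is any element of A, this gives the descent
    to cyclic words and also the vanishing on boundaries. *)
Lemma alpha0_comm t m : alpha0 (bm_r m (inA t)) = alpha0 (bm_l (inA t) m).
Proof.
have hl := lin_app alpha0 (@bm_r_linl k E P (inA t)).
have hr := lin_app alpha0 (@bm_l_linr k E P (inA t)).
move: m; apply: (eq_fgen (F := mklin hl) (G := mklin hr)) => a h u.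
rewrite -[LHS]/(alpha0 (bm_r _ (inA t))) -[RHS]/(alpha0 (bm_l (inA t) _)).
rewrite fgen_r fgen_l inA_pure (alpha0E a h) (alpha0E (t * a) h); apply: eq_sws => x y.
by rewrite -rmulUM inAM mulrA.
Qed.

Lemma alpha_ex : exists alpha : {linear cobj C 0 -> tens H U},
  forall m, alpha (cgen 0 m [::]) = alpha0 m.
Proof.
have [|G GE] := @fam_ext _ _ _ _ _ _ fam 0 (tens H U) (fun m _ => alpha0 m).
  split; last by split=> // *; exact: alpha0_comm.
  - by move=> s _; exact: linearP.
  - by move=> m s1 s2 [].
  - by move=> m s1 s2 x [].
by exists G => m; exact: (GE m [::]).
Qed.
Definition alpha := projT1 (cid alpha_ex).
Lemma alphaE m : alpha (cgen 0 m [::]) = alpha0 m.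
Proof. exact: (projT2 (cid alpha_ex)). Qed.

Lemma alpha_d c : alpha (cdiff C 0 c) = 0.
Proof.
have hl := lin_app alpha (linearP (cdiff C 0)).
move: c; apply: (fam_eq fam (h := mklin hl) (h' := \0)) => m [|a []] // _.
rewrite -[LHS]/(alpha (cdiff C 0 (cgen 1 m [:: a]))) (cyc_diffE S m (erefl (size [:: a]))) bd1.
apply: etrans (linearB _ _ _) _; rewrite !alphaE.
by apply/eqP; rewrite subr_eq0; apply/eqP; exact: alpha0_comm.
Qed.

(** By [fam_contraction0] the contraction carries a round to give (1 # h) (x) u a. On the other
    side, mu alpha gives (1 # h3) (x) u a (1 # h1)(1 # h2)^-1, which is the same by the right
    inverse law. *)
Lemma V_0 c : cdiff C 0 (V 0 c) = c - cyc_mu (alpha c).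
Proof.
have hl := lin_app (cdiff C 0) (linearP (V 0)).
have hr := lin_add (@lin_id k (cobj C 0)) (lin_opp (lin_app cyc_mu (linearP alpha))).
move: c; apply: (fam_eq fam (h := mklin hl) (h' := mklin hr)) => m [|//] _.
rewrite -[LHS]/(cdiff C 0 (V 0 _)) -[RHS]/(_ - cyc_mu (alpha _)) alphaE.
have ll : linear (fun m : P => cdiff C 0 (V 0 (cgen 0 m [::]))).
  by apply: (lin_app (cdiff C 0)); apply: (lin_app (V 0)); exact: cgen_linl.
have rl := lin_add (cgen_linl S (erefl (size ([::] : seq A))))
  (lin_opp (lin_app cyc_mu (linearP alpha0))).
move: m; apply: (eq_fgen (F := mklin ll) (G := mklin rl)) => a h u.
have VN y : cdiff C 0 (V 0 y) = - cdiff C 0 (ctr 0 y).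
  by rewrite -linearN; congr (cdiff C 0 _); exact: scaleN1r.
rewrite -[LHS]/(cdiff C 0 (V 0 _)) -[RHS]/(cgen 0 _ [::] - cyc_mu (alpha0 _)) VN.
have ctr0 m : cdiff C 0 (ctr 0 (cgen 0 m [::])) =
    cgen 0 (fam_rmul (incH wf N) (unmul wf N m)) [::] - cgen 0 m [::].
  rewrite -[in X in _ - X](unmulK m).
  exact: (fam_contraction0 fam (@cyc_diffE _ _ _ _ _ _ _ P S) (@unmul_l _ _ _ _ _ _ wf N)
    (@unmul_r _ _ _ _ _ _ wf N) (@incH_r _ _ _ _ _ _ wf N)).
rewrite ctr0 opprB unmulE fam_rmulE incHE.
have -> : bm_r (fgen (inH h) u : resA P) a = fgen (inH h) (rmulU (inA a) u).
  exact: fgen_r.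
congr (_ - _); rewrite alpha0E (sws_linf hH h _ (linearP cyc_mu)).
have gl e := cgen_rmul_lin e u (erefl (size ([::] : seq A))).
transitivity (sws h (fun x r => sws r (fun y z =>
    cgen 0 (fgen (inH z) (rmulU (inA a * (inH x * inv y)) u)) [::]))); last first.
  apply: eq_sws => x r; rewrite cyc_muE act_J; apply: eq_sws => y z.
  by rewrite mulrA rmulUM.
rewrite -(swsA hH h (F := fun x y z =>
    cgen 0 (fgen (inH z) (rmulU (inA a * (inH x * inv y)) u)) [::])); last first.
  split=> [y z|x z|x y].
  - by apply: (lin_comp (g := fun e => cgen 0 (fgen _ (rmulU e u)) [::])); [exact: gl | lin].
  - by apply: (lin_comp (g := fun e => cgen 0 (fgen _ (rmulU e u)) [::])); [exact: gl | lin].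
  - apply: (lin_comp (g := fun e => cgen 0 (fgen e _) [::])); last by lin.
    exact: cgen_fgen_lin.
rewrite -(sws_counitl hH h (G := fun z => cgen 0 (fgen (inH z) (rmulU (inA a) u)) [::])); last first.
  apply: (lin_comp (g := fun e => cgen 0 (fgen e _) [::])); last by lin.
  exact: cgen_fgen_lin.
apply: eq_sws => t z.
have l1 : linear (fun e => cgen 0 (fgen (inH z) (rmulU (inA a * e) u)) [::]).
  by apply: (lin_comp (g := fun e => cgen 0 (fgen _ (rmulU e u)) [::])); [exact: gl | lin].
have := congr1 (fun e => cgen 0 (fgen (inH z) (rmulU (inA a * e) u)) [::]) (inH_invr wf f_g t).
move=> e; apply: esym; apply: etrans (esym (sws_linf hH t _ l1)) _; apply: etrans e _.
by apply: etrans (linfZ l1 _ _) _; rewrite mulr1.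
Qed.

(** Here it is the left inverse law that cancels (1 # h1)^-1 (1 # h2). With [V_0] this identifies
    the degree 0 homology of the cyclic complex with H (x) U. *)
Lemma alpha_mu t : alpha (cyc_mu t) = t.
Proof.
have hl := lin_app alpha (linearP cyc_mu).
move: t; apply: (@eq_tens k H U _ (mklin hl) idfun) => h u.
rewrite -[LHS]/(alpha (cyc_mu _)) cyc_muE act_J (sws_linf hH h _ (linearP alpha)).
have ul (y : H) : linear (fun e => y \ox rmulU e u).
  by apply: lin_tensr; exact: rmulU_linl.
transitivity (sws h (fun x r => sws r (fun y z => z \ox rmulU (inv x * inH y) u))).
  apply: eq_sws => x y; rewrite alphaE -[inH y]/(pureE 1 y) alpha0E; apply: eq_sws => y1 z.
  by rewrite inA1 mul1r rmulUM.
rewrite -(swsA hH h (F := fun x y z => z \ox rmulU (inv x * inH y) u)); last first.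
  split=> [y z|x z|x y]; last by lin.
  - by apply: (lin_comp (g := fun e => z \ox rmulU e u)); [exact: ul | lin].
  - by apply: (lin_comp (g := fun e => z \ox rmulU e u)); [exact: ul | lin].
rewrite -[RHS]/(h \ox u) -(sws_counitl hH h (G := fun z => z \ox u)); last by lin.
apply: eq_sws => t z.
have := congr1 (fun e => z \ox rmulU e u) (inH_invl wf f_g t).
move=> e; apply: etrans (esym (sws_linf hH t _ (ul z))) _; apply: etrans e _.
by apply: etrans (linfZ (ul z) _ _) _; rewrite rmulU1.
Qed.

(** No computation with alpha: c is mu (alpha c) plus a boundary, alpha kills boundaries, and mu is
    H-linear with alpha mu = id. *)
Lemma alpha_act l c : alpha (act 0 l c) =
  tmap2 (mull l) (idfun : {linear U -> U}) (alpha c).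
Proof.
have cE : c = cyc_mu (alpha c) + cdiff C 0 (V 0 c) by rewrite V_0 addrC subrK.
rewrite [in LHS]cE !linearD -(cyc_act_chain f_g S_stable) alpha_d addr0.
rewrite -[RHS]alpha_mu; congr (alpha _); move: (alpha c).
have hl := lin_app (act 0 l) (linearP cyc_mu).
have hr := lin_app cyc_mu (linearP (tmap2 (mull l) (idfun : {linear U -> U}))).
apply: (@eq_tens k H U _ (mklin hl) (mklin hr)) => h u.
rewrite -[LHS]/(act 0 l (cyc_mu _)) -[RHS]/(cyc_mu (tmap2 _ _ _)).
rewrite tmap2E !cyc_muE; apply: esym; exact: (cyc_actM f_g S_stable fS).
Qed.

Lemma hopf_acyclic n x : cdiff (hopf_cplx hH C act) n x = 0 -> is_bdry x.
Proof.
move: x; have l1 r c := @cyc_act_linh _ _ _ _ _ _ _ _ f_g _ S_stable P r c.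
have l2 r c := @cyc_act1 _ _ _ _ _ _ _ _ f_g _ S_stable P r c.
have l3 r := @cyc_actM _ _ _ _ _ _ _ _ f_g _ S_stable fS P r.
exact: (@tot_acyclic k H hH C act l1 l2 l3 V V_act (@cyc_ctrS _ _ _ _ _ _ wf S N)
  U alpha cyc_J cyc_mu cyc_muE V_0 alpha_d alpha_act n).
Qed.

End FreeCyclicAction.

(** * Split sequences and degree 0 *)

Section Averaging.
Variables (k : comNzRingType) (E T : algType k) (tau : T -> E).
Hypothesis tau_lin : linear tau.
Hypothesis tauM : forall s t, tau (s * t) = tau s * tau t.
Hypothesis tau1 : tau 1 = 1.
Variable e : tens T T.
Hypothesis e_sep : sep_idem e.
Local Notation L := (trep e).

Section OneMap.
Variables (X Y : bimodule E) (q : {linear X -> Y}).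

(** One copy of the separability idempotent for each side; s e = e s lets an element of S cross from
    the argument of q to the outside. *)
Definition avg_fun (x : X) : Y := \sum_(p <- L) \sum_(p' <- L)
  bm_l (tau p.1) (bm_r (q (bm_l (tau p.2) (bm_r x (tau p'.1)))) (tau p'.2)).

Lemma avg_linear : linear avg_fun.
Proof.
by apply: linear_sumf => p; apply: linear_sumf => p'; lin.
Qed.

Definition avg : {linear X -> Y} := mklin avg_linear.

Lemma avg_l t x : avg (bm_l (tau t) x) = bm_l (tau t) (avg x).
Proof.
have tl (U : lmodType k) (b : U -> T) : linear b -> linear (fun u => tau (b u)).
  exact: (@lin_comp _ _ _ _ tau).
pose F (u v : T) := \sum_(p' <- L)
  bm_l (tau u) (bm_r (q (bm_l (tau v) (bm_r x (tau p'.1)))) (tau p'.2)).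
have [||G GE] := @tens_ext2 k T T Y F.
- by move=> v; apply: linear_sumf => p'; lin; exact: tau_lin.
- by move=> u; apply: linear_sumf => p'; lin; exact: tau_lin.
(* The relation s e = e s is an equation of tensors, so the summand is first made a linear map G on
   T (x) T, which carries the relation over to the sum. *)
have := congr1 G (e_sep.2 t); rewrite !linear_sum => h.
transitivity (\sum_(p <- L) F p.1 (p.2 * t)).
  apply: eq_bigr => p _; apply: eq_bigr => p' _.
  by rewrite (bm_lrA (tau t)) tauM bm_lA.
transitivity (\sum_(p <- L) F (t * p.1) p.2).
  rewrite (eq_bigr _ (fun p _ => esym (GE p.1 (p.2 * t)))) -h.
  by apply: eq_bigr => p _; rewrite GE.
rewrite (linf_sum (@bm_l_linr _ _ Y (tau t))); apply: eq_bigr => p _.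
rewrite (linf_sum (@bm_l_linr _ _ Y (tau t))); apply: eq_bigr => p' _.
by rewrite tauM bm_lA.
Qed.

Lemma avg_r t x : avg (bm_r x (tau t)) = bm_r (avg x) (tau t).
Proof.
have tl (U : lmodType k) (b : U -> T) : linear b -> linear (fun u => tau (b u)).
  exact: (@lin_comp _ _ _ _ tau).
pose F (u v : T) := \sum_(p <- L)
  bm_l (tau p.1) (bm_r (q (bm_l (tau p.2) (bm_r x (tau u)))) (tau v)).
have [||G GE] := @tens_ext2 k T T Y F.
- by move=> v; apply: linear_sumf => p'; lin; exact: tau_lin.
- by move=> u; apply: linear_sumf => p'; lin; exact: tau_lin.
have := congr1 G (e_sep.2 t); rewrite !linear_sum => h.
transitivity (\sum_(p <- L) F (t * p.1) p.2).
  rewrite /= /avg_fun exchange_big; apply: eq_bigr => p _; apply: eq_bigr => p' _.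
  by rewrite tauM bm_rA.
transitivity (\sum_(p <- L) F p.1 (p.2 * t)).
  rewrite (eq_bigr _ (fun p _ => esym (GE p.1 (p.2 * t)))) -h.
  by apply: eq_bigr => p _; rewrite GE.
rewrite /= /avg_fun exchange_big.
rewrite (linf_sum (@bm_r_linl _ _ Y (tau t))); apply: eq_bigr => p _.
rewrite (linf_sum (@bm_r_linl _ _ Y (tau t))); apply: eq_bigr => p' _.
by rewrite tauM bm_rA -(bm_lrA (tau _) _ (tau t)).
Qed.

End OneMap.

(** Averaging commutes with composition by maps of bimodules, on this side and in [avg_pre]. So the
    identities for r i, p s and i r + s p survive it. *)
Lemma avg_post (X Y Z : bimodule E) (j : {linear Y -> Z}) (q : {linear X -> Y})
    (q' : {linear X -> Z}) x :
  is_bmor j -> (forall x, j (q x) = q' x) -> j (avg q x) = avg q' x.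
Proof.
move=> [jl jr] jq; rewrite /= /avg_fun linear_sum; apply: eq_bigr => p _.
by rewrite linear_sum; apply: eq_bigr => p' _; rewrite jl jr jq.
Qed.

Lemma avg_pre (X Y Z : bimodule E) (i : {linear X -> Y}) (q : {linear Y -> Z})
    (q' : {linear X -> Z}) x :
  is_bmor i -> (forall x, q (i x) = q' x) -> avg q (i x) = avg q' x.
Proof.
move=> [il ir] iq; apply: eq_bigr => p _; apply: eq_bigr => p' _.
by rewrite -ir -il iq.
Qed.

Lemma avgD (X Y : bimodule E) (q1 q2 q : {linear X -> Y}) x :
  (forall x, q1 x + q2 x = q x) -> avg q1 x + avg q2 x = avg q x.
Proof.
move=> qE; rewrite /= /avg_fun -big_split; apply: eq_bigr => p _.
rewrite -big_split; apply: eq_bigr => p' _.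
by rewrite -qE (linfD (@bm_r_linl _ _ Y _)) (linfD (@bm_l_linr _ _ Y _)).
Qed.

(** For the identity the two factors of each copy of e become adjacent and multiply to 1. *)
Lemma avg_id (X : bimodule E) x : avg (idfun : {linear X -> X}) x = x.
Proof.
have sumL : \sum_(p <- L) tau p.1 * tau p.2 = 1.
  rewrite -tau1 -e_sep.1 (linf_sum tau_lin).
  by apply: eq_bigr => p _; rewrite tauM.
transitivity (\sum_(p <- L) bm_l (tau p.1 * tau p.2) (\sum_(p' <- L) bm_r x (tau p'.1 * tau p'.2))).
  apply: eq_bigr => p _; rewrite (linf_sum (@bm_l_linr _ _ X _)); apply: eq_bigr => p' _.
  by rewrite /= bm_lA bm_lrA bm_rA.
rewrite -(linf_sum (f := fun u => bm_l u _)) ?sumL ?bm_l1; last by lin.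
by rewrite -(linf_sum (f := fun u => bm_r x u)) ?sumL ?bm_r1 //; lin.
Qed.

End Averaging.

(** * Induced maps of total complexes *)

Section TotalMap.
Variables (k : comNzRingType) (H : algType k) (hH : hopf H).

Definition dbl_map (C C' : cplx k) (F : degmap C C') r s :
  {linear dbl_obj H C r s -> dbl_obj H C' r s} :=
  tmap2 (F r) (idfun : {linear tpow (Hbar H) s -> _}).

Lemma dbl_mapE (C C' : cplx k) (F : degmap C C') r s c (t : tpow (Hbar H) s) :
  dbl_map F r s (c \ox t) = F r c \ox t.
Proof. exact: tmap2E. Qed.

Lemma dbl_mapK (C C' : cplx k) (F : degmap C C') (G : degmap C' C) r s x :
  (forall n x, G n (F n x) = x) -> dbl_map G r s (dbl_map F r s x) = x.
Proof.
move=> GF; have hl := lin_app (dbl_map G r s) (linearP (dbl_map F r s)).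
move: x; apply: (eq_dbl (h := mklin hl) (h' := idfun)) => c t.
by rewrite -[LHS]/(dbl_map G r s (dbl_map F r s _)) !dbl_mapE GF.
Qed.

Lemma dbl_map_split (C C' C'' : cplx k) (fi : degmap C C') (fr : degmap C' C)
    (fp : degmap C' C'') (fs : degmap C'' C') r s x :
  (forall n x, fi n (fr n x) + fs n (fp n x) = x) ->
  dbl_map fi r s (dbl_map fr r s x) + dbl_map fs r s (dbl_map fp r s x) = x.
Proof.
move=> isp; have hl := lin_add (lin_app (dbl_map fi r s) (linearP (dbl_map fr r s)))
  (lin_app (dbl_map fs r s) (linearP (dbl_map fp r s))).
move: x; apply: (eq_dbl (h := mklin hl) (h' := idfun)) => c t.
rewrite -[LHS]/(dbl_map fi r s (dbl_map fr r s _) + dbl_map fs r s (dbl_map fp r s _)).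
rewrite !dbl_mapE -[RHS]/(c \ox t) -[in RHS](isp _ c).
exact/esym/(linfD (ptens_linl t)).
Qed.

Section Map.
Variables (C C' : cplx k) (F : degmap C C').

Definition tot_map_fun n (x : tot_obj H C n) : tot_obj H C' n :=
  fun p => dbl_map F _ _ (x p).
Lemma tot_map_linear n : linear (@tot_map_fun n).
Proof.
move=> c x y; apply: functional_extensionality_dep => p.
exact: (linearP (dbl_map F (val p).1 (val p).2) c (x p) (y p)).
Qed.
Definition tot_map n : {linear tot_obj H C n -> tot_obj H C' n} := mklin (@tot_map_linear n).

Variable act : forall r, H -> {linear cobj C r -> cobj C r}.
Hypothesis act_linh : forall r c, linear (fun h => act r h c).
Hypothesis act1 : forall r c, act r 1 c = c.
Hypothesis actM : forall r h l c, act r (h * l) c = act r h (act r l c).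
Variable act' : forall r, H -> {linear cobj C' r -> cobj C' r}.
Hypothesis act_linh' : forall r c, linear (fun h => act' r h c).
Hypothesis act1' : forall r c, act' r 1 c = c.
Hypothesis actM' : forall r h l c, act' r (h * l) c = act' r h (act' r l c).
Hypothesis F_chain : chain_map F.
Hypothesis F_act : forall r h c, F r (act r h c) = act' r h (F r c).

Lemma dbl_map_v r s x :
  dbl_map F r s (dbl_v H C r s x) = dbl_v H C' r s (dbl_map F r.+1 s x).
Proof.
have hl := lin_app (dbl_map F r s) (linearP (dbl_v H C r s)).
have hr := lin_app (dbl_v H C' r s) (linearP (dbl_map F r.+1 s)).
move: x; apply: (eq_dbl (h := mklin hl) (h' := mklin hr)) => c t.
rewrite -[LHS]/(dbl_map F r s (dbl_v H C r s _)).
rewrite -[RHS]/(dbl_v H C' r s (dbl_map F r.+1 s _)).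
rewrite (dbl_vE hH act_linh act1 actM) (dbl_vE hH act_linh' act1' actM').
rewrite tmap2E [LHS]dbl_mapE [X in tmap2 _ _ X]dbl_mapE tmap2E.
by rewrite F_chain.
Qed.

Lemma dbl_map_h r s x :
  dbl_map F r s (dbl_h hH act r s x) = dbl_h hH act' r s (dbl_map F r s.+1 x).
Proof.
rewrite (dbl_hE hH act_linh act1 actM) (dbl_hE hH act_linh' act1' actM') linearZ_LR.
by rewrite (@row_d_map k H hH C C' act act_linh act1 actM act' act_linh' act1' actM') // => *; exact: F_act.
Qed.

Lemma tot_map_chain : @chain_map k (hopf_cplx hH C act) (hopf_cplx hH C' act') tot_map.
Proof.
move=> n x; apply: functional_extensionality_dep => p.
rewrite -[LHS]/(dbl_map F _ _ (dbl_v H C _ _ (x (bideg_l p)) + dbl_h hH act _ _ (x (bideg_r p)))).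
rewrite -[RHS]/(dbl_v H C' _ _ (dbl_map F _ _ (x (bideg_l p))) +
  dbl_h hH act' _ _ (dbl_map F _ _ (x (bideg_r p)))).
by rewrite linearD dbl_map_v dbl_map_h.
Qed.

End Map.

Lemma tot_mapK (C C' : cplx k) (F : degmap C C') (G : degmap C' C) n x :
  (forall n x, G n (F n x) = x) -> tot_map G n (tot_map F n x) = x.
Proof.
by move=> GF; apply: functional_extensionality_dep => p; exact: (dbl_mapK _ GF).
Qed.

Lemma tot_map_split (C C' C'' : cplx k) (fi : degmap C C') (fr : degmap C' C)
    (fp : degmap C' C'') (fs : degmap C'' C') n x :
  (forall n x, fi n (fr n x) + fs n (fp n x) = x) ->
  tot_map fi n (tot_map fr n x) + tot_map fs n (tot_map fp n x) = x.
Proof.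
by move=> isp; apply: functional_extensionality_dep => p; exact: (dbl_map_split _ isp).
Qed.

End TotalMap.

Section Corner.
Variables (k : comNzRingType) (H : algType k) (hH : hopf H) (C : cplx k).
Variable act : forall r, H -> {linear cobj C r -> cobj C r}.
Local Notation D := (hopf_cplx hH C act).

Definition tot00 (t : dbl_obj H C 0 0) : tot_obj H C 0 :=
  fun p => let: exist q e := p in
  match q return (q.1 + q.2 == 0)%N -> dbl_obj H C q.1 q.2 with
  | (0, 0) => fun=> t
  | _ => fun=> 0
  end e.

Definition tot10 (t : dbl_obj H C 1 0) : tot_obj H C 1 :=
  fun p => let: exist q e := p in
  match q return (q.1 + q.2 == 1)%N -> dbl_obj H C q.1 q.2 with
  | (1, 0) => fun=> t
  | _ => fun=> 0
  end e.

Definition tot01 (t : dbl_obj H C 0 1) : tot_obj H C 1 :=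
  fun p => let: exist q e := p in
  match q return (q.1 + q.2 == 1)%N -> dbl_obj H C q.1 q.2 with
  | (0, 1) => fun=> t
  | _ => fun=> 0
  end e.

Lemma tot00_lin : linear tot00.
Proof.
by move=> a c c'; apply: functional_extensionality_dep => -[[[|r] [|s]] e].
Qed.

Definition corner (x : tot_obj H C 0) : dbl_obj H C 0 0 :=
  tcomp x (eqxx 0 : (0 + 0 == 0)%N).

Lemma corner_lin : linear corner.
Proof. by []. Qed.

Lemma cornerK x : tot00 (corner x) = x.
Proof. by apply: tcomp_ext => -[|r] [|s] // e; rewrite (tcomp_eta x e (eqxx 0)). Qed.

Lemma tot10E t : cdiff D 0 (tot10 t) = tot00 (dbl_v H C 0 0 t).
Proof.
apply: tcomp_ext => -[|r] [|s] // e.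
rewrite (tcompD hH act _ e (e : (1 + 0 == 1)%N) (e : (0 + 1 == 1)%N)).
by apply: etrans (addr0 _); congr (_ + _); exact: linear0.
Qed.

Lemma tot01E t : cdiff D 0 (tot01 t) = tot00 (dbl_h hH act 0 0 t).
Proof.
apply: tcomp_ext => -[|r] [|s] // e.
rewrite (tcompD hH act _ e (e : (1 + 0 == 1)%N) (e : (0 + 1 == 1)%N)).
by apply: etrans (add0r _); congr (_ + _); exact: linear0.
Qed.

Lemma corner_d x : corner (cdiff D 0 x) =
  dbl_v H C 0 0 (tcomp x (eqxx 1 : (1 + 0 == 1)%N)) +
  dbl_h hH act 0 0 (tcomp x (eqxx 1 : (0 + 1 == 1)%N)).
Proof. exact: tcompD. Qed.

End Corner.

(** * Degree 0 of the homology of H with cyclic coefficients *)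

Section Degree0.
Variables (k : comNzRingType) (H : algType k) (hH : hopf H) (A : algType k).
Variables (w : weakAction hH A) (f g : {linear tens H H -> A}) (wf : is_crossed w f).
Hypothesis f_g : conv_inverse hH f g.
Variable S : subalgClosed A.
Hypothesis S_stable : forall (h : H) (a : A), a \in S -> w h a \in S.
Hypothesis fS : forall h l : H, f (h \ox l) \in S.
Variable M : bimodule (crossed wf).
Local Notation E := (crossed wf).
Local Notation C := (cyc M S).
Local Notation cgen := (cgen S).
Local Notation sws := (sws hH).
Local Notation eps := (eps hH).
Local Notation inA := (inA wf).
Local Notation inH := (inH wf).
Local Notation inv := (inH_inv g wf).
Local Notation pureE := (pureE wf).
Local Notation act := (cyc_act g M S).
Local Notation fam := (cyc_fam M S).
Local Notation D := (hopf_cplx hH C act).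
Local Notation Q := (quotm (@comm k E M)).

Let act_linh r (c : cobj C r) := @cyc_act_linh _ _ _ _ _ _ _ _ f_g _ S_stable M r c.
Let act1 r (c : cobj C r) := @cyc_act1 _ _ _ _ _ _ _ _ f_g _ S_stable M r c.
Let actM r h l (c : cobj C r) := @cyc_actM _ _ _ _ _ _ _ _ f_g _ S_stable fS M r h l c.
Local Notation rgen := (@rgen k H hH C act act_linh act1 actM).
Local Notation rowfam := (@row_fam k H hH C act act_linh act1 actM).

Lemma cls_comm e m : cls (@comm k E M) (bm_l e m) = cls (@comm k E M) (bm_r m e).
Proof. by apply/clsE/spanp_sub; exists e, m. Qed.

Lemma gen0_lin : linear (fun m : M => cgen 0 m [::] : cobj C 0).
Proof. by have [gm _ _ _] := cgen_good M S 0; exact: gm. Qed.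

Lemma cyc_theta_ex : exists th : {linear cobj C 0 -> Q},
  forall m, th (cgen 0 m [::]) = cls _ m.
Proof.
have [|G GE] := @fam_ext _ _ _ _ _ _ fam 0 Q (fun m _ => cls _ (m : M)).
  split; last by split=> // m1 m2 s _; rewrite -cls_comm.
  - by move=> s _; exact: linearP.
  - by move=> m s1 s2 [].
  - by move=> m s1 s2 x [].
by exists G => m; exact: (GE m [::]).
Qed.
Definition cyc_theta := projT1 (cid cyc_theta_ex).
Lemma cyc_thetaE m : cyc_theta (cgen 0 m [::]) = cls _ m.
Proof. exact: (projT2 (cid cyc_theta_ex)). Qed.

Lemma cyc_theta_d c : cyc_theta (cdiff C 0 c) = 0.
Proof.
have hl := lin_app cyc_theta (linearP (cdiff C 0)).
move: c; apply: (fam_eq fam (h := mklin hl) (h' := \0)) => m [|a []] // _.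
rewrite -[LHS]/(cyc_theta (cdiff C 0 (cgen 1 m [:: a]))) (cyc_diffE S m (erefl (size [:: a]))) bd1.
apply: etrans (linearB _ _ _) _; rewrite !cyc_thetaE.
by apply/eqP; rewrite subr_eq0; apply/eqP/esym; exact: cls_comm.
Qed.

(** Modulo commutators the factor 1 # h2 moves from the left of m to its far right, where it cancels
    against (1 # h1)^-1. *)
Lemma cyc_theta_act h c : cyc_theta (act 0 h c) = eps h *: cyc_theta c.
Proof.
have hl := lin_app cyc_theta (linearP (act 0 h)).
have hr := lin_scale (eps h) (linearP cyc_theta).
move: c; apply: (fam_eq fam (h := mklin hl) (h' := mklin hr)) => m [|//] _.
rewrite -[LHS]/(cyc_theta (act 0 h _)) -[RHS]/(_ *: cyc_theta _) cyc_thetaE.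
rewrite (cyc_actE f_g S_stable) // (sws_linf hH h _ (linearP cyc_theta)).
have l1 : linear (fun e => cls (@comm k E M) (bm_r (m : M) e)) by lin.
have := congr1 (fun e => cls (@comm k E M) (bm_r (m : M) e)) (inH_invl wf f_g h).
move=> e; transitivity (sws h (fun x y => cls (@comm k E M) (bm_r (m : M) (inv x * inH y)))).
  apply: eq_sws => x y.
  rewrite -[LHS]/(cyc_theta (cgen 0 (bm_l (inH y) (bm_r (m : M) (inv x))) [::])).
  by rewrite cyc_thetaE cls_comm bm_rA.
apply: etrans (esym (sws_linf hH h _ l1)) _; apply: etrans e _.
by apply: etrans (linfZ l1 _ _) _; rewrite bm_r1.
Qed.

Lemma row_aug_ex : exists ra : {linear dbl_obj H C 0 0 -> cobj C 0},
  forall c, ra (@rgen 0 0 c [::]) = c.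
Proof.
have [|G GE] := @fam_ext _ _ _ _ _ _ (rowfam 0) 0 (cobj C 0) (fun c _ => c).
  split; last first.
    by split=> // c1 c2 s ->; rewrite bm_r1 bm_l1.
  - by [].
  - by move=> m s1 s2 [].
  - by move=> m s1 s2 x [].
by exists G => c; exact: (GE c [::]).
Qed.
Definition row_aug := projT1 (cid row_aug_ex).
Lemma row_augE c : row_aug (@rgen 0 0 c [::]) = c.
Proof. exact: (projT2 (cid row_aug_ex)). Qed.

Lemma rgen0_lin r : linear (fun c : cobj C r => @rgen r 0 c [::]).
Proof. by have [gm _ _ _] := rgen_good hH act_linh act1 actM r 0; exact: gm. Qed.

Lemma row_augK x : @rgen 0 0 (row_aug x) [::] = x.
Proof.
have hl := lin_comp (@rgen0_lin 0) (linearP row_aug).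
move: x; apply: (fam_eq (rowfam 0) (h := mklin hl) (h' := idfun)) => c [|//] _.
by rewrite -[LHS]/(@rgen 0 0 (row_aug _) [::]) row_augE.
Qed.

Definition in00 (c : cobj C 0) : tot_obj H C 0 := tot00 (@rgen 0 0 c [::]).

Lemma in00_lin : linear in00.
Proof. by apply: (lin_comp (@tot00_lin k H C)); exact: rgen0_lin. Qed.

Definition tot_aug : {linear tot_obj H C 0 -> cobj C 0} :=
  mklin (lin_app row_aug (@corner_lin k H C)).

Lemma tot_augK x : in00 (tot_aug x) = x.
Proof. by rewrite /in00 row_augK cornerK. Qed.

Lemma tot_aug_in c : tot_aug (in00 c) = c.
Proof. exact: row_augE. Qed.

Lemma in10E c : cdiff D 0 (tot10 (@rgen 1 0 c [::])) = in00 (cdiff C 0 c).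
Proof. by rewrite tot10E (@dbl_v_gen _ _ hH _ _ act_linh act1 actM). Qed.

Lemma in01E h c : cdiff D 0 (tot01 (@rgen 0 1 c [:: h])) = in00 (eps h *: c - act 0 h c).
Proof.
rewrite tot01E (@dbl_hE k H hH C act act_linh act1 actM) scale1r row_dE // bd1.
by congr tot00; exact/esym/(linfB (@rgen0_lin 0)).
Qed.

Definition hopf_theta : {linear cobj D 0 -> Q} := mklin (lin_app cyc_theta (linearP tot_aug)).

Lemma hopf_theta_in m : hopf_theta (in00 (cgen 0 m [::])) = cls _ m.
Proof. by rewrite -[LHS]/(cyc_theta (tot_aug _)) tot_aug_in cyc_thetaE. Qed.

Lemma hopf_theta_surj y : exists x, hopf_theta x = y.
Proof.
elim/quotm_ind: y => m; exists (in00 (cgen 0 m [::])); exact: hopf_theta_in.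
Qed.

Lemma hopf_theta_d x : hopf_theta (cdiff D 0 x) = 0.
Proof.
rewrite -[LHS]/(cyc_theta (row_aug (corner (cdiff D 0 x)))) corner_d !linearD.
move: (tcomp _ _) (tcomp _ _) => v u.
have -> : cyc_theta (row_aug (dbl_v H C 0 0 u)) = 0.
  have hl := lin_app cyc_theta (lin_app row_aug (linearP (dbl_v H C 0 0))).
  move: u; apply: (fam_eq (rowfam 1) (h := mklin hl) (h' := \0)) => c [|//] _.
  rewrite -[LHS]/(cyc_theta (row_aug (dbl_v H C 0 0 _))).
  by rewrite (@dbl_v_gen _ _ hH _ _ act_linh act1 actM) row_augE cyc_theta_d.
rewrite add0r.
have hl := lin_app cyc_theta (lin_app row_aug (linearP (@dbl_h k H hH C act 0 0))).
move: v; apply: (fam_eq (rowfam 0) (h := mklin hl) (h' := \0)) => c [|h []] // _.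
rewrite -[LHS]/(cyc_theta (row_aug (@dbl_h k H hH C act 0 0 _))).
rewrite (@dbl_hE k H hH C act act_linh act1 actM) scale1r row_dE // bd1 linearB !row_augE linearB.
by rewrite -[bm_l h c]/(act 0 h c) cyc_theta_act [X in X - _](linearZ_LR cyc_theta) subrr.
Qed.

Local Notation Z := (quotm [set x : cobj D 0 | is_bdry x]).
Local Notation q m := (cls [set x : cobj D 0 | is_bdry x] (in00 (cgen 0 m [::]))).

Lemma q_lin : linear (fun m : M => q m).
Proof. by apply: lin_cls; apply: (lin_comp in00_lin); exact: gen0_lin. Qed.

Lemma bdry_cls (x y : cobj D 0) : is_bdry (x - y) ->
  cls [set x : cobj D 0 | is_bdry x] x = cls [set x : cobj D 0 | is_bdry x] y.
Proof. by move=> xy; apply/clsE/spanp_sub. Qed.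

Lemma q_inA a m : q (bm_r m (inA a)) = q (bm_l (inA a) m).
Proof.
apply: bdry_cls; exists (tot10 (@rgen 1 0 (cgen 1 m [:: a]) [::])).
rewrite in10E (cyc_diffE S m (erefl (size [:: a]))) bd1.
exact/esym/(linfB in00_lin).
Qed.

(** These are the horizontal boundaries in total degree 0; the vertical ones were used in
    [q_inA]. *)
Lemma q_act h c : cls [set x : cobj D 0 | is_bdry x] (in00 (act 0 h c)) =
  eps h *: cls [set x : cobj D 0 | is_bdry x] (in00 c).
Proof.
rewrite -linearZ_LR -(linfZ in00_lin); apply/esym/bdry_cls; exists (tot01 (@rgen 0 1 c [:: h])).
by rewrite in01E (linfB in00_lin).
Qed.

(** By [q_act], n (1 # h) has the class of h2 acting on n (1 # h1), that is of (1 # h3) n (1 # h1)(1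
    # h2)^-1, and the last two factors cancel. With [q_inA] this reaches every commutator of E. *)
Lemma q_inH h n : q (bm_l (inH h) n) = q (bm_r n (inH h)).
Proof.
have l1 z : linear (fun e => q (bm_l (inH z) (bm_r n e))).
  by apply: (lin_comp q_lin); lin.
have l2 : linear (fun e => q (bm_r n (inH e))) by apply: (lin_comp q_lin); lin.
have l3 : linear (fun e => q (bm_l (inH e) n)) by apply: (lin_comp q_lin); lin.
rewrite -[RHS](sws_counitr hH h l2) -[LHS](sws_counitl hH h l3).
transitivity (sws h (fun x r => sws r (fun y z =>
    q (bm_l (inH z) (bm_r n (inH x * inv y)))))); last first.
  apply: eq_sws => x r; rewrite -q_act (cyc_actE f_g S_stable) //.
  rewrite (sws_linf hH r _ (lin_cls [set x : cobj D 0 | is_bdry x] in00_lin)).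
  apply: eq_sws => y z.
  rewrite -[RHS]/(q (bm_l (inH z) (bm_r (bm_r n (inH x)) (inv y)))).
  by rewrite bm_rA.
rewrite -(swsA hH h (F := fun x y z => q (bm_l (inH z) (bm_r n (inH x * inv y))))); last first.
  split=> [y z|x z|x y].
  - by apply: (lin_comp (l1 z)); lin.
  - by apply: (lin_comp (l1 z)); lin.
  - by apply: (lin_comp q_lin); lin.
apply: eq_sws => t z.
have e := congr1 (fun e => q (bm_l (inH z) (bm_r n e))) (inH_invr wf f_g t).
apply: esym; apply: etrans (esym (sws_linf hH t _ (l1 z))) _; apply: etrans e _.
by apply: etrans (linfZ (l1 z) _ _) _; rewrite bm_r1.
Qed.

Lemma q_comm (e : E) (m : M) : q (bm_l e m) = q (bm_r m e).
Proof.
have hl : linear (fun e => q (bm_l e m)) := lin_comp q_lin (@bm_l_linl _ _ M m).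
have hr : linear (fun e => q (bm_r m e)) := lin_comp q_lin (@bm_r_linr _ _ M m).
move: e; apply: (@eq_tens k A H Z (mklin hl) (mklin hr)) => a h.
rewrite -[LHS]/(q (bm_l (pureE a h) m)) -[RHS]/(q (bm_r m (pureE a h))).
by rewrite pureEE bm_lA -q_inA bm_lrA q_inH bm_rA.
Qed.

(** By [q_comm] the class of m modulo boundaries depends only on its class in M/[E, M]. The
    resulting map psi sends theta x back to the class of x, so theta x = 0 forces x to be a
    boundary. *)
Lemma hopf_theta0 x : hopf_theta x = 0 <-> is_bdry x.
Proof.
split=> [th0|[y ->]]; last exact: hopf_theta_d.
have [|psi psiE] := @quotm_ext k M Z (@comm k E M) (mklin q_lin).
  move=> _ [e [m ->]]; rewrite linearB.
  by apply/eqP; rewrite subr_eq0; apply/eqP; exact: q_comm.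
have psi_theta c : psi (cyc_theta c) = cls [set x : cobj D 0 | is_bdry x] (in00 c).
  have hl := lin_app psi (linearP cyc_theta).
  have hr := lin_cls [set x : cobj D 0 | is_bdry x] in00_lin.
  move: c; apply: (fam_eq fam (h := mklin hl) (h' := mklin hr)) => m [|//] _.
  by rewrite -[LHS]/(psi (cyc_theta _)) cyc_thetaE psiE.
have := psi_theta (tot_aug x); rewrite tot_augK.
rewrite [cyc_theta _]th0 linear0 => /esym/cls_eq0.
by move=> /spanp_id; apply; exact: (is_bdry_submod (@lin_id k (cobj D 0))).
Qed.

End Degree0.

Section HopfResolving.
Variables (k : comNzRingType) (H : algType k) (hH : hopf H) (A : algType k).
Variables (w : weakAction hH A) (f g : {linear tens H H -> A}) (wf : is_crossed w f).
Hypothesis f_g : conv_inverse hH f g.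
Variable S : subalgClosed A.
Hypothesis S_sep : separable (salg S).
Hypothesis S_stable : forall (h : H) (a : A), a \in S -> w h a \in S.
Hypothesis fS : forall h l : H, f (h \ox l) \in S.
Local Notation E := (crossed wf).
Local Notation inA := (inA wf).
Local Notation act M := (cyc_act g M S).
Local Notation F M := (hopf_cplx hH (cyc M S) (act M)).
Local Notation theta := (hopf_theta f_g S_stable fS).

Definition inS (s : salg S) : E := inA (val s).

Lemma inS_lin : linear inS.
Proof. by move=> c s t; rewrite /inS linearP; exact: inA_lin. Qed.
Lemma inSM s t : inS (s * t) = inS s * inS t.
Proof. by rewrite /inS rmorphM inAM. Qed.
Lemma inS1 : inS 1 = 1.
Proof. by rewrite /inS rmorph1. Qed.

Section Bilinear.
Variables (e : tens (salg S) (salg S)) (e_sep : sep_idem e).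
Variables (X Y : bimodule E) (q : {linear X -> Y}).

Lemma avg_inA_l s m : s \in S -> avg inS e q (bm_l (inA s) m) = bm_l (inA s) (avg inS e q m).
Proof.
move=> Ss; pose t : salg S := exist (fun x => x \in (S : {pred A})) s Ss.
exact: (avg_l inS_lin inSM e_sep q t m).
Qed.

Lemma avg_inA_r s m : s \in S -> avg inS e q (bm_r m (inA s)) = bm_r (avg inS e q m) (inA s).
Proof.
move=> Ss; pose t : salg S := exist (fun x => x \in (S : {pred A})) s Ss.
exact: (avg_r inS_lin inSM e_sep q t m).
Qed.

End Bilinear.

Section Maps.
Variables (X Y : bimodule E) (q : {linear X -> Y}).
Hypothesis ql : forall s m, s \in S -> q (bm_l (inA s) m) = bm_l (inA s) (q m).
Hypothesis qr : forall s m, s \in S -> q (bm_r m (inA s)) = bm_r (q m) (inA s).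
Local Notation cm := (cyc_map ql qr).

Lemma row_aug_map t : row_aug f_g S_stable fS Y (dbl_map H cm 0 0 t) =
  cm 0 (row_aug f_g S_stable fS X t).
Proof.
have hl := lin_app (row_aug f_g S_stable fS Y) (linearP (dbl_map H cm 0 0)).
have hr := lin_app (cm 0) (linearP (row_aug f_g S_stable fS X)).
have l1 r (c : cobj (cyc X S) r) := @cyc_act_linh _ _ _ _ _ _ _ _ f_g _ S_stable X r c.
have l2 r (c : cobj (cyc X S) r) := @cyc_act1 _ _ _ _ _ _ _ _ f_g _ S_stable X r c.
have l3 r h l (c : cobj (cyc X S) r) :=
  @cyc_actM _ _ _ _ _ _ _ _ f_g _ S_stable fS X r h l c.
move: t; apply: (fam_eq (@row_fam k H hH (cyc X S) (act X) l1 l2 l3 0)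
  (h := mklin hl) (h' := mklin hr)) => c [|//] _.
rewrite -[LHS]/(row_aug f_g S_stable fS Y (dbl_map H cm 0 0 (c \ox _))).
rewrite -[RHS]/(cm 0 (row_aug f_g S_stable fS X _)) row_augE dbl_mapE.
exact: row_augE.
Qed.

Lemma cyc_theta_map (q_mor : is_bmor q) x m :
  cyc_theta S X x = cls _ m -> cyc_theta S Y (cm 0 x) = cls _ (q m).
Proof.
have ql' := lin_cls (@comm k E Y) (linearP q).
have [|Q QE] := @quotm_ext k X _ (@comm k E X) (mklin ql').
  move=> _ [e [z ->]]; apply/cls_eq0/spanp_sub; exists e, (q z).
  by rewrite linearB q_mor.1 q_mor.2.
suff e : cyc_theta S Y (cm 0 x) = Q (cyc_theta S X x) by rewrite e => ->; exact: QE.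
have hl := lin_app (cyc_theta S Y) (linearP (cm 0)).
have hr := lin_app Q (linearP (cyc_theta S X)).
move: x; apply: (fam_eq (cyc_fam X S) (h := mklin hl) (h' := mklin hr)) => z [|//] _.
rewrite -[LHS]/(cyc_theta S Y (cm 0 _)) -[RHS]/(Q (cyc_theta S X _)).
by rewrite cyc_mapE // !cyc_thetaE QE.
Qed.

End Maps.

(** The maps i and p commute with the action of H and induce chain maps. The splittings r and s are
    averaged first, because only S-bilinear maps pass to cyclic words; they induce maps in each
    degree. *)
Lemma hopf_resolving : @resolving k E (fun M => F M) theta.
Proof.
have l1 (M : bimodule E) r (c : cobj (cyc M S) r) := @cyc_act_linh _ _ _ _ _ _ _ _ f_g _ S_stable M r c.
have l2 (M : bimodule E) r (c : cobj (cyc M S) r) := @cyc_act1 _ _ _ _ _ _ _ _ f_g _ S_stable M r c.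
have l3 (M : bimodule E) r h l (c : cobj (cyc M S) r) :=
  @cyc_actM _ _ _ _ _ _ _ _ f_g _ S_stable fS M r h l c.
have l4 (M : bimodule E) r h (c : cobj (cyc M S) r.+1) :=
  @cyc_act_chain _ _ _ _ _ _ _ _ f_g _ S_stable M r h c.
split=> [K P M i p r s i_mor p_mor riK psK isp|V n x|V n x|M|M].
- have [e e_sep] := S_sep.
  have mor_l (X Y : bimodule E) (q : {linear X -> Y}) : is_bmor q ->
      forall t m, t \in S -> q (bm_l (inA t) m) = bm_l (inA t) (q m).
    by move=> [ql _] t m _; exact: ql.
  have mor_r (X Y : bimodule E) (q : {linear X -> Y}) : is_bmor q ->
      forall t m, t \in S -> q (bm_r m (inA t)) = bm_r (q m) (inA t).
    by move=> [_ qr] t m _; exact: qr.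
  pose ci := cyc_map (mor_l _ _ _ i_mor) (mor_r _ _ _ i_mor).
  pose cp := cyc_map (mor_l _ _ _ p_mor) (mor_r _ _ _ p_mor).
  pose cr := cyc_map (avg_inA_l e_sep r) (avg_inA_r e_sep r).
  pose cs := cyc_map (avg_inA_l e_sep s) (avg_inA_r e_sep s).
  have crK n x : cr n (ci n x) = x.
    have hl := lin_app (cr n) (linearP (ci n)).
    move: x; apply: (fam_eq (cyc_fam K S) (h := mklin hl) (h' := idfun)) => m t tn.
    rewrite -[LHS]/(cr n (ci n _)) !cyc_mapE //.
    by rewrite (avg_pre inS e (q' := idfun) m i_mor riK) (avg_id inS_lin inSM inS1 e_sep).
  have csK n x : cp n (cs n x) = x.
    have hl := lin_app (cp n) (linearP (cs n)).
    move: x; apply: (fam_eq (cyc_fam M S) (h := mklin hl) (h' := idfun)) => m t tn.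
    rewrite -[LHS]/(cp n (cs n _)) !cyc_mapE //.
    by rewrite (avg_post inS e (q' := idfun) m p_mor psK) (avg_id inS_lin inSM inS1 e_sep).
  have cisp n x : ci n (cr n x) + cs n (cp n x) = x.
    have hl := lin_add (lin_app (ci n) (linearP (cr n))) (lin_app (cs n) (linearP (cp n))).
    move: x; apply: (fam_eq (cyc_fam P S) (h := mklin hl) (h' := idfun)) => m t tn.
    rewrite -[LHS]/(ci n (cr n _) + cs n (cp n _)) !cyc_mapE //.
    have [gm _ _ _] := cgen_good P S n.
    rewrite -(linfD (gm t tn)); congr (cgen S n _ t).
    pose ir : {linear P -> P} := mklin (lin_app i (linearP r)).
    pose sp : {linear P -> P} := mklin (lin_app s (linearP p)).
    rewrite (avg_post inS e (q' := ir) m i_mor) // (avg_pre inS e (q' := sp) m p_mor) //.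
    rewrite (avgD inS e (q1 := ir) (q2 := sp) (q := idfun) m isp).
    exact: (avg_id inS_lin inSM inS1 e_sep).
  exists (tot_map H ci), (tot_map H cp), (tot_map H cr), (tot_map H cs); split; first split.
  + apply: (@tot_map_chain k H hH (cyc K S) (cyc P S) ci (act K) (l1 K) (l2 K) (l3 K)
      (act P) (l1 P) (l2 P) (l3 P)); first exact: cyc_map_chain.
    by move=> n h c; exact: cyc_map_act.
  + apply: (@tot_map_chain k H hH (cyc P S) (cyc M S) cp (act P) (l1 P) (l2 P) (l3 P)
      (act M) (l1 M) (l2 M) (l3 M)); first exact: cyc_map_chain.
    by move=> n h c; exact: cyc_map_act.
  + by move=> n x; exact: tot_mapK.
  + by move=> n x; exact: tot_mapK.
  + by move=> n x; exact: tot_map_split.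
  + move=> x m; rewrite -[theta K x]/(cyc_theta S K (row_aug f_g S_stable fS K (corner x))).
    move=> xm; rewrite -[LHS]/(cyc_theta S P (row_aug f_g S_stable fS P
      (dbl_map H ci 0 0 (corner x)))).
    by rewrite row_aug_map; exact: cyc_theta_map.
- exact: (tot_dd (l1 _) (l2 _) (l3 _) (l4 _) (@cyc_dd _ _ _ _ _ _ _ S _)).
- exact: (hopf_acyclic f_g S_stable fS).
- exact: hopf_theta_surj.
- exact: hopf_theta0.
Qed.

End HopfResolving.

Theorem theorem3p1p5p1
  (k : comNzRingType) (H : algType k) (hH : hopf H) (A : algType k)
  (w : weakAction hH A) (f finv : {linear tens H H -> A})
  (wf : is_crossed w f) (f_finv : conv_inverse hH f finv)
  (M : bimodule (crossed wf))
  (S : subalgClosed A) (S_sep : separable (salg S))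
  (S_stable : forall (h : H) (a : A), a \in S -> w h a \in S)
  (fS : forall h l : H, f (h \ox l) \in S)
  (n : nat) :
  exists phi : {linear homology (hochschild M) n ->
                 homology (hopf_cplx hH (cyc M S) (cyc_act finv M S)) n},
    bijective phi.
Proof.
exact: (resolving_iso n M (@hoch_resolving k (crossed wf))
  (hopf_resolving wf f_finv S_sep S_stable fS)).
Qed.
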